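(* Let $m\geq 1$ be an integer and assume that the polynomials $P(m,m+1,x)$ and $Q(m,m+1,x)$ are irreducible over $\mathbf{Q}$. Then $\operatorname{Gal}_{\mathbf{Q}} P(m,m+1,x)\supseteq A_m$ and $\operatorname{Gal}_{\mathbf{Q}} Q(m,m+1,x)\supseteq A_{m+1}$ (as permutation groups on the roots). Furthermore: (1) $\operatorname{Gal}_{\mathbf{Q}} P(m,m+1,x)\simeq A_m$ if and only if $m\equiv 0 \pmod 4$ or $m=2(2k+1)^2-1$ for some integer $k\geq 0$; (2) $\operatorname{Gal}_{\mathbf{Q}} Q(m,m+1,x)\simeq A_{m+1}$ if and only if $m=(2k+1)^2-1$ for some integer $k\geq 1$.
   Context: For positive integers $u,v$ define $P(u,v,x)=\sum_{j=0}^{u}\frac{(u+v-j)!}{v!}\binom{u}{j}x^j$ and $Q(u,v,x)=\sum_{j=0}^{v}\frac{(u+v-j)!}{u!}\binom{v}{j}(-x)^j$ (the normalized Padé approximants of the truncated exponential polynomial). $P(u,v,x)$ has degree $u$ and $Q(u,v,x)$ has degree $v$. $\operatorname{Gal}_{\mathbf{Q}} f$ denotes the Galois group of the splitting field of $f$ over $\mathbf{Q}$, viewed as a subgroup of the symmetric group on the roots of $f$. *)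

(* Defs.v *)
From HB Require Import structures.
From mathcomp Require Import all_boot all_order all_algebra.
From mathcomp Require Import all_fingroup all_solvable all_field.

Set Implicit Arguments.
Unset Strict Implicit.
Unset Printing Implicit Defensive.

Import GRing.Theory.
Local Open Scope ring_scope.

Definition padeP (u v : nat) : {poly rat} :=
  \sum_(j < u.+1) ((u + v - j)`!%:R / v`!%:R * 'C(u, j)%:R) *: 'X^j.

Definition padeQ (u v : nat) : {poly rat} :=
  \sum_(j < v.+1) ((u + v - j)`!%:R / u`!%:R * 'C(v, j)%:R) *: (- 'X) ^+ j.

(* [L] is a splitting field of [p] over the rationals, and [rs] lists the roots
   of [p] in [L]; this is [splittingFieldFor 1 p fullv] with the root list, which
   that predicate quantifies away, kept as a parameter. *)
Definition is_splitting_field (p : {poly rat}) (L : splittingFieldType rat)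
    (rs : seq L) : Prop :=
  map_poly (in_alg L) p %= \prod_(z <- rs) ('X - z%:P) /\ <<1 & rs>>%VS = fullv.

(* The Galois group of [L] over the rationals as permutations of the finite type
   [seq_sub rs] of the elements of [rs] (without repetition). *)
Definition galois_perm (L : splittingFieldType rat) (rs : seq L) :
    {set {perm seq_sub rs}} :=
  [set s : {perm seq_sub rs} |
    [exists g in 'Gal({:L} / 1%AS)%g, forall r : seq_sub rs, val (s r) == g (val r)]].

Lemma galois_perm_group_set (L : splittingFieldType rat) (rs : seq L) :
  group_set (galois_perm rs).
Proof.
apply/group_setP; split.
  rewrite inE; apply/existsP; exists 1%g; rewrite group1 /=.
  by apply/forallP => r; rewrite perm1 gal_id.
move=> s t; rewrite !inE => /exists_inP[g gG /forallP gs].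
move=> /exists_inP[h hG /forallP ht].
apply/exists_inP; exists (g * h)%g; first by rewrite groupM.
apply/forallP => r; rewrite permM (eqP (ht _)) (eqP (gs _)).
by rewrite galM ?memvf.
Qed.

Canonical galois_perm_group (L : splittingFieldType rat) (rs : seq L) :=
  Group (galois_perm_group_set rs).

Lemma is_splitting_field_exists (p : {poly rat}) : p != 0 ->
  exists (L : splittingFieldType rat) (rs : seq L), is_splitting_field p rs.
Proof.
move=> p0.
have [rs Dp] := closed_field_poly_normal (map_poly ratr p : {poly algC}).
have [L [LtoC [s Ds genL]]] := num_field_exists rs.
have Dprod : map_poly (in_alg L) p %= \prod_(z <- s) ('X - z%:P).
  rewrite -(eqp_map LtoC) -map_poly_comp.
  rewrite (_ : map_poly _ p = map_poly ratr p); last first.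
    by apply: eq_map_poly => a; rewrite /= alg_num_field fmorph_rat.
  have -> : map_poly LtoC (\prod_(z <- s) ('X - z%:P)) = \prod_(z <- rs) ('X - z%:P).
    rewrite rmorph_prod -Ds big_map.
    by apply: eq_bigr => z _; rewrite /= map_polyXsubC.
  by rewrite Dp eqp_scale // lead_coef_eq0 map_poly_eq0.
have splitL : SplittingField.axiom L.
  exists (map_poly (in_alg L) p); last by exists s.
  by apply/polyOver1P; exists p.
pose M : splittingFieldType rat :=
  HB.pack L (FieldExt_isSplittingField.Build rat L splitL).
by exists M, s.
Qed.

(* Main.v *)
(* Up to sign and scaling, P(m,m+1,x) and Q(m,m+1,-x) are the monic Laguerre
   polynomials sum_j C(n,j) (r+1)...(r+n-j) x^j for (n,r) = (m,m+1), (m+1,m).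
   A Galois group that is transitive of degree n contains A_n as soon as its
   order is divisible by a prime p with n/2 < p < n-2 (Jordan): an element of
   order p is then a p-cycle. Such a p exists for n >= 8 by Bertrand's postulate,
   and p divides the order because the Newton polygon of the polynomial at p has
   a slope with denominator p, so that p ramifies. In degrees 4 to 7 a factor
   pattern modulo a suitable prime supplies, through Frobenius, a 3-cycle.
   Given A_n, equality with A_n is decided by whether the discriminant, known in
   closed form by Schur's recurrence argument, is a rational square. *)
Require Import Defs.
From HB Require Import structures.
From mathcomp Require Import all_boot all_order all_algebra.
From mathcomp Require Import all_fingroup all_solvable all_field.
From mathcomp Require Import generic_quotient ring_quotient.
From mathcomp Require boolp classical_sets.
From mathcomp Require Import zify ring lra.

Set Implicit Arguments.
Unset Strict Implicit.
Unset Printing Implicit Defensive.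

(** * Primes between n and 2n - 2 *)

Section Bertrand.
Local Open Scope nat_scope.

(** No valuation is extended to the splitting field. A prime [q] enters through a ring morphism
    [phi] from the algebraic integers of that field onto a field of characteristic [q]: local units
    are the elements with [phi x != 0], and the valuation statement e v(a) = v(q) is written
    [s * a ^+ e = w * q%:R] with local units [s] and [w]. The same [phi] provides the Frobenius
    elements. The delicate point on the Newton polygon is that, depending on the multiples of [p]
    between r+1 and n+r, it has one side over the roots in [ker phi] or two, of lengths k and [p]
    with k < p. In the second case a root in [ker phi] may belong to the short side; that not all of
    them do follows by comparing valuations of the product of the roots. Jordan's theorem is usually
    stated for primitive groups. Here a cycle longer than half of the points lets transitivity
    suffice, since a set of more than half of the points meets all its translates. Irreducibility
    enters as transitivity and as distinctness of the roots. *)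

Lemma mul_bin_central n :
  n.+1 * 'C(n.+1.*2, n.+1) = 2 * (n.*2.+1 * 'C(n.*2, n)).
Proof.
have E1 := mul_bin_diag n.*2.+2 n; have E2 := mul_bin_down n.*2.+1 n.
rewrite /= in E2; rewrite doubleS -E1.
rewrite (_ : n.*2.+1 - n = n.+1) in E2; last by lia.
rewrite E2; move: 'C(_, _) => X; lia.
Qed.

Lemma leq_exp4_bin_central n : 0 < n -> 4 ^ n <= n.*2 * 'C(n.*2, n).
Proof.
elim: n => // -[|n] IH _; first by [].
have E := mul_bin_central n.+1; have := IH isT.
rewrite [4 ^ n.+2]expnS; move: E; set A := 'C(n.+2.*2, _); set B := 'C(_, _).
move: (4 ^ _) A B => X A B. nia.
Qed.

(** The two equal central terms in the expansion of (1 + 1)^(2n+1) add up to at most 2 * 4^n. *)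
Lemma bin_odd_leq_exp4 n : 'C(n.*2.+1, n) <= 4 ^ n.
Proof.
have := Pascal 1 1 n.*2.+1; rewrite addn1.
have n1 : n < n.*2.+2 by lia.
have n2 : n.+1 < n.*2.+2 by lia.
rewrite (bigD1 (Ordinal n1)) //= (bigD1 (Ordinal n2)) /=; last first.
  by rewrite -val_eqE /=; lia.
rewrite !exp1n !mul1n !muln1.
have -> : 'C(n.*2.+1, n.+1) = 'C(n.*2.+1, n).
  by rewrite -bin_sub; [congr 'C(_, _); lia | lia].
move: (\sum_(_ | _) _) => Y.
rewrite expnS -mul2n expnM; move: (_ ^ n) 'C(_, _) => X Z; lia.
Qed.

Lemma prime_dvd_fact p n : prime p -> (p %| n`!) = (p <= n).
Proof.
move=> pp; elim: n => [|n IH]; first by rewrite fact0 dvdn1; case: p pp => [|[]].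
rewrite factS Euclid_dvdM // IH [p <= n.+1]leq_eqVlt ltnS.
case: (leqP p n) => [|np]; first by rewrite !orbT.
rewrite !orbF; apply/idP/eqP => [/dvdn_leq|->] //; lia.
Qed.

Lemma prime_dvd_bin p n k : prime p -> k < p -> n - k < p -> p <= n ->
  p %| 'C(n, k).
Proof.
move=> pp kp nkp pn; have kn : k <= n by lia.
have := prime_dvd_fact n pp; rewrite pn -(bin_fact kn) !Euclid_dvdM //.
by rewrite !prime_dvd_fact // [p <= k]leqNgt kp [p <= n - k]leqNgt nkp !orbF.
Qed.

Definition primorial n := \prod_(p < n.+1 | prime p) p.

Lemma primorialS n :
  primorial n.+1 = (if prime n.+1 then n.+1 else 1) * primorial n.
Proof. by rewrite /primorial big_mkcond big_ord_recr /= -big_mkcond mulnC. Qed.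

Lemma dvdn_primes_prod (n : nat) (I : seq nat) : uniq I -> {in I, forall p, prime p} ->
  {in I, forall p, p %| n} -> \prod_(p <- I) p %| n.
Proof.
elim: I n => [|p I IH] n /=; first by rewrite big_nil dvd1n.
move=> /andP[pI uI] Hp Hn; rewrite big_cons Gauss_dvd.
  rewrite Hn ?mem_head //= IH // => q qI; first by apply: Hp; rewrite inE qI orbT.
  by apply: Hn; rewrite inE qI orbT.
have pp : prime p by apply: Hp; rewrite mem_head.
rewrite prime_coprime // Euclid_dvd_prod //.
rewrite big_has; apply/hasPn => q qI /=; apply/negP.
have pq : prime q by apply: Hp; rewrite inE qI orbT.
by rewrite dvdn_prime2 // => /eqP E; rewrite E qI in pI.
Qed.

(** Erdos's induction: an even number above 2 adds no prime, and the primes from k+2 to 2k+1 all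
    divide the binomial coefficient C(2k+1, k), which is at most 4^k. *)
Lemma primorial_leq_exp4 n : primorial n <= 4 ^ n.
Proof.
elim/ltn_ind: n => -[|n] IH; first by rewrite /primorial big_mkcond big_ord_recl big_ord0.
have [on|en] := boolP (odd n.+1); last first.
  case: n en IH => // -[|n] en IH; first by rewrite /primorial big_mkcond !big_ord_recr big_ord0.
  rewrite primorialS ifN; first by rewrite mul1n expnS (leq_trans (IH _ _)) ?leq_pmull.
  by apply/negP => /even_prime [//|]; rewrite (negbTE en).
have [k nk] : exists k, n = k.*2 by exists n./2; lia.
have IHk : primorial k.+1 <= 4 ^ k.+1.
  have [->|k0] := posnP k; first by rewrite /primorial big_mkcond !big_ord_recr big_ord0.
  by apply: IH; lia.
have -> : primorial n.+1 = primorial k.+1 * \prod_(p <- [seq p <- index_iota k.+2 n.+2 | prime p]) p.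
  rewrite /primorial big_filter; rewrite -!(big_mkord prime id).
  by rewrite -big_cat_nat //; lia.
have -> : 4 ^ n.+1 = 4 ^ k.+1 * 4 ^ k by rewrite -expnD; congr (_ ^ _); lia.
apply: leq_mul => //; apply: leq_trans (bin_odd_leq_exp4 k).
apply: dvdn_leq; first by rewrite bin_gt0; lia.
apply: dvdn_primes_prod; first by rewrite filter_uniq // iota_uniq.
  by move=> p; rewrite mem_filter => /andP[].
move=> p; rewrite mem_filter mem_index_iota => /and3P[pp kp pn].
by apply: prime_dvd_bin => //; lia.
Qed.

(* Legendre's formula: each summand of [logn_fact] contributes at most 1. *)
Lemma exp_logn_bin_central p n : prime p -> 0 < n ->
  p ^ logn p 'C(n.*2, n) <= n.*2.
Proof.
move=> pp n0; have C0 : 0 < 'C(n.*2, n) by rewrite bin_gt0; lia.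
have := bin_fact (leq_addr n n); rewrite addKn addnn => /(congr1 (logn p)).
rewrite !lognM ?muln_gt0 ?fact_gt0 ?C0 // !logn_fact //.
set v := logn _ _ => E.
pose f n k := n %/ p ^ k.
have W N : N <= n.*2 -> \sum_(1 <= k < N.+1) N %/ p ^ k = \sum_(1 <= k < n.*2.+1) N %/ p ^ k.
  move=> Nn; rewrite [RHS](@big_cat_nat _ _ _ N.+1) //=.
  rewrite [X in _ + X]big1_seq ?addn0 // => k /=; rewrite mem_index_iota => /andP[Nk _].
  by rewrite divn_small // (leq_trans _ (ltn_expl k (prime_gt1 pp))) //; lia.
rewrite (W n) in E; last lia.
have le1 : v <= \sum_(1 <= k < n.*2.+1) (p ^ k <= n.*2).
  rewrite -(leq_add2r (\sum_(1 <= k < n.*2.+1) n %/ p ^ k + \sum_(1 <= k < n.*2.+1) n %/ p ^ k)) E.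
  rewrite -!big_split /=; apply: leq_sum => k _.
  have pk : 0 < p ^ k by rewrite expn_gt0 prime_gt0.
  case: (leqP (p ^ k) n.*2) => H; last by rewrite divn_small.
  move: (p ^ k) pk => q q0; have := ltn_ceil n q0.
  move: (n %/ q) => a na; rewrite -ltnS ltn_divLR //.
  by clear -na; nia.
have le2 N t : \sum_(1 <= k < N.+1) (k <= t) <= minn N t.
  elim: N => [|N IH]; first by rewrite big_geq.
  by rewrite big_nat_recr //=; move: IH; case: leqP; lia.
have vt : v <= trunc_log p n.*2.
  apply: leq_trans le1 (leq_trans _ (leq_trans (le2 n.*2 _) (geq_minr _ _))).
  apply: leq_sum => k _; case: (leqP (p ^ k) n.*2) => // H.
  by rewrite trunc_log_max // prime_gt1.
apply: leq_trans (leq_pexp2l _ vt) _; first exact: prime_gt0.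
by apply: trunc_logP; [exact: prime_gt1 | lia].
Qed.

Lemma prod_primes_exp_logn n N : 0 < n -> (forall p, p %| n -> prime p -> p <= N) ->
  n = \prod_(p < N.+1 | prime p) p ^ logn p n.
Proof.
move=> n0 HN; pose M := maxn n N.
have {1}-> : n = \prod_(0 <= p < M.+1 | p \in predT) p ^ logn p n.
  by rewrite -widen_partn ?partnT // leq_maxl.
rewrite -(big_mkord prime (fun p => p ^ logn p n)).
rewrite (big_nat_widen 0 N.+1 M.+1); last by rewrite ltnS leq_maxr.
rewrite big_mkcond [RHS]big_mkcond /=; apply: eq_bigr => p _.
case: ifP => //; case: (boolP (prime p)) => [pp|npp _]; last first.
  by rewrite lognE (negbTE npp).
rewrite ltnS => /= /negbT; rewrite -ltnNge => Np.
by rewrite lognE pp n0; case: ifP => // /HN - /(_ pp); rewrite leqNgt Np.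
Qed.

(** Erdos's bound under the assumption that Bertrand's postulate fails. Since only primes up to 2n -
    3 are excluded, 2n - 1 may be prime; it costs one more factor 2n, hence the exponent [s.+1]. *)
Lemma bin_central_bound n s : 3 <= n -> n.*2 < s.+1 ^ 2 ->
  (forall p, prime p -> n < p -> p.+3 <= n.*2 -> False) ->
  'C(n.*2, n) <= n.*2 ^ s.+1 * 4 ^ (n.*2 %/ 3).
Proof.
move=> n3 ns noP; have C0 : 0 < 'C(n.*2, n) by rewrite bin_gt0; lia.
have le2n p : p %| 'C(n.*2, n) -> prime p -> p <= n.*2.
  move=> pC pp; rewrite -(prime_dvd_fact _ pp).
  have nn : n <= n.*2 by lia.
  by rewrite -(bin_fact nn) dvdn_mulr.
rewrite {1}(prod_primes_exp_logn C0 le2n).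
(* The factors stand for three kinds of primes: those up to [s], contributing at most 2n each; 2n -
   1, the only candidate above n that is left; and the others, which occur at most once and are at
   most 2n/3. *)
pose F p := (if p <= s then n.*2 else 1) *
  ((if p == n.*2.-1 then n.*2 else 1) * (if 3 * p <= n.*2 then p else 1)).
have /leq_trans -> // : \prod_(p < n.*2.+1 | prime p) p ^ logn p 'C(n.*2, n) <=
    \prod_(p < n.*2.+1 | prime p) F p.
  apply: leq_prod => p pp; have := exp_logn_bin_central pp (ltnW (ltnW n3)).
  set X := _ ^ _ => leX; have p0 := prime_gt0 pp.
  rewrite /F; case: (leqP p s) => [_|sp].
    by rewrite (leq_trans leX) // leq_pmulr //; do 2!case: ifP => _; lia.
  rewrite mul1n; case: eqP => [_|np1].
    by rewrite (leq_trans leX) // leq_pmulr //; case: ifP.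
  rewrite mul1n; have v1 : logn p 'C(n.*2, n) <= 1.
    rewrite leqNgt; apply/negP => v2; have := leq_trans (leq_pexp2l p0 v2) leX.
    have : s.+1 ^ 2 <= p ^ 2 by rewrite leq_exp2r.
    by move=> A B; have := leq_trans A B; rewrite leqNgt ns.
  case: ifP => [_|p3].
    by rewrite /X -[leqRHS]expn1 leq_pexp2l.
  have : ~~ (p %| 'C(n.*2, n)); last first.
    by rewrite /X lognE; case: (p %| _) => //; rewrite !andbF.
  apply/negP => pC; have [np|pn] := ltnP n p.
    apply: (noP p pp np); have := ltn_ord p; have : odd p.
      by case: (even_prime pp) => // p2; move: np; rewrite p2; lia.
    by move/eqP: np1; lia.
  (* For 2n/3 < p <= n the prime occurs twice in (2n)! and once in each n!, so it cancels from the
     central binomial coefficient. *)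
  have := congr1 (logn p) (bin_fact (leq_addr n n)); rewrite addKn addnn.
  rewrite !lognM ?muln_gt0 ?fact_gt0 ?C0 //.
  have : 0 < logn p 'C(n.*2, n) by rewrite logn_gt0 mem_primes pp C0.
  have Lf N : N < p ^ 2 -> logn p N`! = N %/ p.
    move=> Np; rewrite logn_fact //; case: N Np => [|N] Np; first by rewrite big_geq ?div0n.
    rewrite big_ltn // expn1 big1_seq ?addn0 // => k; rewrite mem_index_iota => /andP[_ /andP[k1 _]].
    by rewrite divn_small // (leq_trans Np) // leq_pexp2l.
  have n2p : n.*2 < p ^ 2.
    by rewrite (leq_trans ns) // leq_exp2r.
  rewrite !Lf //; last by rewrite (leq_ltn_trans _ n2p) //; lia.
  have -> : n.*2 %/ p = 2.
    by apply/eqP; rewrite eqn_leq -ltnS ltn_divLR // leq_divRL //; lia.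
  have -> : n %/ p = 1.
    by apply/eqP; rewrite eqn_leq -ltnS ltn_divLR // leq_divRL //; lia.
  by lia.
rewrite /F big_split /= big_split /= mulnA.
apply: leq_mul; last first.
  apply: leq_trans (primorial_leq_exp4 _); rewrite /primorial -big_mkcondr.
  rewrite -(big_mkord (fun p => prime p && (3 * p <= n.*2)) id) /=.
  rewrite -(big_mkord prime id) (big_nat_widen 0 (n.*2 %/ 3).+1 n.*2.+1); last first.
    by rewrite ltnS leq_div.
  by apply: eq_leq; apply: eq_bigl => p; rewrite ltnS leq_divRL // mulnC.
rewrite expnS mulnC; apply: leq_mul.
  rewrite big_mkcond /= (bigD1 (inord n.*2.-1)) //= big1 ?muln1.
    by rewrite !inordK ?eqxx; [case: ifP => _; lia|lia].
  move=> i /negbTE ni; case: ifP => // _; case: eqP => // Ei.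
  by move: ni; rewrite -val_eqE /= inordK ?Ei ?eqxx //; lia.
have -> : \prod_(p < n.*2.+1 | prime p) (if p <= s then n.*2 else 1) =
    n.*2 ^ count (fun p => prime p && (p <= s)) (iota 0 n.*2.+1).
  rewrite -big_mkcondr -(big_mkord (fun p => prime p && (p <= s)) (fun=> n.*2)).
  by rewrite -big_filter big_const_seq count_predT size_filter iter_muln_1.
apply: leq_pexp2l; first lia.
rewrite -size_filter -[leqRHS](size_iota 1); apply: uniq_leq_size.
  by rewrite filter_uniq // iota_uniq.
move=> p; rewrite mem_filter mem_iota => /andP[/andP[pp ps] _].
by rewrite mem_iota prime_gt0 //= ltnS.
Qed.

Lemma bertrand_large n : 8 * 1024 <= n -> exists2 p, prime p & (n < p) && (p.+3 <= n.*2).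
Proof.
move=> nl.
case: (boolP (has (fun p => prime p && (p.+3 <= n.*2)) (iota n.+1 n))) => [|/hasPn noP].
  by case/hasP=> p; rewrite mem_iota => /andP[np _] /andP[pp p3]; exists p; rewrite ?np.
(* With 2n enclosed between 4^j and 4^(j+1), the number 2^(j+1) exceeds the square root of 2n and
   all bounds become comparisons of exponents of 2. The threshold 8 * 1024 gives j >= 7, the point
   from which 16 (j + 1) <= 2^j. *)
pose j := trunc_log 4 n.*2.
have n0 : 0 < n.*2 by lia.
have j1 : 4 ^ j <= n.*2 by apply: trunc_logP.
have j2 : n.*2 < 4 ^ j.+1 by apply: trunc_log_ltn.
have j7 : 7 <= j by apply: trunc_log_max => //; move: nl; rewrite (_ : 4 ^ 7 = 2 * (8 * 1024)) //; lia.
pose s := (2 ^ j.+1).-1; have Es : s.+1 = 2 ^ j.+1 by rewrite prednK ?expn_gt0.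
have := @bin_central_bound n s; rewrite Es -expnM mulnC expnM => /(_ _ j2).
rewrite (leq_trans _ nl) // => /(_ isT).
move=> B; have {}B : 'C(n.*2, n) <= n.*2 ^ 2 ^ j.+1 * 4 ^ (n.*2 %/ 3).
  apply: B => p pp np p3; have := noP p; rewrite mem_iota pp p3 np /=.
  by move=> /(_ _)/negP; apply=> //; lia.
have n1 : 0 < n by lia.
have := leq_trans (leq_exp4_bin_central n1) (leq_mul (leqnn n.*2) B).
rewrite mulnA -expnS.
have : n.*2 ^ (2 ^ j.+1).+1 <= 2 ^ (j.+1.*2 * (2 ^ j.+1).+1).
  by rewrite [leqRHS]expnM leq_exp2r // -[j.+1.*2]mul2n expnM ltnW.
move=> X; move/leq_trans => /(_ _ (leq_mul X (leqnn _))).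
rewrite -[4]/(2 ^ 2) -!expnM -expnD leq_exp2l //.
have [x Ex] : exists x, x = 2 ^ j by exists (2 ^ j).
have : 16 * j.+1 <= x.
  rewrite Ex; move: j7; clear; elim: j => // j IH; rewrite leq_eqVlt => /orP[/eqP<-//|].
  by rewrite ltnS => /IH; rewrite expnS; lia.
have : x ^ 2 <= n.*2 by rewrite Ex -expnM mulnC expnM.
rewrite [2 ^ j.+1]expnS -Ex -mulnn => A1 A2 A3; exfalso.
have := leq_trunc_div n.*2 3; move: A1 A2 A3; move: (_ %/ 3) {nl noP n0 j1 j2 j7 s Es B n1 X Ex} => d.
move: @j => j A1 A2 A3 A4; have A5 : 16 * j.+1 * (2 * x).+1 <= x * (2 * x).+1 by rewrite leq_mul2r A2 orbT.
by clear -A1 A2 A3 A4 A5; nia.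
Qed.

Lemma bertrand n : 4 <= n -> exists2 p, prime p & (n < p) && (p.+3 <= n.*2).
Proof.
move=> n4; have [/bertrand_large //|nl] := leqP (8 * 1024) n.
have H p : prime p -> n < p -> p.+3 <= n.*2 -> exists2 p, prime p & (n < p) && (p.+3 <= n.*2).
  by move=> pp H1 H2; exists p => //; rewrite H1.
(* A chain of primes in which each is at most twice its predecessor minus 3, continued past 8 *
   1024. *)
have [?|?] := ltnP n 5; first by apply: (H 5) => //; lia.
have [?|?] := ltnP n 7; first by apply: (H 7) => //; lia.
have [?|?] := ltnP n 11; first by apply: (H 11) => //; lia.
have [?|?] := ltnP n 19; first by apply: (H 19) => //; lia.
have [?|?] := ltnP n 31; first by apply: (H 31) => //; lia.
have [?|?] := ltnP n 59; first by apply: (H 59) => //; lia.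
have [?|?] := ltnP n 113; first by apply: (H 113) => //; lia.
have [?|?] := ltnP n 223; first by apply: (H 223) => //; lia.
have [?|?] := ltnP n 443; first by apply: (H 443) => //; lia.
have [?|?] := ltnP n 883; first by apply: (H 883) => //; lia.
have [?|?] := ltnP n 1759; first by apply: (H 1759) => //; lia.
have [?|?] := ltnP n 3511; first by apply: (H 3511) => //; lia.
have [?|?] := ltnP n (7 * 1000 + 19); first by apply: (H (7 * 1000 + 19)) => //; lia.
by apply: (H (14 * 1000 + 33)) => //; lia.
Qed.

End Bertrand.

(** * Permutation groups containing a cycle of prime length *)

Section Jordan.
Import GroupScope.
Variables (T : finType) (G : {group {perm T}}).
Implicit Types (D E B : {set T}) (x y z : T) (g h k : {perm T}).

Definition fixer D := 'C_G(~: D | 'P).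

Lemma fixerP D h :
  reflect (h \in G /\ forall x, x \notin D -> h x = x) (h \in fixer D).
Proof.
rewrite inE; apply: (iffP andP) => -[hG hD]; split=> //.
  by move=> x xD; apply: (astabP hD); rewrite inE.
by apply/astabP => x; rewrite inE; apply: hD.
Qed.

Lemma fixer_mem D h x : h \in fixer D -> (h x \in D) = (x \in D).
Proof.
move=> hF; have S k y : k \in fixer D -> k y \notin D -> y \notin D.
  by case/fixerP=> _ kD /[dup] /kD /perm_inj ->.
apply/idP/idP; apply: contraTT; last exact: S.
by move=> xD; have [_ /(_ x xD)->] := fixerP _ _ hF.
Qed.

Lemma fixer_sub D E : D \subset E -> fixer D \subset fixer E.
Proof.
move=> /subsetP DE; apply/subsetP => h /fixerP[hG hD]; apply/fixerP; split=> // x xE.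
by apply: hD; apply: contraNN xE => /DE.
Qed.

(** Rudio's separation property of primitive groups: some [h] puts [x] inside [B] and [y] outside.
    The extension argument uses primitivity on [D] in this form. *)
Definition rudio (H : {set {perm T}}) D := forall B x y,
  B \subset D -> B != set0 -> B != D -> x \in D -> y \in D -> x != y ->
  exists2 h, h \in H & (h x \in B) && (h y \notin B).

Lemma rudioS (H K : {set {perm T}}) D : H \subset K -> rudio H D -> rudio K D.
Proof.
move=> /subsetP HK rH B x y B1 B2 B3 x1 y1 xy.
by have [h /HK hK hxy] := rH B x y B1 B2 B3 x1 y1 xy; exists h.
Qed.

Lemma rudio_ntransitive (H : {group {perm T}}) D :
  [transitive^2 H, on D | 'P] -> rudio H D.
Proof.
move=> tr B x y BD /set0Pn[u uB] BnD xD yD xy.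
have [v vD vB] : exists2 v, v \in D & v \notin B.
  by apply/subsetPn; apply: contraNN BnD => DB; rewrite eqEsubset BD.
have d1 : [tuple x; y] \in 2.-dtuple(D).
  by rewrite !inE memtE subset_all /= !mem_seq1 xy xD yD.
have d2 : [tuple u; v] \in 2.-dtuple(D).
  rewrite !inE memtE subset_all /= !mem_seq1 (subsetP BD) // vD !andbT.
  by apply: contraNneq vB => <-.
have [h hH [hx hy]] := atransP2 tr d1 d2; exists h => //.
by rewrite -![h _]/(aperm _ h) -hx -hy uB vB.
Qed.

Lemma ntransitive1I (H : {group {perm T}}) D :
  [transitive H, on D | 'P] -> [transitive^1 H, on D | 'P].
Proof.
move=> tr; have /imsetP[x xD _] := tr.
by apply: stab_ntransitiveI xD tr _; apply: ntransitive0.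
Qed.

(* Wielandt, Finite Permutation Groups, Theorem 13.1: among the translates of
   [D] meeting [D] and different from it, one that leaves [D] at the fewest
   points leaves it at exactly one point. *)
Lemma ntransitive_step D t g x y :
  (0 < t)%N -> [transitive^ t fixer D, on D | 'P] -> rudio (fixer D) D ->
  g \in G -> x \in D -> g x \in D -> y \in D -> g y \notin D ->
  exists2 z, z \notin D & [transitive^ t.+1 fixer (z |: D), on z |: D | 'P].
Proof.
move=> t0 tr rud; pose A g := [set y in D | g y \notin D].
have [s] := ubnP #|A g|; elim: s g x y => // s IH g x y As gG xD gx yD gy.
have tr1 := ntransitive1 t0 tr.
have [/set0Pn[v vA]|A1] := boolP (A g :\ y != set0).
  have {vA}[vy vD gv] : [/\ v != y, v \in D & g v \notin D].
    by move: vA; rewrite !inE => /and3P.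
  have [| | | // | // | |h0 h0F /andP[h0y h0v]] := rud (A g) y v.
  - by apply/subsetP => w; rewrite inE => /andP[].
  - by apply/set0Pn; exists y; rewrite inE yD.
  - by apply: contraTneq xD => <-; rewrite inE gx andbF.
  - by rewrite eq_sym.
  have h0vD : h0 v \in D by rewrite fixer_mem.
  move: h0y h0v; rewrite !inE h0vD /= negbK => /andP[h0yD gh0y] gh0v.
  (* [k] fixes all points outside g(D) and sends [g (h0 b)] to [g b]. A point of [D] that [k] takes
     out of [D] is therefore some [g (h0 b)] with [b] in [A g], and [b] is not [y] because
     [g (h0 y)] is outside [D]: fewer points leave [D] under [k] than under [g]. *)
  pose k := (h0 ^ g)^-1.
  have kE w : k (g (h0 w)) = g w.
    by apply: (@perm_inj _ (h0 ^ g)); rewrite permKV conjgE !permM permK.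
  have [h0G h0D] := fixerP _ _ h0F.
  have kfix w : g^-1 w \notin D -> k w = w.
    by move=> wD; rewrite -{1}[w](permKV g) -{1}(h0D _ wD) kE permKV.
  (* a point of [D] outside [g D] is fixed by [k] *)
  have [w wD gw] : exists2 w, w \in D & g^-1 w \notin D.
    apply/exists_inP; rewrite -negb_forall_in; apply/negP => /forall_inP H.
    have DgD : D \subset g @: D.
      by apply/subsetP => w /H gw; apply/imsetP; exists (g^-1 w); rewrite ?permKV.
    have /setP/(_ (g y)) : D = g @: D.
      by apply/eqP; rewrite eqEcard DgD (card_imset _ (@perm_inj _ g)) leqnn.
    by rewrite imset_f // (negbTE gy).
  apply: (IH k w (g (h0 v))).
  - move: As; rewrite (cardsD1 y) inE yD gy add1n ltnS; apply: leq_trans; rewrite ltnS.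
    have inj : injective (fun z => h0^-1 (g^-1 z)) by move=> a b /perm_inj/perm_inj.
    rewrite -(card_imset _ inj) subset_leq_card //; apply/subsetP => _ /imsetP[z + ->].
    rewrite !inE => /andP[zD kz]; set b := h0^-1 _.
    have zE : z = g (h0 b) by rewrite !permKV.
    have aD : g^-1 z \in D by apply: contraNT kz => /kfix ->.
    have bD : b \in D by rewrite -(fixer_mem _ h0F) permKV.
    rewrite bD -kE -zE kz !andbT; apply: contraNneq gh0y => <-.
    by rewrite -zE.
  - by rewrite groupV groupJ.
  - by [].
  - by rewrite kfix.
  - by [].
  - by rewrite kE.
have {}A1 : A g = [set y].
  apply/eqP; rewrite eqEsubset sub1set inE yD gy !andbT -setD_eq0.
  by move: A1; rewrite negbK.
(* As [y] is the only point leaving [D], the translate g(D) lies in [E]. The fixer of [D] and its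
   conjugate by [g] then both act inside [E] and together are transitive on it, while the stabiliser
   of [z] is again the fixer of [D]. *)
exists (g y) => //; set z := g y; set E := z |: D.
have gD w : w \in D -> w != y -> g w \in D.
  move=> wD wy; have /setP/(_ w) := A1; rewrite !inE wD (negbTE wy) /=.
  by move/negbT; rewrite negbK.
have FE : fixer D \subset fixer E by apply: fixer_sub; apply: subsetUr.
have FgE h : h \in fixer D -> h ^ g \in fixer E.
  case/fixerP=> hG hD; apply/fixerP; split; first by rewrite groupJ.
  move=> w wE; rewrite conjgE !permM hD ?permKV //.
  apply: contraNN wE => gwD; rewrite !inE; have [gwy|gwy] := eqVneq (g^-1 w) y.
    by rewrite /z -gwy permKV eqxx.
  by rewrite -[w](permKV g) gD ?orbT.
have trE : [transitive fixer E, on E | 'P].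
  apply/imsetP; exists x; first by rewrite !inE xD orbT.
  apply/setP => w; apply/idP/imsetP => [|[h hF ->]]; last first.
    by rewrite /aperm fixer_mem // !inE xD orbT.
  rewrite !inE => /orP[/eqP->|wD].
    have [h1 h1F h1x] := atransP2 tr1 xD gx; have [h hF hx] := atransP2 tr1 xD yD.
    exists (h1 * h ^ g); first by rewrite groupM ?FgE // (subsetP FE).
    by rewrite /= actM /= -h1x /aperm conjgE !permM permK /z hx.
  have [h hF ->] := atransP2 tr1 xD wD; exists h => //; exact: (subsetP FE).
apply: (@stab_ntransitiveI _ _ _ _ _ _ z) => //; first by rewrite !inE eqxx.
have -> : E :\ z = D.
  by rewrite setU1K.
suff -> : 'C_(fixer E)[z | 'P] = fixer D by [].
apply/setP => h; apply/setIP/fixerP => [[/fixerP[hG hE] /astab1P hz]|[hG hD]].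
  split=> // w wD; have [->|wz] := eqVneq w z; first exact: hz.
  by apply: hE; rewrite !inE (negbTE wz).
split; first by apply: (subsetP FE); apply/fixerP.
by apply/astab1P; apply: hD.
Qed.

(** Every extension adds one point and one degree of transitivity. Separation is a hypothesis only
    for the initial set: afterwards the action is 2-transitive and has it automatically. *)
Lemma ntransitive_chain D t :
  (0 < t)%N -> [transitive^ t fixer D, on D | 'P] -> rudio (fixer D) D ->
  (forall E, D \subset E -> E != setT -> exists g x y,
     [/\ g \in G, x \in E, g x \in E, y \in E & g y \notin E]) ->
  [transitive^(t + #|~: D|) G, on setT | 'P].
Proof.
have [d] := ubnP #|~: D|; elim: d D t => // d IH D t Dd t0 tr rud mv.
have [DT|DnT] := eqVneq D setT.
  have FG : fixer D = G.
    apply/setP => h; apply/fixerP/idP => [[]//|hG]; split=> // x.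
    by rewrite DT inE.
  by move: tr; rewrite DT setCT cards0 addn0 -DT FG DT.
have [g [x [y [gG xD gx yD gy]]]] := mv D (subxx _) DnT.
have [z zD trz] := ntransitive_step t0 tr rud gG xD gx yD gy.
have cz : #|~: D| = #|~: (z |: D)|.+1.
  rewrite (cardsD1 z) inE zD add1n; congr _.+1; apply: eq_card => w.
  by rewrite !inE negb_or.
rewrite cz addnS -addSn; apply: IH => //.
- by rewrite -ltnS -cz.
- by apply: rudio_ntransitive; apply: ntransitive_weak trz.
by move=> E DE; apply: mv; apply: subset_trans DE; apply: subsetUr.
Qed.

(** By pigeonhole a set with more than half of the points meets each of its translates; transitivity
    supplies a translate that leaves the set. *)
Lemma move_of_card E : [transitive G, on setT | 'P] -> (#|T| < 2 * #|E|)%N ->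
  E != setT -> exists g x y,
     [/\ g \in G, x \in E, g x \in E, y \in E & g y \notin E].
Proof.
move=> tr cE EnT; have [z _ zE] : exists2 z, z \in setT & z \notin E.
  by apply/subsetPn; rewrite subTset.
have [y yE] : exists y, y \in E by apply/set0Pn; rewrite -card_gt0; lia.
have [g gG zg] := atransP2 tr (in_setT y) (in_setT z).
have [x] : exists x, x \in E :&: (g @^-1: E).
  apply/set0Pn; rewrite -card_gt0; have := cardsUI E (g @^-1: E).
  rewrite (card_preimset _ (@perm_inj _ g)) => e.
  have : (#|E :|: g @^-1: E| <= #|T|)%N by apply: max_card.
  by lia.
rewrite !inE => /andP[xE gxE]; exists g, x, y; split=> //.
by rewrite -[g y]/(aperm y g) -zg.
Qed.

Lemma move_of_2transitive E : [transitive^2 G, on setT | 'P] -> (1 < #|E|)%N ->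
  E != setT -> exists g x y,
     [/\ g \in G, x \in E, g x \in E, y \in E & g y \notin E].
Proof.
move=> tr /card_gt1P[x [y [xE yE xy]]] EnT.
have [z _ zE] : exists2 z, z \in setT & z \notin E.
  by apply/subsetPn; rewrite subTset.
have d1 : [tuple x; y] \in 2.-dtuple([set: T]).
  by rewrite !inE memtE subset_all /= !mem_seq1 !inE xy.
have d2 : [tuple x; z] \in 2.-dtuple([set: T]).
  rewrite !inE memtE subset_all /= !mem_seq1 !inE !andbT.
  by apply: contraNneq zE => <-.
have [g gG [gx gy]] := atransP2 tr d1 d2.
exists g, x, y; split=> //; first by rewrite -[g x]/(aperm x g) -gx.
by rewrite -[g y]/(aperm y g) -gy.
Qed.

End Jordan.

Section PrimeCycle.
Import GroupScope.
Variables (T : finType).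
Implicit Types (G : {group {perm T}}) (c g h : {perm T}) (x y z : T).

Definition support_perm c := [set x | c x != x].

Lemma card_porbit_prime c p x : prime p -> #[c] = p -> c x != x -> #|porbit c x| = p.
Proof.
move=> p_pr oc cx; apply/(prime_nt_dvdP p_pr); last first.
  by rewrite -oc porbitE; apply: dvdn_orbit.
apply: contraNneq cx => /eqP/cards1P[y E].
have : c x \in porbit c x by apply/porbitP; exists 1%N; rewrite expg1.
have := porbit_id c x; rewrite E !inE => /eqP-> /eqP->; exact: eqxx.
Qed.

Section OneCycle.
Variables (c : {perm T}) (p : nat).
Hypotheses (p_pr : prime p) (oc : #[c] = p) (sc : #|support_perm c| = p).
Local Notation D := (support_perm c).

Lemma prime_cycle_porbit x : x \in D -> porbit c x = D.
Proof.
move=> xD; apply/eqP; rewrite eqEcard sc; apply/andP; split.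
  apply/subsetP => _ /porbitP[i ->]; rewrite !inE in xD *.
  by apply: contraNneq xD; rewrite -permM -expgSr expgS permM => /perm_inj->.
by rewrite inE in xD; rewrite (card_porbit_prime p_pr oc xD).
Qed.

Lemma prime_cycle_transitive : [transitive <[c]>, on D | 'P].
Proof.
have [x xD] : exists x, x \in D by apply/set0Pn; rewrite -card_gt0 sc prime_gt0.
by apply/imsetP; exists x => //; rewrite -porbitE (prime_cycle_porbit xD).
Qed.

(** The power [d] of [c] taking [x] to [y] generates [<[c]>]. If no element separated [x] from [y],
    then [B] would be closed under [d] and hence be all of [D]. *)
Lemma prime_cycle_rudio : rudio <[c]> D.
Proof.
move=> B x y BD /set0Pn[b bB] BnD xD yD xy.
have : y \in porbit c x by rewrite prime_cycle_porbit.
case/porbitP=> i yE; set d := c ^+ i in yE; have dc : d \in <[c]> by apply: mem_cycle.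
have dgen : <[c]> = <[d]>.
  apply: nt_gen_prime; first by rewrite -orderE oc.
  by rewrite !inE dc andbT; apply: contraNneq xy => d1; rewrite yE d1 perm1.
apply/exists_inP; apply: contraNT BnD; rewrite negb_exists_in => /forall_inP H.
have {}H h : h \in <[c]> -> h x \in B -> h y \in B.
  by move=> /H; rewrite negb_and negbK => /orP[/negbTE->|].
have Hd n h : h \in <[c]> -> h x \in B -> (h * d ^+ n) x \in B.
  elim: n h => [|n IH] h hc hx; first by rewrite expg0 mulg1.
  rewrite expgS mulgA; apply: IH; first by rewrite groupM.
  have ->: h * d = d * h by apply: (centsP (cycle_abelian c)).
  by rewrite permM -yE; apply: H.
rewrite eqEsubset BD; apply/subsetP => w wD.
have : b \in porbit c x by rewrite prime_cycle_porbit // (subsetP BD).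
rewrite porbitE => /imsetP[h hc bE]; rewrite /= /aperm in bE.
have : w \in porbit c b by rewrite prime_cycle_porbit // (subsetP BD).
rewrite porbitE => /imsetP[k]; rewrite dgen => /cycleP[n ->] ->.
by rewrite /= /aperm bE -permM; apply: Hd; rewrite // -bE.
Qed.

Lemma prime_cycle_ntransitive G : c \in G ->
  (forall E : {set T}, D \subset E -> E != setT -> exists g x y,
     [/\ g \in G, x \in E, g x \in E, y \in E & g y \notin E]) ->
  [transitive^(1 + (#|T| - p)) G, on setT | 'P].
Proof.
move=> cG mv; have cF : <[c]> \subset fixer G D.
  rewrite cycle_subG; apply/fixerP; split=> // x; rewrite inE negbK.
  by move/eqP.
have -> : (#|T| - p)%N = #|~: D| by rewrite [RHS]cardsCs setCK sc.
apply: ntransitive_chain => //.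
  apply: ntransitive1I; apply/imsetP; have /imsetP[x xD Dx] := prime_cycle_transitive.
  exists x => //; apply/eqP; rewrite eqEsubset {1}Dx imsetS //=.
  by apply/subsetP => _ /imsetP[h hF ->]; rewrite /= /aperm (fixer_mem _ hF).
by apply: rudioS prime_cycle_rudio.
Qed.

End OneCycle.

Lemma tperm_conj_ex x y u v : x != y -> u != v ->
  exists z : {perm T}, tperm x y ^ z = tperm u v.
Proof.
move=> xy uv; exists (tperm x u * tperm (tperm x u y) v).
rewrite tpermJ !permM tpermL; congr tperm; last by rewrite tpermL.
rewrite tpermD //; last by rewrite eq_sym.
by rewrite -{2}[u](tpermL x u) (inj_eq perm_inj) eq_sym.
Qed.

(** With at most two cosets, a product of two elements outside [G] lies in [G], so [G] is normal.
    Transpositions being conjugate, any two of them are both inside or both outside, and in either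
    case their product is in [G]. *)
Lemma Alt_sub_index2 G : (#|T|`! <= 2 * #|G|)%N -> 'Alt_T \subset G.
Proof.
rewrite -card_Sym; set S := 'Sym_T => cS.
have inS g : g \in S by rewrite inE.
have GS : G \subset S by apply/subsetP.
have H g h : g \notin G -> h \notin G -> g * h \in G.
  move=> gG hG.
  have GgS : G :|: (g^-1 *: G) = S.
    apply/eqP; rewrite eqEcard; apply/andP; split; first by apply/subsetP.
    rewrite cardsU card_lcoset (_ : _ :&: _ = set0); last first.
      apply/setP => w; rewrite !inE mem_lcoset invgK; apply/andP => -[wG gw].
      by rewrite groupMr in gw; rewrite // gw in gG.
    by rewrite cards0 subn0 addnn -mul2n.
  have := inS h; rewrite -GgS inE (negbTE hG) /= mem_lcoset invgK.
  by [].
have nG g h : h \in G -> h ^ g \in G.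
  move=> hG; have [gG|gG] := boolP (g \in G); first by rewrite groupJ.
  rewrite conjgE; apply: H; rewrite ?groupV //.
  by rewrite groupMl.
apply/subsetP => s; rewrite Alt_even => es.
have [ts sE dp] := prod_tpermP s; rewrite sE.
have {es} : ~~ odd (size ts).
  by move: es; rewrite sE odd_perm_prod.
have [n] := ubnP (size ts); elim: n ts dp {s sE} => // n IH [|t1 [|t2 ts]] //=.
  by rewrite big_nil group1.
move=> /and3P[d1 d2 dp] sz; rewrite negbK => ev; rewrite !big_cons mulgA groupM //.
  have [|t1G] := boolP (tperm t1.1 t1.2 \in G).
    by move=> tG; rewrite groupMl //; have [z <-] := tperm_conj_ex d1 d2; apply: nG.
  have [|t2G] := boolP (tperm t2.1 t2.2 \in G); last exact: H.
  by move=> tG; rewrite groupMr //; have [z <-] := tperm_conj_ex d2 d1; apply: nG.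
by apply: IH => //; lia.
Qed.

Lemma ntransitive_card G t : [transitive^ t G, on setT | 'P] -> #|T| ^_ t %| #|G|.
Proof.
move=> /atrans_dvd; congr (_ %| _); rewrite -cardsT -card_uniq_tuples.
by apply: eq_card => s; rewrite !inE andbC subset_all.
Qed.

(** A 3-cycle makes [G] transitive of degree |T| - 2, and then |T|!/2 divides its order. *)
Lemma Alt_sub_of_3cycle G c : c \in G -> #[c] = 3 -> #|support_perm c| = 3 ->
  (forall E : {set T}, support_perm c \subset E -> E != setT -> exists g x y,
     [/\ g \in G, x \in E, g x \in E, y \in E & g y \notin E]) ->
  'Alt_T \subset G.
Proof.
move=> cG oc sc mv; have := @prime_cycle_ntransitive c 3 isT oc sc G cG mv.
move/ntransitive_card/dvdn_leq; rewrite cardG_gt0 => /(_ isT) le.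
have T3 : (3 <= #|T|)%N by rewrite -sc; apply: max_card.
apply: Alt_sub_index2; move: le; rewrite -(leq_pmul2l (isT : 0 < 2)%N); apply: leq_trans.
have -> : (1 + (#|T| - 3) = #|T| - 2)%N by lia.
by rewrite -(ffact_fact (leq_subr 2 #|T|)) subKn ?(ltnW T3) // mulnC.
Qed.

(** All nontrivial orbits of [c] have [p] points, and two of them would not fit into fewer than 2p
    points. *)
Lemma card_support_of_prime_order c p : prime p -> #[c] = p -> (#|T| < 2 * p)%N ->
  #|support_perm c| = p.
Proof.
move=> p_pr oc T2p; set D := support_perm c.
have card_orb x : x \in D -> #|porbit c x| = p.
  by rewrite inE => cx; apply: card_porbit_prime.
have [x xD] : exists x, x \in D.
  apply/set0Pn; apply/eqP => D0; have : c = 1.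
    by apply/permP => x; have /setP/(_ x) := D0; rewrite !inE perm1 => /negbFE/eqP.
  by move=> c1; move: p_pr; rewrite -oc c1 order1.
rewrite -(card_orb x xD); apply/eqP; rewrite eqn_leq; apply/andP; split; last first.
  apply: subset_leq_card; apply/subsetP => _ /porbitP[i ->]; rewrite !inE in xD *.
  by apply: contraNneq xD; rewrite -permM -expgSr expgS permM => /perm_inj->.
apply: subset_leq_card; apply/subsetP => y yD; apply: contraTT T2p => yx.
have dis : [disjoint porbit c x & porbit c y].
  apply/pred0Pn => -[z /= /andP[]]; rewrite -!eq_porbit_mem => /eqP zx /eqP zy.
  by move: yx; rewrite -eq_porbit_mem -zy zx eqxx.
rewrite -leqNgt mul2n -addnn -{1}(card_orb x xD) -(card_orb y yD).
by rewrite -cardUI (eqP dis) addn0 max_card.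
Qed.

(** Automorphisms of a cyclic group commute, so a commutator of elements normalising [<[c]>] acts
    trivially on it. *)
Lemma commg_cent_cycle c g h : c ^ g \in <[c]> -> c ^ h \in <[c]> ->
  commute c [~ g, h].
Proof.
move=> /cycleP[i ci] /cycleP[j cj].
have E : c ^ (g * h) = c ^ (h * g).
  by rewrite !conjgM ci cj !conjXg ci cj -!expgM mulnC.
have gen k u : c ^ u = c ^+ k -> c \in <[c ^+ k]>.
  move=> cu; rewrite -cu; have : #|<[c ^ u]>| = #|<[c]>| by rewrite -!orderE orderJ.
  have : <[c ^ u]> \subset <[c]> by rewrite cycle_subG cu mem_cycle.
  move=> s e; have /eqP -> : <[c ^ u]> == <[c]> by rewrite eqEcard s e leqnn.
  exact: cycle_id.
have hg : c ^ (h * g) = c ^+ (i * j) by rewrite conjgM cj conjXg ci -expgM.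
have /cycleP[k ck] := gen _ _ hg.
have : commute (c ^+ (i * j)) [~ g, h].
  apply/commgP/conjg_fixP; rewrite -hg -conjgM -commgC.
  exact: E.
by move=> com; rewrite ck; apply/commute_sym/commuteX/commute_sym.
Qed.

(* Wielandt, Theorem 13.9: the normaliser of the [p]-cycle induces the full
   symmetric group on the points it fixes, and commutators of that normaliser
   centralise the [p]-cycle, so a [p]-th power of one of them is a 3-cycle. *)
Theorem jordan_prime_cycle G p : [transitive G, on setT | 'P] -> prime p ->
  (3 < p)%N -> (p + 3 <= #|T|)%N -> (#|T| < 2 * p)%N -> p %| #|G| ->
  'Alt_T \subset G.
Proof.
move=> trG p_pr p3 pT T2p /(Cauchy p_pr)[c cG oc].
have sc := card_support_of_prime_order p_pr oc T2p.
set D := support_perm c in sc.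
have ntr : [transitive^(1 + (#|T| - p)) G, on setT | 'P].
  apply: (prime_cycle_ntransitive p_pr oc sc cG) => E DE EnT.
  apply: move_of_card => //; apply: leq_trans T2p _; rewrite leq_mul2l /=.
  by rewrite -sc subset_leq_card.
have cF : <[c]> \subset fixer G D.
  rewrite cycle_subG; apply/fixerP; split=> // x; rewrite inE negbK.
  by move/eqP.
have FD : #|fixer G D| %| p`!.
  rewrite -sc -/D -perm.card_Sym; apply: cardSg; apply/subsetP => h /fixerP[_ hD].
  by rewrite inE; apply/subsetP => x; apply: contraR => /hD/eqP.
(* The fixer embeds into the symmetric group on [p] points, whose order p! contains [p] exactly
   once. *)
have sylc : p.-Sylow(fixer G D) <[c]>.
  rewrite pHallE cF -orderE oc p_part /=.
  have : (0 < logn p #|fixer G D| <= logn p p`!)%N.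
    rewrite dvdn_leq_log ?fact_gt0 // logn_gt0 mem_primes p_pr cardG_gt0 /= andbT.
    by rewrite -oc order_dvdG // -cycle_subG.
  have -> : logn p p`! = 1%N.
    rewrite logn_fact // big_ltn; last by rewrite ltnS prime_gt0.
    rewrite expn1 divnn prime_gt0 //.
    rewrite big1_seq // => k; rewrite mem_index_iota => /andP[_ /andP[k1 _]].
    by rewrite divn_small // -[X in (X < _)%N]expn1 ltn_exp2l // prime_gt1.
  by case: logn => [|[|]] // _; rewrite expn1.
have cardC : #|~: D| = (#|T| - p)%N by rewrite [LHS]cardsCs setCK sc.
(* Frattini argument: multiple transitivity gives [g] acting as the transposition outside [D]. It
   carries [<[c]>] to another Sylow subgroup of the fixer, and an element of the fixer, invisible
   outside [D], carries it back. *)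
have real a b : a \notin D -> b \notin D -> exists2 y : {perm T}, y \in G /\ c ^ y \in <[c]> &
    forall x, x \notin D -> y x = tperm a b x.
  move=> aD bD; have tD x : x \notin D -> tperm a b x \notin D.
    by move=> xD; case: tpermP => // ->.
  have t1P : size (enum (~: D)) == (#|T| - p)%N by rewrite -cardE cardC.
  have t2P : size (map (tperm a b) (enum (~: D))) == (#|T| - p)%N by rewrite size_map.
  have d1 : Tuple t1P \in (#|T| - p).-dtuple([set: T]).
    by rewrite inE enum_uniq /= subset_all; apply/allP => x; rewrite inE.
  have d2 : Tuple t2P \in (#|T| - p).-dtuple([set: T]).
    rewrite inE /= (map_inj_uniq perm_inj) enum_uniq /= subset_all.
    by apply/allP => x; rewrite inE.
  have [g gG [/eq_in_map gE]] := atransP2 (ntransitive_weak (leq_addl 1 _) ntr) d1 d2.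
  have {}gE x : x \notin D -> g x = tperm a b x.
    by move=> xD; rewrite gE // mem_enum inE.
  have sylcg : p.-Sylow(fixer G D) (<[c]> :^ g).
    rewrite pHallE cardJg; apply/andP; split; last by have := sylc; rewrite pHallE => /andP[].
    rewrite /= -cycleJ cycle_subG; apply/fixerP; split; first by rewrite groupJ.
    move=> x xD; have E : g^-1 x = tperm a b x.
      by rewrite -{1}[x](tpermK a b) -gE ?permK // tD.
    rewrite conjgE !permM E; have := tD x xD; rewrite inE negbK => /eqP->.
    by rewrite gE ?tpermK // tD.
  have [h hF cgh] := Sylow_trans sylcg sylc; exists (g * h).
    split; first by rewrite groupM //; case/fixerP: hF.
    suff -> : <[c]> = <[c]> :^ (g * h) by rewrite memJ_conjg cycle_id.
    by rewrite conjsgM; apply: cgh.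
  move=> x xD; rewrite permM gE //; have [_ hD] := fixerP _ _ _ hF.
  by rewrite hD // tD.
have : (2 < #|~: D|)%N by rewrite cardC; lia.
case/card_gt2P=> u1 [u2 [u3 [[]]]]; rewrite !in_setC => u1D u2D u3D [u12 u23 u31].
have [y1 [y1G y1c] y1E] := real _ _ u1D u2D.
have [y2 [y2G y2c] y2E] := real _ _ u2D u3D.
pose z := [~ y1, y2]; have zc : commute c z := commg_cent_cycle y1c y2c.
have zG : z \in G by rewrite groupR.
pose s := tperm u1 u2 * tperm u2 u3.
have tD a b x : a \notin D -> b \notin D -> x \notin D -> tperm a b x \notin D.
  by move=> aD bD xD; case: tpermP => // ->.
have sN x : x \notin D -> s x \notin D.
  by move=> xD; rewrite permM tD // tD.
have yV (y t : {perm T}) : (forall x, x \notin D -> y x = t x) ->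
    (forall x, x \notin D -> t x \notin D) -> t * t = 1 ->
    forall x, x \notin D -> y^-1 x = t x.
  move=> yE tND tt x xD; have ttx : t (t x) = x by rewrite -permM tt perm1.
  by rewrite -{1}ttx -yE ?permK // tND.
have zE x : x \notin D -> z x = (s ^+ 2) x.
  move=> xD; rewrite /z /commg conjgE !permM.
  rewrite (yV _ _ y1E) ?tperm2 //; last by move=> w wD; apply: tD.
  rewrite (yV _ _ y2E) ?tperm2 //; [|by move=> w wD; apply: tD|by apply: tD].
  have sxD : tperm u2 u3 (tperm u1 u2 x) \notin D by rewrite tD // tD.
  by rewrite (y1E _ sxD) y2E // tD.
have su1 : s u1 = u3 by rewrite permM !tpermL.
have su2 : s u2 = u1 by rewrite permM tpermR tpermD // eq_sym.
have su3 : s u3 = u2.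
  by rewrite permM (@tpermD _ u1 u2 u3) ?tpermR 1?[u1 == u3]eq_sym.
have s_id x : x != u1 -> x != u2 -> x != u3 -> s x = x.
  by move=> x1 x2 x3; rewrite permM !tpermD // eq_sym.
have s3 : s ^+ 3 = 1.
  apply/permP => x; rewrite permX perm1 /=.
  have [->|x1] := eqVneq x u1; first by rewrite su1 su3 su2.
  have [->|x2] := eqVneq x u2; first by rewrite su2 su1 su3.
  have [->|x3] := eqVneq x u3; first by rewrite su3 su2 su1.
  by rewrite !s_id.
(* On [D] the element [z] commutes with the cycle [c], hence acts there like a power of it and
   disappears in the [p]-th power. Outside [D] it acts as the commutator of two transpositions,
   which is [s ^+ 2]. *)
have zpE : z ^+ p = s ^+ (2 * p).
  apply/permP => x; have [xD|xD] := boolP (x \in D).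
    have -> : (s ^+ (2 * p)) x = x.
      have sx : s x = x by apply: s_id; apply: contraTneq xD => ->.
      by elim: (2 * p)%N => [|n IH]; rewrite ?perm1 // expgS permM sx.
    have zxD : z x \in D.
      rewrite inE -permM -zc permM (inj_eq perm_inj).
      by rewrite inE in xD.
    move: zxD; rewrite /D -(prime_cycle_porbit p_pr oc sc xD) => /porbitP[i zx].
    have zn n : (z ^+ n) x = (c ^+ (i * n)) x.
      elim: n => [|n IH]; first by rewrite muln0 !perm1.
      rewrite expgSr permM IH -permM (commute_sym (commuteX (i * n) (commute_sym zc))).
      by rewrite permM zx -permM -expgD mulnS.
    by rewrite zn mulnC expgM -oc expg_order expg1n perm1.
  rewrite expgM; elim: p {p_pr p3 pT T2p oc sc ntr FD sylc cardC real} => [|n IH]; first by rewrite perm1.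
  rewrite [z ^+ _]expgSr [RHS](congr1 (fun t : {perm T} => t x) (expgSr _ _)).
  have pM (w t : {perm T}) : (w * t) x = t (w x) by rewrite permM.
  rewrite 2!pM IH zE //; elim: (n) => [|k IHk]; first by rewrite expg0 perm1.
  by rewrite expgSr permM [s ^+ 2]expgS permM expg1 !sN.
have sG : s \in G.
  have s2pG : s ^+ (2 * p) \in G by rewrite -zpE groupX.
  have pn3 : ~~ (3 %| p) by rewrite dvdn_prime2 // neq_ltn p3.
  (* 2p is prime to 3, so [s], having order 3, is a power of [s ^+ (2 * p)]. *)
  have [p1|p2] : (2 * p * 2 = 1 %[mod 3] \/ 2 * p = 1 %[mod 3])%N by clear -pn3; lia.
    have -> : s = (s ^+ (2 * p)) ^+ 2; last exact: groupX.
    by rewrite -expgM -(expg_mod _ s3) p1.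
  by have -> : s = s ^+ (2 * p); rewrite // -(expg_mod _ s3) p2.
have os : #[s] = 3.
  apply: nt_prime_order => //; apply/eqP => /permP/(_ u1).
  by rewrite permM tpermL tpermL perm1 => e; rewrite e eqxx in u31.
have ss : #|support_perm s| = 3.
  have -> : support_perm s = [set u1; u2; u3].
    apply/setP => x; rewrite !inE.
    have [->|x1] := eqVneq x u1; first by rewrite su1.
    have [->|x2] := eqVneq x u2; first by rewrite su2 u12.
    have [->|x3] := eqVneq x u3; first by rewrite su3 u23.
    by rewrite s_id ?eqxx.
  by rewrite -setUA !cardsU1 cards1 !inE negb_or u12 u23 [u1 == _]eq_sym u31.
apply: (@Alt_sub_of_3cycle G s) => //.
move=> E sE EnT; apply: move_of_2transitive => //; first by apply: ntransitive_weak ntr; clear -pT; lia.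
by apply: leq_trans (subset_leq_card sE); rewrite ss.
Qed.

End PrimeCycle.

Import Order.TTheory GRing.Theory Num.Theory.
Local Open Scope ring_scope.

(** * Residue fields, inertia and Frobenius elements *)

Section ResidueField.
Import boolp classical_sets.
Local Open Scope quotient_scope.

Lemma maximal_ideal_exists (R : comNzRingType) (a : R) :
  (forall y, a * y <> 1) ->
  exists I : R -> Prop, [/\ I a, ~ I 1,
    forall c u v, I u -> I v -> I (c * u + v)
    & forall x, ~ I x -> exists u y, I u /\ u + x * y = 1].
Proof.
move=> aN.
pose lin (I : R -> Prop) := forall c u v, I u -> I v -> I (c * u + v).
(* The alternative [u = 0] admits the empty set, which Zorn's lemma produces as the union of the
   empty chain. Asking that 1 be outside I + aR, rather than outside I, makes a maximal I contain
   [a]. *)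
pose P (I : set R) := lin I /\
  forall u y, I u \/ u = 0 -> u + a * y <> 1.
have [|I [[Ilin Ia] Imax]] := @Zorn_bigcup R P.
  move=> F FP Ftot; split=> [c u v [A FA Au] [B FB Bv]|u y].
    have [AB|BA] := Ftot _ _ FA FB; first by exists B => //; apply: (FP B FB).1 => //; apply: AB.
    by exists A => //; apply: (FP A FA).1 => //; apply: BA.
  case=> [[A FA Au]|->]; last by rewrite add0r; apply: aN.
  by apply: (FP A FA).2; left.
have ext (J : set R) : (I `<=` J)%classic -> P J -> (J `<=` I)%classic.
  move=> IJ PJ x Jx; apply: contrapT => Ix; apply: (Imax J) => //.
  by split=> // /(_ x Jx).
pose J := [set x | exists u y, (I u \/ u = 0) /\ x = u + a * y]%classic.
have JI : (J `<=` I)%classic.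
  apply: ext => [x Ix|]; first by exists x, 0; split; [left|rewrite mulr0 addr0].
  have I0 u : I u \/ u = 0 -> forall v c, I v \/ v = 0 -> I (c * u + v) \/ c * u + v = 0.
    move=> hu v c hv; case: hu => [hu|->]; last by rewrite mulr0 add0r.
    case: hv => [hv|->]; first by left; apply: Ilin.
    left; rewrite (_ : _ + 0 = (c - 1) * u + u); first exact: Ilin.
    by ring.
  split=> [c _ _ [u [y [hu ->]]] [v [z [hv ->]]]|x y].
    exists (c * u + v), (c * y + z); split; first exact: I0.
    by ring.
  case=> [[u [z [hu ->]]]|->]; last by rewrite add0r; apply: aN.
  by rewrite -addrA -mulrDr; apply: Ia.
have Ia1 : I a by apply: JI; exists 0, 1; split; [right|ring].
have I1 : ~ I 1 by move=> I1; apply: (Ia 1 0); [left|rewrite mulr0 addr0].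
exists I; split=> // x Ix; apply: contrapT => nex; apply: Ix.
pose K := [set z | exists u y, I u /\ z = u + x * y]%classic.
have KI : (K `<=` I)%classic.
  apply: ext => [z Iz|]; first by exists z, 0; split=> //; rewrite mulr0 addr0.
  split=> [c _ _ [u [y [hu ->]]] [v [z [hv ->]]]|z y].
    exists (c * u + v), (c * y + z); split; first exact: Ilin.
    by ring.
  case=> [[u [w [hu ->]]]|->]; last by rewrite add0r; apply: aN.
  move=> e; apply: nex; exists (y * a + u), w; split; first exact: Ilin.
  by rewrite -e; ring.
apply: KI; exists 0, 1; split; last by ring.
by apply: JI; exists 0, 0; split; [right|ring].
Qed.

(* A maximal ideal containing a non-invertible element, in the form of the
   projection onto its residue field. *)
Lemma residue_field_exists (R : comNzRingType) (a : R) :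
  (forall y, a * y <> 1) ->
  exists (k : fieldType) (phi : {rmorphism R -> k}),
    (forall z, exists x, phi x = z) /\ phi a = 0.
Proof.
move=> /maximal_ideal_exists[I [Ia I1 Ilin Imax]].
pose S : R -> bool := fun x => `[< I x >].
have SP x : reflect (I x) (S x) := asboolP (I x).
have I0 : I 0 by rewrite -(addNr a) -mulN1r; apply: Ilin.
have Scl : idealr_closed S.
  split; [exact/SP | exact/SP |] => c u v /SP hu /SP hv; apply/SP; exact: Ilin.
pose SI : idealr R := HB.pack S (isIdealr.Build R S Scl).
pose Q : comNzRingType := {ideal_quot SI}.
pose pr : {rmorphism R -> Q} := \pi_Q.
have prK z : pr (repr z) = z by apply: reprK.
have piP (x : R) : pr x = 0 <-> I x.
  rewrite -(rmorph0 pr) /pr /=; split=> [/eqP|/SP Sx].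
    by rewrite -Quotient.idealrBE subr0 => /SP.
  by apply/eqP; rewrite -Quotient.idealrBE subr0.
have inv_ex (z : Q) : exists y : Q, (z != 0 -> y * z = 1) /\ (z = 0 -> y = 0).
  have [->|z0] := eqVneq z 0; first by exists 0; split=> // /eqP.
  have /Imax[u [y [/piP Iu /(congr1 pr)]]] : ~ I (repr z).
    by move=> /piP; rewrite prK => e; rewrite e eqxx in z0.
  rewrite rmorphD rmorphM rmorph1 Iu add0r prK => e.
  exists (pr y); split=> [_|z00]; first by rewrite mulrC.
  by rewrite z00 eqxx in z0.
have [inv invP] := choice inv_ex.
have mulVf (x : Q) : x != 0 -> inv x * x = 1 by case: (invP x).
have invr0 : inv 0 = 0 by case: (invP 0) => _; apply.
pose k : fieldType := HB.pack Q (GRing.ComNzRing_isField.Build Q mulVf invr0).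
exists k, pr; split; last exact/piP.
by move=> z; exists (repr (z : Q)); apply: prK.
Qed.

End ResidueField.

(** * Algebraic integers of a splitting field and the primes above q *)

Section AlgebraicIntegers.
Variable L : splittingFieldType rat.
Local Notation intL := (intmul 1 : int -> L).
Local Notation Gal := 'Gal({:L} / 1%AS)%g.

(** Integrality is a proposition without a decision procedure; the classical [asbool] makes it a
    Boolean predicate, from which a subring type can be formed. *)
Definition is_algint : {pred L} := fun x => boolp.asbool (integralOver intL x).

Lemma is_algintP x : reflect (integralOver intL x) (x \in is_algint).
Proof. exact: boolp.asboolP. Qed.

Lemma is_algint_subring : subring_closed is_algint.
Proof.
split; first by apply/is_algintP/integral1.
  by move=> x y /is_algintP hx /is_algintP hy; apply/is_algintP/integral_sub.
by move=> x y /is_algintP hx /is_algintP hy; apply/is_algintP/integral_mul.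
Qed.
HB.instance Definition _ := GRing.isSubringClosed.Build L is_algint is_algint_subring.

Record algint := AlgInt { algint_val : L; _ : algint_val \in is_algint }.
HB.instance Definition _ := [isSub for algint_val].
HB.instance Definition _ := [Choice of algint by <:].
HB.instance Definition _ := [SubChoice_isSubComNzRing of algint by <:].

Lemma algint_val_intr (z : int) : val (z%:~R : algint) = z%:~R.
Proof. exact: (rmorph_int (val : algint -> L)). Qed.

Lemma fieldext_intr_inj : injective intL.
Proof.
move=> a b; rewrite -!(rmorph_int (in_alg L)) => /fmorph_inj/eqP.
by rewrite eqr_int => /eqP.
Qed.

Lemma fieldext_nat_eq0 n : (n%:R == 0 :> L) = (n == 0)%N.
Proof. by rewrite -(rmorph_nat (in_alg L)) fmorph_eq0 pnatr_eq0. Qed.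

Lemma galois_rat : galois 1%AS {:L}.
Proof.
rewrite /galois sub1v normalFieldf andbT; apply/separableP => y _; apply: pcharf0_separable.
by move=> p; rewrite !inE; apply/negP => /andP[p_pr]; rewrite fieldext_nat_eq0; case: p p_pr.
Qed.

Lemma gal_fixed_rat (x : L) : (forall g, g \in Gal -> g x = x) -> x \in 1%VS.
Proof.
move=> hx; have /galois_fixedField <- := galois_rat.
by apply/fixedFieldP; rewrite ?memvf.
Qed.

(** The integers are integrally closed; the fact is taken from [algC], to which the rational value
    is carried together with its monic equation. *)
Lemma rat_algint (x : algint) : val x \in 1%VS -> exists z : int, x = z%:~R.
Proof.
case/vlineP=> c xc; have /is_algintP[p mp rp] := valP x.
have {rp} : root (map_poly (intmul 1 : int -> rat) p) c.
  rewrite /= xc in rp; rewrite -(fmorph_root (in_alg L)).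
  by rewrite -map_poly_comp (eq_map_poly (g := intL)) // => i; apply: (rmorph_int (in_alg L)).
rewrite -(fmorph_root (ratr : {rmorphism rat -> algC})) => rp.
have Ac : ratr c \in Aint.
  apply: root_monic_Aint rp _ _; first by do 2!apply: monic_map.
  apply/polyOverP => i; rewrite !coef_map /= ratr_int; exact: intr_int.
have /intrP[z cz] : (ratr c : algC) \is a Num.int.
  by apply: Cint_rat_Aint Ac; apply: Crat_rat.
exists z; apply: val_inj; rewrite /= xc.
have -> : c = z%:~R by apply: (fmorph_inj (ratr : {rmorphism rat -> algC})); rewrite /= cz ratr_int.
by rewrite (algint_val_intr z); apply: (rmorph_int (in_alg L)).
Qed.

Lemma gal_algint (g : gal_of {:L}) (x : algint) : g (val x) \in is_algint.
Proof.
have /is_algintP[p mp rp] := valP x; apply/is_algintP; exists p => //.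
have <- : map_poly g (map_poly intL p) = map_poly intL p.
  by rewrite -map_poly_comp; apply: eq_map_poly => z /=; rewrite rmorph_int.
exact: rmorph_root.
Qed.

Definition gact (g : gal_of {:L}) (x : algint) : algint := AlgInt (gal_algint g x).

Lemma gact_zmod g : zmod_morphism (gact g).
Proof. by move=> x y; apply: val_inj; rewrite /= rmorphB. Qed.
Lemma gact_monoid g : monoid_morphism (gact g).
Proof.
by split=> [|x y]; apply: val_inj; [exact: (rmorph1 g) | exact: (rmorphM g)].
Qed.
HB.instance Definition _ g := GRing.isZmodMorphism.Build _ _ (gact g) (gact_zmod g).
HB.instance Definition _ g := GRing.isMonoidMorphism.Build _ _ (gact g) (gact_monoid g).

Lemma gactM g h x : gact (g * h)%g x = gact h (gact g x).
Proof. by apply: val_inj; rewrite /= galM ?memvf. Qed.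

Lemma algint_gal_fixed (x : algint) : (forall g, g \in Gal -> gact g x = x) ->
  exists z : int, x = z%:~R.
Proof.
move=> hx; apply: rat_algint; apply: gal_fixed_rat => g gG.
by rewrite -{2}(hx g gG).
Qed.

Lemma algint_intr_inj (a b : int) : a%:~R = b%:~R :> algint -> a = b.
Proof.
by move/(congr1 val); rewrite !algint_val_intr => /fieldext_intr_inj.
Qed.

Lemma algint_mulI (x y z : algint) : x != 0 -> x * y = x * z -> y = z.
Proof.
move=> x0 /(congr1 val) /= e; apply: val_inj.
by apply: mulfI e; apply: contraNneq x0 => v0; apply/eqP; apply: val_inj.
Qed.

(** An inverse of [q] among the algebraic integers would be a rational algebraic integer, thus an
    integer; so [q] lies in a maximal ideal. *)
Lemma residue_exists q : prime q ->
  exists (k : fieldType) (phi : {rmorphism algint -> k}),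
    (forall z, exists x, phi x = z) /\ q \in [pchar k].
Proof.
move=> q_pr.
have qN (y : algint) : q%:R * y <> 1.
  move=> qy; have qvy : q%:R * val y = 1.
    apply: etrans (congr1 val qy); congr (_ * _).
    exact: (esym (algint_val_intr q)).
  have [|z yz] := @rat_algint y.
    have -> : val y = q%:R^-1.
      apply: (@mulfI _ q%:R); first by rewrite fieldext_nat_eq0; case: q q_pr {qy qvy}.
      by rewrite qvy divff // fieldext_nat_eq0; case: q q_pr {qy qvy}.
    by rewrite rpredV rpred_nat.
  move: qy; rewrite yz -[q%:R]/(q%:~R) -intrM -[1]/(1%:~R) => /algint_intr_inj.
  by move/(congr1 absz); rewrite abszM /= => /eqP; rewrite muln_eq1 gtn_eqF ?prime_gt1.
have [k [phi [sur phiq]]] := residue_field_exists qN.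
by exists k, phi; split=> //; rewrite inE q_pr /= -(rmorph_nat phi) phiq eqxx.
Qed.


Lemma algint_root (x : algint) : exists2 p : {poly int}, p \is monic &
  (map_poly (intmul 1 : int -> algint) p).[x] = 0.
Proof.
have /is_algintP[p mp rp] := valP x; exists p => //.
apply: val_inj; rewrite -[RHS](eqP rp) -[LHS](horner_map (val : {rmorphism algint -> L})).
by rewrite -map_poly_comp (eq_map_poly (g := intL)) // => i; apply: algint_val_intr.
Qed.

Section Residue.
Variables (q : nat) (k : fieldType) (phi : {rmorphism algint -> k}).
Hypotheses (phi_sur : forall z, exists x, phi x = z) (qk : q \in [pchar k]).

Let q_pr : prime q. Proof. exact: pcharf_prime qk. Qed.

Lemma residue_int (z : int) : (phi z%:~R == 0) = (q %| `|z|)%N.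
Proof.
rewrite rmorph_int (dvdn_pcharf qk); case: (intP z) => [|n|n].
- by [].
- by [].
by rewrite abszN /= mulrNz oppr_eq0.
Qed.

(** Locally, [q] divides a power of every [t] in the maximal ideal. In a monic equation of [t], let
    [n] be the least index of a coefficient prime to [q]: the terms from [n] on form a local unit
    times [t ^+ n], and the lower terms a multiple of [q]. *)
Lemma residue_nilpotent (t : algint) : phi t = 0 ->
  exists s n z, phi s != 0 /\ s * t ^+ n = z * q%:R.
Proof.
move=> t0; have [p mp pt] := algint_root t.
have ex : exists i, ~~ (q %| `|(p`_i)%R|)%N.
  exists (size p).-1; rewrite -lead_coefE (monicP mp) dvdn1.
  by rewrite gtn_eqF // prime_gt1.
case: (ex_minnP ex) => n pn minn.
pose int_map := map_poly (intmul 1 : int -> algint).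
exists (int_map (drop_poly n p)).[t], n, (- (int_map (map_poly (fun c => (c %/ q%:Z)%Z) (take_poly n p))).[t]).
split.
  rewrite /int_map; set d := drop_poly n p.
  have -> : phi (map_poly intr d).[t] = phi (d`_0)%:~R.
    rewrite -horner_map t0 horner_coef0 !coef_map /=; done.
  by rewrite residue_int coef_drop_poly add0n.
apply/eqP; rewrite mulNr -addr_eq0; apply/eqP; rewrite -[RHS]pt.
rewrite -[in RHS](poly_take_drop n p) rmorphD rmorphM /= map_polyXn hornerD hornerM hornerXn.
rewrite addrC; congr (_ + _).
rewrite mulrC -hornerZ; congr (_.[t]); apply/polyP => i.
rewrite coefZ !coef_map /= coef_map_id0 ?div0z // coef_take_poly.
case: ifP => [ni|]; last by rewrite div0z mulr0.
rewrite -[q%:R]/(q%:~R) -intrM mulrC divzK //.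
by rewrite dvdzE; apply: contraTT ni => /minn; rewrite -leqNgt.
Qed.

Definition decomposition := [set g in Gal | boolp.asbool
  (forall x, phi x = 0 -> phi (gact g x) = 0)].

Lemma decompositionP g : reflect (g \in Gal /\ forall x, phi x = 0 -> phi (gact g x) = 0)
  (g \in decomposition).
Proof. by rewrite inE; apply: (iffP andP) => -[? /boolp.asboolP]. Qed.

Lemma gact1 x : gact 1%g x = x.
Proof. by apply: val_inj; rewrite /= gal_id. Qed.

Lemma decomposition_group_set : group_set decomposition.
Proof.
apply/group_setP; split=> [|g h /decompositionP[gG gD] /decompositionP[hG hD]].
  by apply/decompositionP; split; [exact: group1|move=> x; rewrite gact1].
apply/decompositionP; split; first exact: groupM.
by move=> x /gD/hD; rewrite gactM.
Qed.
Canonical decomposition_group := Group decomposition_group_set.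

Lemma decomposition_neq0 g x : g \in decomposition -> phi x != 0 -> phi (gact g x) != 0.
Proof.
case/decompositionP=> _ gD x0; have [y yE] := phi_sur (phi x)^-1.
have : phi (gact g (x * y - 1)) = 0 by apply: gD; rewrite rmorphB rmorphM rmorph1 yE divff ?subrr.
move=> /eqP; rewrite !(rmorphB, rmorphM, rmorph1) subr_eq0; apply: contraTneq => ->.
by rewrite mul0r eq_sym oner_eq0.
Qed.

(* An element that is 1 modulo the maximal ideal [ker phi] and lies in each of
   its conjugates different from it. *)
Lemma conjugate_separation : exists u, phi u = 1 /\
  forall g, g \in Gal -> g \notin decomposition -> phi (gact g u) = 0.
Proof.
have uex (g : gal_of {:L}) : exists u, g \in Gal -> g \notin decomposition ->
    phi u = 1 /\ phi (gact g u) = 0.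
  have [gG|] := boolP (g \in Gal); last by exists 0.
  have [|gD] := boolP (g \in decomposition); first by exists 0.
  have [x [x0 gx]] : exists x, phi x = 0 /\ phi (gact g x) != 0.
    apply: boolp.contrapT => H; case/negP: gD; apply/decompositionP; split=> // x x0.
    by apply/eqP; apply: boolp.contrapT => gx; apply: H; exists x; split=> //; apply/negP.
  have [t tE] := phi_sur (phi (gact g x))^-1.
  exists (1 - x * gact g^-1%g t); split.
    by rewrite rmorphB rmorphM rmorph1 x0 mul0r subr0.
  rewrite !(rmorphB, rmorphM, rmorph1) /= -gactM mulVg gact1 tE divff ?subrr //.
have [u uP] := boolp.choice uex.
exists (\prod_(g in Gal :\: decomposition) u g); split.
  rewrite rmorph_prod big1 // => g /setDP[gG gD]; by have [] := uP g gG gD.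
move=> g gG gD; rewrite rmorph_prod rmorph_prod (bigD1 g) /=; last by rewrite in_setD gD.
by have [_ ->] := uP g gG gD; rewrite mul0r.
Qed.

Lemma algint_norm (x : algint) : exists z : int, \prod_(g in Gal) gact g x = z%:~R.
Proof.
apply: algint_gal_fixed => h hG; rewrite rmorph_prod (reindex_inj (mulIg h^-1%g)) /=.
apply: eq_big => [g|g _]; first by rewrite groupMr ?groupV.
by rewrite -gactM mulgKV.
Qed.

(** The hypothesis says e v(a) = v(q). A suitable [b] satisfies a relation of the same form and is a
    unit at the conjugates of the ideal different from it. Its norm is an integer [N] to which only
    the decomposition group contributes powers of [q], and comparing exponents gives
    [e * logn q |N| = #|decomposition|], a divisor of the order of the Galois group. *)
Theorem ramification_dvd_galois (a s w : algint) e : phi s != 0 -> phi w != 0 ->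
  s * a ^+ e = w * q%:R -> (e %| #|Gal|)%N.
Proof.
move=> s0 w0 sa; have [u [u1 uD]] := conjugate_separation.
have [r [n [z [r0 rz]]]] : exists r n z, phi r != 0 /\ r * (1 - u) ^+ n = z * q%:R.
  by apply: residue_nilpotent; rewrite rmorphB rmorph1 u1 subrr.
pose t := (1 - u) ^+ n.
have rt : r * t = z * q%:R by [].
(* Locally [q] divides [t], so [t * t] changes the relation only by a multiple of [q * q] and the
   cofactor of [q] remains a unit; with [t] alone it might not. At the other conjugates [u] vanishes
   and [t] becomes 1, which makes [b] a unit there. *)
have [v bE] : exists v, (a * u + t * t) ^+ e = (a * u) ^+ e + t * t * v.
  elim: e {sa} => [|e [v IH]]; first by exists 0; rewrite !expr0 mulr0 addr0.
  exists ((a * u) ^+ e + v * (a * u) + t * t * v); rewrite exprSr IH exprSr.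
  by ring.
set b := a * u + t * t in bE.
pose s' := s * r * r; pose w' := w * r * r * u ^+ e + s * z * z * q%:R * v.
have bw : s' * b ^+ e = w' * q%:R.
  rewrite bE /s' /w' exprMn.
  have -> : s * r * r * (a ^+ e * u ^+ e + t * t * v) =
     (s * a ^+ e) * r * r * u ^+ e + s * (r * t) * (r * t) * v by ring.
  by rewrite sa rt; ring.
have s'0 : phi s' != 0 by rewrite !rmorphM !mulf_neq0.
have phiq : phi q%:R = 0 by rewrite rmorph_nat (pcharf0 qk).
have w'0 : phi w' != 0.
  by rewrite rmorphD !rmorphM phiq rmorphXn u1 expr1n !(mulr0, mul0r) addr0 mulr1 !mulf_neq0.
have [N NE] := algint_norm b.
have bD g : g \in Gal -> g \notin decomposition -> phi (gact g b) != 0.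
  move=> gG gD; rewrite /b /t !(rmorphD, rmorphM, rmorphXn, rmorphN, rmorph1) /= (uD g gG gD).
  by rewrite mulr0 add0r oppr0 addr0 !expr1n mulr1 oner_eq0.
suff : (e %| #|decomposition|)%N by move/dvdn_trans; apply; apply: cardSg; apply/subsetP => g /decompositionP[].
(* Elements of the decomposition group preserve local units, so each of them turns the relation for
   [b] into one of the same form; these relations are multiplied together. *)
have key : exists H W, [/\ phi H != 0, phi W != 0 &
    N%:~R ^+ e * H = q%:R ^+ #|decomposition| * W :> algint].
  exists (\prod_(g in decomposition) gact g s').
  exists ((\prod_(g in decomposition) gact g w') * (\prod_(g in Gal | g \notin decomposition) gact g b) ^+ e).
  split.
  - rewrite rmorph_prod; apply/prodf_neq0 => g gD; exact: decomposition_neq0.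
  - rewrite rmorphM rmorphXn !rmorph_prod mulf_neq0 ?expf_neq0 //.
      by apply/prodf_neq0 => g gD; apply: decomposition_neq0.
    by apply/prodf_neq0 => g /andP[gG gD]; apply: bD.
  rewrite -NE (bigID (mem decomposition)) /= exprMn.
  rewrite mulrAC mulrA; congr (_ * _).
  have -> : \prod_(g in Gal | g \in decomposition) gact g b = \prod_(g in decomposition) gact g b.
    by apply: eq_bigl => g; rewrite andb_idl // => /decompositionP[].
  rewrite -prodrXl -big_split /= -prodr_const -big_split /=; apply: eq_bigr => g _.
  by rewrite -rmorphXn -rmorphM mulrC bw rmorphM rmorph_nat mulrC.
case: key => H [W [H0 W0 key]].
have e0 : (0 < e)%N.
  case: e sa {bE bw w' w'0 key} => // sa; case/eqP: s0.
  by have := congr1 phi sa; rewrite expr0 mulr1 rmorphM phiq mulr0.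
have q0 j : q%:R ^+ j != 0 :> algint.
  apply/eqP => /(congr1 val); rewrite -[q%:R ^+ j]natrX (algint_val_intr (q ^ j)%N) => /eqP.
  by rewrite [_ == _]fieldext_nat_eq0 expn_eq0; case: q q_pr.
have N0 : N != 0.
  apply: contraNneq W0 => N0; move: key.
  rewrite N0 expr0n eqn0Ngt e0 mul0r -[LHS](mulr0 (q%:R ^+ #|decomposition|)).
  by move/(algint_mulI (q0 _)) <-; rewrite rmorph0.
have Npos : (0 < `|N|)%N by rewrite absz_gt0.
have [m qm Nm] := pfactor_coprime q_pr Npos; set v' := logn q _ in Nm.
pose N' : int := (-1) ^+ (N < 0)%R * m%:Z.
have N'q : phi N'%:~R != 0.
  by rewrite residue_int abszM abszX exp1n mul1n -prime_coprime.
have NN' : N%:~R = q%:R ^+ v' * N'%:~R :> algint.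
  by rewrite [N]intEsign Nm PoszM mulrA mulrC intrM -natrX.
clearbody N'; move: key; rewrite NN' exprMn -exprM -mulrA => key.
have [lt|gt|<-] := ltngtP (v' * e)%N #|decomposition|; last exact: dvdn_mull.
  move: key; rewrite -[in RHS](subnKC (ltnW lt)) exprD -mulrA => /(algint_mulI (q0 _)).
  move/(congr1 phi)/eqP; rewrite !rmorphM !rmorphXn /= phiq expr0n subn_eq0 leqNgt lt mul0r.
  by rewrite mulf_eq0 (negbTE H0) orbF expf_eq0 (negbTE N'q) andbF.
move: key; rewrite -(subnKC (ltnW gt)) exprD -mulrA => /(algint_mulI (q0 _)).
move/(congr1 phi)/eqP; rewrite rmorphM !rmorphXn /= phiq expr0n subn_eq0 leqNgt gt mul0r.
by rewrite eq_sym (negbTE W0).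
Qed.

End Residue.

End AlgebraicIntegers.

Lemma poly_exp_pchar (k : fieldType) q (qk : q \in [pchar k]) (P : {poly k}) :
  P ^+ q = map_poly (pFrobenius_aut qk) P \Po 'X^q.
Proof.
have qP : q \in [pchar {poly k}].
  by have := qk; rewrite !inE -polyCMn polyC_eq0.
elim/poly_ind: P => [|P c IH].
  by rewrite rmorph0 comp_poly0 expr0n gtn_eqF // prime_gt0 // (pcharf_prime qk).
rewrite -(pFrobenius_autE qP) rmorphD rmorphM /= !pFrobenius_autE IH.
rewrite rmorphD rmorphM /= map_polyX map_polyC comp_polyD comp_polyM comp_polyX.
by rewrite comp_polyC polyC_exp.
Qed.

Section Frobenius.
Variables (L : splittingFieldType rat) (q : nat) (k : fieldType).
Variable phi : {rmorphism algint L -> k}.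
Hypothesis qk : q \in [pchar k].
Local Notation Gal := 'Gal({:L} / 1%AS)%g.

Lemma residue_int_exp (z : int) : phi z%:~R ^+ q = phi z%:~R.
Proof. by rewrite rmorph_int -(pFrobenius_autE qk) rmorph_int. Qed.

(** The elements [xs] become the coefficients of one polynomial [th], so that a single [g] serves
    them all. The product of the factors Y - g(th) has integer coefficients; modulo [phi] it is
    compatible with Frobenius, so the [q]-th power of the reduction of [th] matches that of some
    conjugate. *)
Theorem frobenius_exists (xs : seq (algint L)) :
  exists2 g, g \in Gal & {in xs, forall x, phi (gact g x) = phi x ^+ q}.
Proof.
pose act (g : gal_of {:L}) : {rmorphism {poly algint L} -> {poly algint L}} := map_poly (gact g).
pose Phi : {rmorphism {poly algint L} -> {poly k}} := map_poly phi.
pose th : {poly algint L} := Poly xs.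
pose G : {poly {poly algint L}} := \prod_(g in Gal) ('X - (act g th)%:P).
have Gfix h : h \in Gal -> map_poly (act h) G = G.
  move=> hG; rewrite rmorph_prod /G [RHS](reindex_inj (mulIg h)) /=.
  apply: eq_big => [g|g _]; first by rewrite groupMr.
  rewrite map_polyXsubC; congr ('X - _%:P); apply/polyP => i.
  by rewrite !coef_map /= gactM.
have Gint i j : exists z : int, (G`_i)`_j = z%:~R.
  apply: algint_gal_fixed => h hG.
  by rewrite -{2}(Gfix h hG) !coef_map.
have Groot : G.[th] = 0.
  rewrite /G horner_prod (bigD1 1%g) ?group1 //= hornerXsubC.
  have -> : act 1%g th = th by apply/polyP => i; rewrite coef_map /= gact1.
  by rewrite subrr mul0r.
have qP : q \in [pchar {poly k}].
  by have := qk; rewrite !inE -polyCMn polyC_eq0.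
pose F : {rmorphism {poly k} -> {poly k}} := pFrobenius_aut qP.
pose psi : {rmorphism {poly k} -> {poly k}} := comp_poly 'X^q.
pose Gk := map_poly Phi G.
(* Frobenius on [{poly k}] also replaces 'X by ['X^q]. Since the coefficients of [G] are integers,
   it reduces on them to this substitution, and coefficients of [xs] are later compared at the
   exponents divisible by [q]. *)
have Fpsi : map_poly F Gk = map_poly psi Gk.
  apply/polyP => i; rewrite !coef_map /= pFrobenius_autE poly_exp_pchar.
  congr (_ \Po _); apply/polyP => j; rewrite !coef_map /= pFrobenius_autE.
  by have [z ->] := Gint i j; apply: residue_int_exp.
have : (map_poly F Gk).[F (Phi th)] = 0.
  by rewrite horner_map /Gk horner_map Groot !rmorph0.
rewrite Fpsi /Gk /G !rmorph_prod horner_prod => /eqP.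
case/prodf_eq0 => g gG /=; rewrite !map_polyXsubC hornerXsubC subr_eq0 /F /psi /=.
rewrite pFrobenius_autE poly_exp_pchar => /eqP E.
exists g => // x xin.
have q0 : (0 < q)%N by rewrite prime_gt0 // (pcharf_prime qk).
have := congr1 (fun P : {poly k} => P`_(q * index x xs)) E.
rewrite !coef_comp_poly_Xn // dvdn_mulr // mulKn // !coef_map /= pFrobenius_autE.
by rewrite coef_Poly nth_index.
Qed.

End Frobenius.

(** * Newton polygons and factorisation patterns *)

Section IntegerPolynomial.
Variables (L : splittingFieldType rat) (rs : seq L) (f : {poly int}).
Hypotheses (mf : f \is monic)
  (hf : map_poly (intmul 1 : int -> L) f = \prod_(z <- rs) ('X - z%:P)).
Local Notation Gal := 'Gal({:L} / 1%AS)%g.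

Lemma roots_algint : exists rsO : seq (algint L), map val rsO = rs.
Proof.
have: {subset rs <= @is_algint L}.
  move=> z zr; apply/is_algintP; exists f => //.
  by rewrite hf root_prod_XsubC.
elim: (rs) => [|z s IH] h; first by exists [::].
have [|t tE] := IH; first by move=> y ys; apply: h; rewrite inE ys orbT.
exists (AlgInt (h z (mem_head _ _)) :: t); by rewrite /= tE.
Qed.

Variable rsO : seq (algint L).
Hypothesis rsOE : map val rsO = rs.

Lemma algint_poly : map_poly (intmul 1 : int -> algint L) f = \prod_(z <- rsO) ('X - z%:P).
Proof.
have inj : injective (map_poly (val : {rmorphism algint L -> L})).
  move=> P Q /polyP E; apply/polyP => i; apply: val_inj.
  by have := E i; rewrite !coef_map.
apply: inj; rewrite -map_poly_comp rmorph_prod.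
rewrite (eq_map_poly (g := (intmul 1 : int -> L))); last by move=> i; apply: algint_val_intr.
by rewrite hf -rsOE big_map; apply: eq_bigr => z _; symmetry; apply: (map_polyXsubC (val : {rmorphism algint L -> L})).
Qed.

Lemma algint_poly_coef0 : \prod_(z <- rsO) z = (-1) ^+ size rsO * (f`_0)%:~R.
Proof.
have := congr1 (fun P : {poly _} => P.[0]) algint_poly.
rewrite horner_coef0 coef_map /= horner_prod => ->.
rewrite [in RHS](eq_bigr (fun z => - 1 * z)) => [|z _]; last by rewrite hornerXsubC add0r mulN1r.
rewrite big_split /= big_const_seq count_predT iter_mulr_1 mulrA -exprMn.
by rewrite mulrNN mulr1 expr1n mul1r.
Qed.

Lemma algint_poly_root a : a \in rsO -> (map_poly intr f).[a] = 0 :> algint L.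
Proof.
move=> ar; rewrite algint_poly horner_prod (big_rem a) //= hornerXsubC subrr.
by rewrite mul0r.
Qed.

Section Valuation.
Variables (q : nat) (k : fieldType) (phi : {rmorphism algint L -> k}).
Hypotheses (phi_sur : forall z, exists x, phi x = z) (qk : q \in [pchar k]).

Let phiq : phi q%:R = 0. Proof. by rewrite rmorph_nat (pcharf0 qk). Qed.

Lemma residue_root_exists : (q %| `|(f`_0)%R|)%N -> exists2 a, a \in rsO & phi a = 0.
Proof.
move=> q0; have : \prod_(z <- rsO) phi z = 0.
  rewrite -rmorph_prod algint_poly_coef0 rmorphM.
  have /eqP -> : phi (f`_0)%:~R == 0 by rewrite (residue_int _ qk).
  exact: mulr0.
move/eqP; rewrite prodf_seq_eq0 => /hasP[a ar /= /eqP a0]; by exists a.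
Qed.

Lemma horner_residue0 (g : {poly int}) a : phi a = 0 ->
  phi (map_poly intr g).[a] = phi (g`_0)%:~R.
Proof. by move=> a0; rewrite -horner_map a0 horner_coef0 !coef_map. Qed.

Lemma dvd_int_poly (n : nat) (g : {poly int}) : (forall i, (n %| `|(g`_i)%R|)%N) ->
  exists h : {poly int}, g = n%:Z *: h.
Proof.
move=> ng; exists (map_poly (fun c => (c %/ n)%Z) g); apply/polyP => i.
by rewrite coefZ coef_map_id0 ?div0z // mulrC divzK ?dvdzE ?absz_nat ?ng.
Qed.

Lemma horner_intZ (n : nat) (h : {poly int}) (a : algint L) :
  (map_poly intr (n%:Z *: h)).[a] = n%:R * (map_poly intr h).[a].
Proof. by rewrite map_polyZ hornerZ. Qed.

(** For a root [a] in [ker phi], the terms from [e] on are a local unit times [a ^+ e], and those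
    below are [q] times a local unit because [q] divides the constant coefficient exactly once. *)
Lemma newton_single e : (forall j, (j < e)%N -> (q %| `|(f`_j)%R|)%N) ->
  ~~ (q %| `|(f`_e)%R|)%N -> (0 < e)%N -> ~~ (q ^ 2 %| `|(f`_0)%R|)%N -> (e %| #|Gal|)%N.
Proof.
move=> qj qe e0 q0; have [a ar a0] := residue_root_exists (qj 0%N e0).
have [|h hE] := @dvd_int_poly q (take_poly e f).
  by move=> i; rewrite coef_take_poly; case: ifP => // /qj.
have := algint_poly_root ar.
rewrite -(poly_take_drop e f) hE rmorphD /= hornerD horner_intZ rmorphM /= map_polyXn.
rewrite hornerM hornerXn => /eqP; rewrite addr_eq0 => /eqP E.
apply: (@ramification_dvd_galois _ _ _ _ phi_sur qk a (map_poly intr (drop_poly e f)).[a]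
  (- (map_poly intr h).[a])).
- by rewrite horner_residue0 // coef_drop_poly (residue_int _ qk).
- rewrite rmorphN oppr_eq0 horner_residue0 // (residue_int _ qk).
  apply: contra q0 => qh; have -> : f`_0 = q%:Z * h`_0.
    by have := congr1 (fun P : {poly int} => P`_0) hE; rewrite coef_take_poly e0 coefZ.
  by rewrite abszM -mulnn dvdn_pmul2l // prime_gt0 // (pcharf_prime qk).
by rewrite mulNr [_ * q%:R]mulrC E opprK.
Qed.


Lemma residue_poly : map_poly (intmul 1 : int -> k) f = \prod_(z <- rsO) ('X - (phi z)%:P).
Proof.
have := congr1 (map_poly phi) algint_poly; rewrite -map_poly_comp.
rewrite (eq_map_poly (g := (intmul 1 : int -> k))) => [->|i]; last exact: rmorph_int.
by rewrite rmorph_prod; apply: eq_bigr => z _; apply: map_polyXsubC.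
Qed.

Lemma residue_root_count n : (forall j, (j < n)%N -> (q %| `|(f`_j)%R|)%N) ->
  ~~ (q %| `|(f`_n)%R|)%N -> count (fun z => phi z == 0) rsO = n.
Proof.
move=> qj qn; pose fk := map_poly (intmul 1 : int -> k) f.
have fkj j : fk`_j = 0 <-> (q %| `|(f`_j)%R|)%N.
  rewrite coef_map /= -(rmorph_int phi) -(residue_int phi qk); split=> /eqP //.
have fkE : fk = 'X^n * drop_poly n fk.
  rewrite -{1}(poly_take_drop n fk) mulrC (_ : take_poly n fk = 0) ?add0r //.
  apply/polyP => j; rewrite coef_take_poly coef0; case: ifP => // jn.
  exact/fkj/qj.
set c := count _ _; pose g := \prod_(z <- rsO | phi z != 0) ('X - (phi z)%:P).
have fkE2 : fk = 'X^c * g.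
  rewrite /fk residue_poly (bigID (fun z => phi z == 0)) /=; congr (_ * _).
  rewrite /c; elim: (rsO) => [|z s IH]; first by rewrite big_nil expr0.
  by rewrite big_cons /= IH; case: eqP => // ->; rewrite subr0 exprS.
have g0 : g`_0 != 0.
  rewrite -horner_coef0 horner_prod prodf_seq_neq0; apply/allP => z _; apply/implyP => z0.
  by rewrite hornerXsubC add0r oppr_eq0.
have d0 : (drop_poly n fk)`_0 != 0.
  by rewrite coef_drop_poly add0n; apply/eqP => /fkj; apply/negP.
have E : 'X^c * g = 'X^n * drop_poly n fk by rewrite -fkE2 -fkE.
have XC (a b : {poly k}) (i j : nat) : (i < j)%N -> 'X^i * a = 'X^j * b -> a`_0 = 0.
  move=> ij /(congr1 (fun P : {poly k} => P`_i)).
  by rewrite !coefXnM ltnn subnn ij.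
have [lt|gt|//] := ltngtP c n.
  by move: g0; rewrite (XC _ _ _ _ lt E) eqxx.
by move: d0; rewrite (XC _ _ _ _ gt (esym E)) eqxx.
Qed.

Lemma residue_valuation_inj (A B : algint L) i j : phi A != 0 -> phi B != 0 ->
  q%:R ^+ i * A = q%:R ^+ j * B -> i = j.
Proof.
have q0 n : q%:R ^+ n != 0 :> algint L.
  apply/eqP => /(congr1 val); rewrite -[q%:R ^+ n]natrX (algint_val_intr _ (q ^ n)%N) => /eqP.
  by rewrite [_ == _]fieldext_nat_eq0 expn_eq0; case: q (pcharf_prime qk).
have H C D n l : phi C != 0 -> q%:R ^+ n * C = q%:R ^+ l * D -> (l <= n)%N -> phi D != 0 -> n = l.
  move=> C0 E ln; apply: contraNeq => nl.
  move: E; rewrite -(subnKC ln) exprD -mulrA => /(algint_mulI (q0 _)) <-.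
  by rewrite rmorphM rmorphXn /= phiq expr0n subn_eq0 leqNgt ltn_neqAle [l == n]eq_sym nl ln mul0r.
move=> A0 B0 E; have [ji|/ltnW ij] := leqP j i; first exact: (H A B).
by apply/esym; apply: (H B A).
Qed.

(* [p / a^e1] is integral up to the unit [r], which decides between the two
   slopes of the Newton polygon at the root [a]. *)
Lemma slope_dichotomy (a h g r : algint L) k1 e : (0 < k1 < e)%N ->
  phi a = 0 -> phi h != 0 -> phi g != 0 -> phi r != 0 ->
  a ^+ (k1 + e) * h + q%:R * a ^+ k1 * g + q%:R ^+ 2 * r = 0 ->
  (exists s w, [/\ phi s != 0, phi w != 0 & s * a ^+ k1 = w * q%:R]) \/
  (exists s w, [/\ phi s != 0, phi w != 0 & s * a ^+ e = w * q%:R]).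
Proof.
case/andP=> k0 ke a0 h0 g0 r0 E.
have r_neq0 : r != 0 by apply: contraNneq r0 => ->; rewrite rmorph0.
have va : val a != 0.
  apply: contraNneq r_neq0 => v0; have a00 : a = 0 by apply: val_inj.
  move: E; rewrite a00 !expr0n (gtn_eqF k0) gtn_eqF ?addn_gt0 ?k0 // mul0r mulr0 mul0r !add0r.
  rewrite -[RHS](mulr0 (q%:R ^+ 2)) => /algint_mulI -> //.
  apply/eqP => /(congr1 val); rewrite -[q%:R ^+ 2]natrX (algint_val_intr _ (q ^ 2)%N) => /eqP.
  by rewrite [_ == _]fieldext_nat_eq0 expn_eq0; case: q (pcharf_prime qk).
have vq : val (q%:R : algint L) = q%:R by apply: (algint_val_intr L q).
pose A := val a ^+ k1; pose B := val a ^+ (e - k1).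
have A0 : A != 0 by rewrite expf_neq0.
have vE : A ^+ 2 * B * val h + q%:R * A * val g + q%:R ^+ 2 * val r = 0.
  have -> : A ^+ 2 * B = val a ^+ (k1 + e).
    by rewrite -exprM -exprD; congr (_ ^+ _); lia.
  apply: etrans (congr1 val E).
  by rewrite -vq !rmorphD !rmorphM !rmorphXn.
(* Multiplying the relation by r / a^(2 k1) gives a monic quadratic equation for [eta] with integral
   coefficients. Its constant term vanishes modulo [phi], as k1 < e, so [eta] or [eta + g] is in
   [ker phi]; the other one is a local unit because [g] is, and this unit yields the relation for
   one of the two sides. *)
pose eta : L := q%:R * val r / A.
have etaE : eta ^+ 2 + val g * eta + val r * val h * B = 0.
  apply: (mulfI (expf_neq0 2 A0)); rewrite mulr0 -[RHS](mulr0 (val r)) -vE /eta.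
  by field.
have etaI : eta \in @is_algint L.
  pose p := Poly [:: val r * val h * B; val g; 1].
  have pE : p = [:: val r * val h * B; val g; 1] :> seq L by apply: (PolyK (c := 1)); apply: oner_neq0.
  apply/is_algintP; apply: (@integral_root_monic _ _ _ eta p).
  - by rewrite monicE lead_coefE pE.
  - have hrec (x b c : L) : horner_rec [:: c; b; 1] x = x ^+ 2 + b * x + c by rewrite /=; ring.
    by rewrite /root /p horner_Poly hrec etaE.
  have iv (x : algint L) : integralOver (intmul 1 : int -> L) (val x) by apply/is_algintP/valP.
  move=> x; rewrite pE !inE => /or3P[] /eqP->; try exact: iv; last exact: integral1.
  have -> : val r * val h * B = val (r * h * a ^+ (e - k1)) by rewrite rmorphM rmorphM rmorphXn.
  exact: iv.
pose et := AlgInt etaI.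
have etE : et * (et + g) = - (r * h * a ^+ (e - k1)).
  apply: val_inj; have vB : val (a ^+ (e - k1)) = B by rewrite rmorphXn.
  change (eta * (eta + val g) = - (val r * val h * val (a ^+ (e - k1)))).
  by rewrite vB; apply/eqP; rewrite -addr_eq0 -etaE; apply/eqP; ring.
have eta2 : et * a ^+ k1 = r * q%:R.
  apply: val_inj; have vA : val (a ^+ k1) = A by rewrite rmorphXn.
  change (eta * val (a ^+ k1) = val r * val (q%:R : algint L)).
  by rewrite vA vq /eta mulfVK // mulrC.
have : phi et * (phi et + phi g) = 0.
  rewrite -rmorphD -rmorphM etE rmorphN rmorphM rmorphXn a0 expr0n subn_eq0 leqNgt ke.
  by rewrite mulr0 oppr0.
move/eqP; rewrite mulf_eq0; have [et0 _|et0 _] := eqVneq (phi et) 0; last by left; exists et, r.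
right; exists h, (- (et + g)); split=> //.
  by rewrite rmorphN oppr_eq0 rmorphD et0 add0r.
apply: (algint_mulI r_neq0); have -> : r * (- (et + g) * q%:R) = - (et + g) * (r * q%:R) by ring.
rewrite -eta2; have -> : - (et + g) * (et * a ^+ k1) = - (et * (et + g)) * a ^+ k1 by ring.
rewrite etE opprK -!mulrA; congr (r * (h * _)); rewrite -exprD; congr (_ ^+ _).
by rewrite subnK // ltnW.
Qed.

(** The polygon passes through (0, 2), (k1, 1) and (k1 + e, 0). If all k1 + e roots in [ker phi] had
    valuation v(q)/k1, the k1-th power of their product would have valuation (k1 + e) v(q), against
    2 k1 v(q) read off the constant coefficient. This contradicts k1 < e, so some root lies on the
    side of length [e]. *)
Lemma newton_double k1 e : (0 < k1 < e)%N ->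
  (forall j, (j < k1)%N -> (q ^ 2 %| `|(f`_j)%R|)%N) ->
  (forall j, (j < k1 + e)%N -> (q %| `|(f`_j)%R|)%N) ->
  ~~ (q ^ 3 %| `|(f`_0)%R|)%N -> ~~ (q ^ 2 %| `|(f`_k1)%R|)%N ->
  ~~ (q %| `|(f`_(k1 + e))%R|)%N -> (e %| #|Gal|)%N.
Proof.
move=> k1e qj2 qj f0 fk fke; have [k0 ke] := andP k1e.
have [|R RE] := @dvd_int_poly (q ^ 2) (take_poly k1 f).
  by move=> i; rewrite coef_take_poly; case: ifP => // /qj2.
have [|M ME] := @dvd_int_poly q (take_poly e (drop_poly k1 f)).
  by move=> i; rewrite coef_take_poly coef_drop_poly; case: ifP => // ie; apply: qj; lia.
pose H := drop_poly e (drop_poly k1 f).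
have fE : f = (q ^ 2)%:Z *: R + (q%:Z *: M + H * 'X^e) * 'X^k1.
  by rewrite -RE -ME !poly_take_drop.
have H0 : ~~ (q %| `|(H`_0)%R|)%N by rewrite /H !coef_drop_poly add0n [(e + _)%N]addnC.
have q_gt0 : (0 < q)%N by rewrite prime_gt0 // (pcharf_prime qk).
have M0 : ~~ (q %| `|(M`_0)%R|)%N.
  apply: contra fk => qM; have -> : f`_k1 = q%:Z * M`_0.
    have := congr1 (fun P : {poly int} => P`_0) ME.
    by rewrite coef_take_poly coef_drop_poly (ltn_trans k0 ke) coefZ.
  by rewrite abszM -mulnn dvdn_pmul2l.
have R0 : ~~ (q %| `|(R`_0)%R|)%N.
  apply: contra f0 => qR; have -> : f`_0 = (q ^ 2)%:Z * R`_0.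
    by have := congr1 (fun P : {poly int} => P`_0) RE; rewrite coef_take_poly k0 coefZ.
  by rewrite abszM expnSr absz_nat dvdn_pmul2l ?expn_gt0 ?q_gt0.
have dich a : a \in rsO -> phi a = 0 ->
   (exists s w, [/\ phi s != 0, phi w != 0 & s * a ^+ k1 = w * q%:R]) \/
   (exists s w, [/\ phi s != 0, phi w != 0 & s * a ^+ e = w * q%:R]).
  move=> ar a0; apply: (slope_dichotomy (h := (map_poly intr H).[a])
     (g := (map_poly intr M).[a]) (r := (map_poly intr R).[a])) => //.
  - by rewrite horner_residue0 // (residue_int _ qk).
  - by rewrite horner_residue0 // (residue_int _ qk).
  - by rewrite horner_residue0 // (residue_int _ qk).
  pose MP : {rmorphism {poly int} -> {poly algint L}} := map_poly (intmul 1).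
  rewrite -[RHS](algint_poly_root ar) fE (rmorphD MP) (rmorphM MP) (rmorphD MP) (rmorphM MP) /=.
  rewrite !map_polyXn !(hornerD, hornerM, hornerXn, horner_intZ) natrX exprD; ring.
have [[a [ar a0] [s [w [s0 w0 sa]]]]|nex] := boolp.pselect (exists2 a, a \in rsO /\ phi a = 0 &
   exists s w, [/\ phi s != 0, phi w != 0 & s * a ^+ e = w * q%:R]).
  exact: (ramification_dvd_galois phi_sur qk s0 w0 sa).
have {nex} dich a : a \in rsO -> phi a = 0 ->
   exists s w, [/\ phi s != 0, phi w != 0 & s * a ^+ k1 = w * q%:R].
  by move=> ar a0; case: (dich a ar a0) => // H1; case: nex; exists a.
have cnt : count (fun z => phi z == 0) rsO = (k1 + e)%N by apply: residue_root_count.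
have [s [w [s0 w0 sw]]] : exists s w, [/\ phi s != 0, phi w != 0 &
    s * (\prod_(z <- rsO) z) ^+ k1 = w * q%:R ^+ (k1 + e)].
  rewrite -cnt; elim: (rsO) dich => [|z l IH] dich.
    by exists 1, 1; rewrite big_nil expr1n expr0 rmorph1 oner_neq0.
  have [|s [w [s0 w0 sw]]] := IH; first by move=> a al; apply: dich; rewrite inE al orbT.
  rewrite big_cons /=; case: eqP => [z0|/eqP z0].
    have [s1 [w1 [s10 w10 sw1]]] := dich z (mem_head _ _) z0.
    exists (s * s1), (w * w1); rewrite !rmorphM !mulf_neq0 //; split=> //.
    by rewrite exprMn [s * s1]mulrC mulrACA sw sw1 exprS; ring.
  exists s, (w * z ^+ k1); rewrite rmorphM rmorphXn mulf_neq0 ?expf_neq0 //; split=> //.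
  rewrite exprMn mulrCA sw add0n; ring.
have f0E : f`_0 = (q ^ 2)%:Z * R`_0.
  by have := congr1 (fun P : {poly int} => P`_0) RE; rewrite coef_take_poly k0 coefZ.
move: sw; rewrite algint_poly_coef0 f0E intrM => sw.
have /residue_valuation_inj : q%:R ^+ (2 * k1) * (s * ((-1) ^+ size rsO * (R`_0)%:~R) ^+ k1) =
    q%:R ^+ (k1 + e) * w.
  rewrite [RHS]mulrC -sw exprM -[((q ^ 2)%:Z)%:~R]/((q ^ 2)%:R) natrX.
  by rewrite !exprMn; ring.
have -> : phi (s * ((-1) ^+ size rsO * (R`_0)%:~R) ^+ k1) != 0.
  rewrite rmorphM rmorphXn rmorphM rmorphXn rmorphN1.
  rewrite mulf_neq0 // expf_neq0 // mulf_neq0 ?(residue_int _ qk) //.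
  by rewrite expf_neq0 // oppr_eq0 oner_eq0.
move=> /(_ isT w0)/eqP; rewrite mul2n -addnn eqn_add2l => /eqP ek.
by rewrite ek ltnn in ke.
Qed.

End Valuation.

End IntegerPolynomial.

Lemma pchar_fixed_nat (k : fieldType) q (y : k) : q \in [pchar k] -> y ^+ q = y ->
  exists2 j, (j < q)%N & y = j%:R.
Proof.
move=> qk yq; have q_pr := pcharf_prime qk; have q1 := prime_gt1 q_pr.
case: (boolP (y \in [seq j%:R | j <- iota 0 q])) => [/mapP[j]|yN].
  by rewrite mem_iota => /andP[_ jq] ->; exists j.
have sz : size ('X^q - 'X : {poly k}) = q.+1.
  by rewrite size_polyDl ?size_polyXn // size_polyN size_polyX ltnS.
have := @max_poly_roots k ('X^q - 'X) (y :: [seq j%:R | j <- iota 0 q]).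
rewrite -size_poly_eq0 sz /= size_map size_iota ltnn => H.
suff : false by []; apply: H => //.
  rewrite /root !hornerE yq subrr eqxx /=; apply/allP => _ /mapP[j _ ->].
  by rewrite /root !hornerE -(pFrobenius_autE qk) pFrobenius_aut_nat subrr.
rewrite yN map_inj_in_uniq ?iota_uniq //.
have H0 (i j : nat) : (i <= j)%N -> (j < q)%N -> i%:R = j%:R :> k -> i = j.
  move=> ij jq /eqP; rewrite eq_sym -subr_eq0 -natrB // -(dvdn_pcharf qk).
  by case: (posnP (j - i)) => [|h /(dvdn_leq h)]; lia.
move=> i j; rewrite !mem_iota !add0n => /andP[_ iq] /andP[_ jq].
by case/orP: (leq_total i j) => h e; [apply: H0 | apply/esym; apply: H0].
Qed.

Lemma cards_three (U : finType) (x y z : U) : x != y -> x != z -> y != z ->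
  #|[set x; y; z]| = 3%N.
Proof.
by move=> xy xz yz; rewrite -setUA !cardsU1 cards1 !inE negb_or xy xz yz.
Qed.

(** * The Galois group as permutations of the roots, and 3-cycles from Frobenius *)

Section GaloisPermutations.
Variables (L : splittingFieldType rat) (rs : seq L) (f : {poly int}).
Hypotheses (hf : map_poly (intmul 1 : int -> L) f = \prod_(z <- rs) ('X - z%:P)).
Local Notation Gal := 'Gal({:L} / 1%AS)%g.
Local Notation T := (seq_sub rs).

Lemma gal_root_mem (g : gal_of {:L}) z : z \in rs -> g z \in rs.
Proof.
rewrite -!root_prod_XsubC -hf => rz.
have <- : map_poly g (map_poly (intmul 1 : int -> L) f) = map_poly (intmul 1 : int -> L) f.
  by rewrite -map_poly_comp; apply: eq_map_poly => i /=; rewrite rmorph_int.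
exact: rmorph_root.
Qed.

Definition root_map (g : gal_of {:L}) (r : T) : T := SeqSub (gal_root_mem g (ssvalP r)).

Lemma root_map_inj g : injective (root_map g).
Proof.
move=> r s /(congr1 val) /= e; apply: val_inj; exact: (fmorph_inj g).
Qed.

Definition root_perm g : {perm T} := perm (@root_map_inj g).

Lemma root_permE g r : val (root_perm g r) = g (val r).
Proof. by rewrite permE. Qed.

Lemma galois_permE : galois_perm rs = root_perm @: Gal.
Proof.
apply/setP => s; rewrite inE; apply/exists_inP/imsetP => -[g gG].
  move=> /forallP sg; exists g => //; apply/permP => r; apply: val_inj.
  by rewrite root_permE; apply/eqP.
move=> ->; exists g => //; apply/forallP => r; by rewrite root_permE.
Qed.

Lemma card_galois_perm : <<1 & rs>>%VS = fullv -> #|galois_perm rs| = #|Gal|.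
Proof.
move=> gen; rewrite galois_permE card_in_imset // => g h gG hG /permP gh.
apply/eqP/gal_eqP => a _; pose x := (g * h^-1)%g.
have xrs z : z \in rs -> x z = z.
  move=> zr; have := congr1 val (gh (SeqSub zr)); rewrite !root_permE /= => e.
  by rewrite /x galM ?memvf // e -galM ?memvf // mulgV gal_id.
have : (<<1 & rs>> <= fixedField [set x])%VS.
  apply/Fadjoin_seqP; split; first exact: sub1v.
  by move=> z zr; apply/fixedFieldP; rewrite ?memvf // => y /set1P ->; apply: xrs.
rewrite gen => /subvP/(_ a (memvf a))/mem_fixedFieldP[_ /(_ x (set11 x))].
rewrite /x galM ?memvf // => e.
by rewrite -[in RHS]e -galM ?memvf // mulVg gal_id.
Qed.

Lemma minPoly_eqp z : irreducible_poly (map_poly (intmul 1 : int -> rat) f) -> z \in rs ->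
  minPoly 1 z %= map_poly (intmul 1 : int -> L) f.
Proof.
move=> irr zr.
have fL : map_poly (in_alg L) (map_poly (intmul 1 : int -> rat) f) = map_poly (intmul 1) f.
  by rewrite -map_poly_comp; apply: eq_map_poly => i; apply: (rmorph_int (in_alg L)).
have /polyOver1P[p pE] := minPolyOver 1 z.
rewrite pE -fL eqp_map; apply: irr.2.
  by rewrite -(size_map_poly (in_alg L)) -pE size_minPoly.
rewrite -(dvdp_map (in_alg L)) fL -pE; apply: minPoly_dvdp.
  by rewrite -fL; apply/polyOver1P; exists (map_poly (intmul 1) f).
by rewrite hf root_prod_XsubC.
Qed.

Lemma galois_perm_transitive : irreducible_poly (map_poly (intmul 1 : int -> rat) f) ->
  (0 < size rs)%N -> [transitive galois_perm rs, on setT | 'P].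
Proof.
move=> irr rs0; have [z0 z0r] : exists z, z \in rs by case: rs rs0 => // z l; exists z; rewrite mem_head.
have minE := minPoly_eqp irr.
pose r0 : T := SeqSub z0r; apply/imsetP; exists r0; rewrite ?inE //.
apply/setP => s; rewrite inE; symmetry; apply/imsetP.
have sr : val s \in rs := ssvalP s.
have [||||g gG gs] := @normalField_root_minPoly _ _ 1%AS {:L}%AS z0 (val s).
- exact: sub1v.
- exact: normalFieldf.
- exact: memvf.
- by rewrite (eqp_root (minE z0 z0r)) hf root_prod_XsubC.
exists (root_perm g); first by rewrite galois_permE imset_f.
by apply: val_inj; rewrite /= /aperm root_permE.
Qed.

Section FrobeniusCycle.
Variables (q : nat) (k : fieldType) (phi : {rmorphism algint L -> k}).
Hypotheses (phi_sur : forall z, exists x, phi x = z) (qk : q \in [pchar k]).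
Hypotheses (mf : f \is monic) (gen : <<1 & rs>>%VS = fullv).
Hypothesis rs_uniq : uniq rs.
Variable rsO : seq (algint L).
Hypothesis rsOE : map val rsO = rs.
Hypothesis phi_inj : {in rsO &, injective phi}.

Lemma residue_frobenius_perm : exists2 s, s \in galois_perm rs & exists rho : T -> k,
  [/\ injective rho, forall t, rho (s t) = rho t ^+ q &
      forall t, (map_poly (intmul 1 : int -> k) f).[rho t] = 0].
Proof.
have [g gG gP] := frobenius_exists phi qk rsO.
have ex (t : T) : exists a, a \in rsO /\ val a = val t.
  have /mapP[a ar aE] : val t \in map val rsO by rewrite rsOE; apply: ssvalP.
  by exists a; rewrite aE.
have [lift liftP] := boolp.choice ex.
have lift_in t : lift t \in rsO by case: (liftP t).
have lift_val t : val (lift t) = val t by case: (liftP t).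
exists (root_perm g); first by rewrite galois_permE imset_f.
exists (fun t => phi (lift t)); split=> [t u|t|t].
- move/phi_inj => /(_ (lift_in t) (lift_in u)) /(congr1 val).
  by rewrite !lift_val => /val_inj.
- rewrite -gP //; congr (phi _); apply: val_inj.
  by rewrite lift_val root_permE -lift_val.
rewrite (residue_poly hf rsOE phi) horner_prod (big_rem (lift t)) //=.
by rewrite hornerXsubC subrr mul0r.
Qed.

(** [Z d] collects the roots whose residues are zeros of [d]. The degree bounds add up to the number
    of roots, so [Z c] has exactly three elements. Frobenius permutes each [Z d]: on at most two
    points its square is trivial, on [Z c] it has no fixed point, since a residue fixed by Frobenius
    lies in the prime field and [c] has no zero there. *)
Lemma galois_3cycle (c : {poly int}) (ds : seq {poly int}) :
  (forall y, (map_poly (intmul 1 : int -> k) f).[y] = 0 ->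
     (map_poly intr c).[y] = 0 \/ exists2 d, d \in ds & (map_poly intr d).[y] = 0) ->
  c \is monic -> size c = 4%N -> (forall j, (j < q)%N -> ~~ (q %| `|c.[j%:Z]|)%N) ->
  all (fun d : {poly int} => (d \is monic) && (size d <= 3)%N) ds ->
  size rs = (3 + \sum_(d <- ds) (size d).-1)%N ->
  exists s, [/\ s \in galois_perm rs, #[s]%g = 3%N & #|support_perm s| = 3%N].
Proof.
move=> fac mc c4 cN dsP sz.
have [s sG [rho [rho_inj rho_s rho_f]]] := residue_frobenius_perm.
pose Z (d : {poly int}) := [set t : T | (map_poly (intmul 1 : int -> k) d).[rho t] == 0].
have cardZ (d : {poly int}) : d \is monic -> (#|Z d| <= (size d).-1)%N.
  move=> md; have dk0 : map_poly (intmul 1 : int -> k) d != 0.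
    by rewrite monic_neq0 // monic_map.
  have := @max_poly_roots k _ (map rho (enum (Z d))) dk0.
  rewrite size_map -cardE size_map_poly_id0 ?(monicP md) ?oner_neq0 // => H.
  have : (#|Z d| < size d)%N.
    apply: H; last by rewrite map_inj_uniq // enum_uniq.
    by apply/allP => _ /mapP[t + ->]; rewrite mem_enum inE.
  by case: (size d).
have sZ d t : t \in Z d -> s t \in Z d.
  rewrite !inE rho_s => /eqP e.
  rewrite -(pFrobenius_autE qk); set F := pFrobenius_aut qk.
  have -> : map_poly (intmul 1 : int -> k) d = map_poly F (map_poly (intmul 1) d).
    by rewrite -map_poly_comp; apply: eq_map_poly => i /=; rewrite rmorph_int.
  by rewrite horner_map e rmorph0.
have cT : #|{: T}| = size rs by rewrite card_seq_sub.
have cover t : t \in Z c \/ exists2 d, d \in ds & t \in Z d.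
  have [h|[d dd h]] := fac _ (rho_f t); [left|right; exists d => //]; by rewrite inE h eqxx.
have Zc3 : #|Z c| = 3%N.
  apply/eqP; rewrite eqn_leq; apply/andP; split; first by have := cardZ c mc; rewrite c4.
  have cU (es : seq {poly int}) : (#|[set t : T | has (fun d => t \in Z d) es]| <=
      \sum_(d <- es) #|Z d|)%N.
    elim: es => [|d es IH].
      by rewrite big_nil (_ : [set _ | _] = set0) ?cards0 //; apply/setP => t; rewrite !inE.
    rewrite big_cons (_ : [set _ | _] = Z d :|: [set t : T | has (fun d => t \in Z d) es]); last first.
      by apply/setP => t; rewrite in_setU ![_ \in [set _ | has _ _]]in_set.
    by apply: leq_trans (leq_add (leqnn _) IH); rewrite -cardsUI leq_addr.
  have : (#|{: T}| <= #|Z c| + \sum_(d <- ds) (size d).-1)%N.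
    rewrite -cardsT (_ : setT = Z c :|: [set t : T | has (fun d => t \in Z d) ds]); last first.
      apply/setP => t; rewrite in_setT in_setU; symmetry; apply/orP.
      by case: (cover t) => [|[d dd td]]; [left|right; rewrite in_set; apply/hasP; exists d].
    apply: leq_trans (_ : #|Z c| + \sum_(d <- ds) #|Z d| <= _)%N.
      apply: leq_trans (leq_add (leqnn _) (cU ds)); by rewrite -cardsUI leq_addr.
    rewrite leq_add2l big_seq [leqRHS]big_seq; apply: leq_sum => d dd.
    by apply: cardZ; have /allP/(_ d dd)/andP[] := dsP.
  by rewrite cT sz leq_add2r.
have sfix t : t \in Z c -> s t != t.
  move=> tc; apply/eqP => st; have := rho_s t; rewrite st => /esym yq.
  have [j jq yj] := pchar_fixed_nat qk yq.
  move: tc; rewrite inE yj -[j%:R]/(j%:Z%:~R) horner_map /= => /eqP e.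
  have := cN j jq; rewrite -(residue_int phi qk) rmorph_int e eqxx //.
have s2d d t : d \in ds -> t \in Z d -> s (s t) = t.
  move=> dd td; have /allP/(_ d dd)/andP[md d3] := dsP.
  have Zd2 : (#|Z d| <= 2)%N by rewrite (leq_trans (cardZ d md)) //; case: (size d) d3.
  have [st|st] := eqVneq (s t) t; first by rewrite !st.
  have ZE : [set t; s t] = Z d.
    apply/eqP; rewrite eqEcard cards2 eq_sym st Zd2 andbT.
    by apply/subsetP => u /set2P[]->; rewrite ?sZ.
  have : s (s t) \in [set t; s t] by rewrite ZE !sZ.
  by case/set2P => // /perm_inj e; rewrite e eqxx in st.
have s2c t : t \in Z c -> s (s t) != t /\ s (s (s t)) = t.
  move=> tc; have st := sfix t tc; have stc := sZ c t tc; have sst := sfix _ stc.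
  (* If [s] exchanged [t] and [s t], the third point of [Z c] would be fixed. *)
  have s2t : s (s t) != t.
    apply/eqP => e.
    have [u uc] : exists u, u \in Z c :\: [set t; s t].
      apply/set0Pn; rewrite -card_gt0 cardsD Zc3 subn_gt0.
      by apply: leq_ltn_trans (subset_leq_card (subsetIr _ _)) _; rewrite cards2; case: eqP.
    move: uc; rewrite !inE negb_or => /andP[/andP[ut ust] uc].
    have uZ : u \in Z c by rewrite inE.
    have ZE : [set t; s t; u] = Z c.
      apply/eqP; rewrite eqEcard Zc3 cards_three //; try by rewrite eq_sym.
      by rewrite andbT; apply/subsetP => v; rewrite !in_setU !in_set1 => /orP[/orP[]|] /eqP->.
    have := sZ c u uZ; rewrite -ZE !inE => /orP[/orP[]|] /eqP su.
    - by move: su; rewrite -e => /perm_inj us; rewrite us eqxx in ust.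
    - by move/perm_inj: su => us; rewrite us eqxx in ut.
    - by have := sfix u uZ; rewrite su eqxx.
  split=> //; have ZE : [set t; s t; s (s t)] = Z c.
    apply/eqP; rewrite eqEcard Zc3 cards_three //; try by rewrite eq_sym.
    by rewrite andbT; apply/subsetP => v; rewrite !in_setU !in_set1 => /orP[/orP[]|] /eqP->; rewrite ?sZ.
  have := sZ c _ (sZ c _ stc); rewrite -ZE !inE => /orP[/orP[]|] /eqP e //.
  - by move/perm_inj: e => e; rewrite e eqxx in s2t.
  - by move/perm_inj: e => e; rewrite e eqxx in sst.
have ssE t : (s * s)%g t = s (s t) by rewrite permM.
have supE : support_perm (s * s)%g = Z c.
  apply/setP => t; rewrite in_set ssE; case: (boolP (t \in Z c)) => tc.
    by have [] := s2c t tc.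
  by case: (cover t) => [|[d dd td]]; [rewrite (negbTE tc)|rewrite (s2d d t dd td) eqxx].
exists (s * s)%g; split; [by rewrite groupM | | by rewrite supE].
have [t tc] : exists t, t \in Z c by apply/set0Pn; rewrite -card_gt0 Zc3.
apply: nt_prime_order => //; last first.
  by apply: contraTneq tc => e; rewrite -supE e inE perm1 eqxx.
apply/permP => u; rewrite permX perm1 /= !ssE.
case: (boolP (u \in Z c)) => uc; first by have [_ s3] := s2c u uc; rewrite !s3.
case: (cover u) => [|[d dd ud]]; first by rewrite (negbTE uc).
by rewrite !(s2d d u dd ud).
Qed.

End FrobeniusCycle.

End GaloisPermutations.

(** * Laguerre polynomials and their discriminant *)

Section Laguerre.
Variable S : int.

(* The monic Laguerre polynomial [(-1)^n n! L_n^(alpha)] with [alpha = -S]. *)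
Definition laguerre_coef (n j : nat) : int :=
  'C(n, j)%:Z * \prod_(j.+1 <= i < n.+1) (S - i%:Z).

Definition laguerre n : {poly int} := \poly_(j < n.+1) laguerre_coef n j.

Lemma coef_laguerre n j : (laguerre n)`_j = laguerre_coef n j.
Proof.
rewrite coef_poly ltnS; case: leqP => // nj.
by rewrite /laguerre_coef bin_small ?mul0r.
Qed.

Lemma laguerre_rec n : laguerre n.+2 =
  ('X + (S - (2 * n + 3)%:Z)%:P) * laguerre n.+1
  + ((n.+1)%:Z * (S - n.+1%:Z)) *: laguerre n.
Proof.
have N3 : (2 * n + 3)%:Z = 2 * n%:Z + 3 by lia.
apply/polyP => j; rewrite N3 coefD mulrDl coefD coefXM coefCM coefZ !coef_laguerre.
rewrite /laguerre_coef.
have [jn|nj] := leqP j n; last first.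
  move: nj; rewrite leq_eqVlt => /orP[/eqP <-|].
    rewrite /= !binSn binn bin_small // !big_nat1 big_geq //.
    rewrite !intS; ring.
  rewrite leq_eqVlt => /orP[/eqP <-|nj] /=.
    by rewrite !binn !big_geq ?bin_small ?(leqW (leqnn _)) // ?(leqW (leqW (leqnn _))) //; ring.
  case: j nj => // j nj /=; have nj1 : (n.+1 < j)%N by [].
  rewrite (bin_small nj) (bin_small nj1) (bin_small (ltnW nj)) bin_small ?(ltnW (ltnW nj)) //; ring.
set G := \prod_(j.+1 <= i < n.+1) (S - i%:Z).
have G1 : \prod_(j.+1 <= i < n.+2) (S - i%:Z) = G * (S - n.+1%:Z).
  by rewrite big_nat_recr.
have G2 : \prod_(j.+1 <= i < n.+3) (S - i%:Z) = G * (S - n.+1%:Z) * (S - n.+2%:Z).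
  by rewrite (@big_nat_recr _ _ _ n.+2) ?G1 //; lia.
rewrite G1 G2; case: j jn @G G1 G2 => [|j] jn G G1 G2 /=.
  by rewrite !bin0; lia.
have -> : \prod_(j.+1 <= i < n.+2) (S - i%:Z) = (S - j.+1%:Z) * (G * (S - n.+1%:Z)).
  by rewrite big_ltn ?G1 //; lia.
have E2 := congr1 Posz (mul_bin_left n.+1 j).
have E4 := congr1 Posz (mul_bin_down n.+1 j.+1).
have E3 : 'C(n.+2, j.+1)%:Z = 'C(n.+1, j.+1)%:Z + 'C(n.+1, j)%:Z by rewrite binS PoszD.
rewrite !PoszM -subzn ?(ltnW (leqW jn)) // in E2.
rewrite !PoszM -subzn ?(leqW jn) //= in E4.
rewrite E3; set A := 'C(n.+1, j.+1)%:Z; set B := 'C(n.+1, j)%:Z in E2 *; set C := 'C(n, j.+1)%:Z in E4 *.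
rewrite -/A in E2 E4; rewrite !intS in E2 E4 *.
have -> : (1 + n%:Z) * (S - (1 + n%:Z)) * (C * G) = (S - (1 + n%:Z)) * G * ((1 + n%:Z) * C) by ring.
rewrite E4; have -> : B * ((S - (1 + j%:Z)) * (G * (S - (1 + n%:Z)))) =
   (S * B) * (G * (S - (1 + n%:Z))) - G * (S - (1 + n%:Z)) * ((1 + j%:Z) * B) by ring.
apply/eqP; rewrite -subr_eq0; apply/eqP.
transitivity (G * (S - (1 + n%:Z)) * ((1 + j%:Z) * A - (1 + n%:Z - j%:Z) * B)); first by ring.
by rewrite E2 subrr mulr0.
Qed.

Lemma laguerre_deriv n : 'X * (laguerre n.+1)^`() =
  n.+1%:Z *: laguerre n.+1 - (n.+1%:Z * (S - n.+1%:Z)) *: laguerre n.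
Proof.
apply/polyP => j; rewrite coefB !coefZ coefXM coef_deriv !coef_laguerre /laguerre_coef.
have [jn|nj] := leqP j n; last first.
  move: nj; rewrite leq_eqVlt => /orP[/eqP <-|nj] /=.
    by rewrite binn bin_small // big_geq // -mulr_natl; ring.
  case: j nj => // j nj /=; rewrite (bin_small nj) bin_small ?(ltnW nj) //.
  by rewrite !mul0r mul0rn !mulr0 subr0.
set G := \prod_(j.+1 <= i < n.+1) (S - i%:Z).
have GE : \prod_(j.+1 <= i < n.+2) (S - i%:Z) = G * (S - n.+1%:Z) by rewrite big_nat_recr.
rewrite GE.
have E := congr1 Posz (mul_bin_down n.+1 j); rewrite !PoszM -subzn ?(leqW jn) //= in E.
have -> : n.+1%:Z * (S - n.+1%:Z) * ('C(n, j)%:Z * G) = (S - n.+1%:Z) * G * (n.+1%:Z * 'C(n, j)%:Z) by ring.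
rewrite E; case: j jn @G GE E => [|j] jn G GE E /=; first by rewrite !bin0 subr0; ring.
by rewrite GE -mulr_natl natz !intS; ring.
Qed.

Lemma size_laguerre n : size (laguerre n) = n.+1.
Proof. by rewrite size_poly_eq // /laguerre_coef binn big_geq // mulr1. Qed.

Lemma laguerre_monic n : laguerre n \is monic.
Proof.
by rewrite monicE lead_coefE size_laguerre coef_laguerre /laguerre_coef binn big_geq // mulr1.
Qed.

Lemma laguerre_coef0 n : (laguerre n)`_0 = \prod_(1 <= i < n.+1) (S - i%:Z).
Proof. by rewrite coef_laguerre /laguerre_coef bin0 mul1r. Qed.

End Laguerre.

Lemma prod_diff_swap (R : comNzRingType) (A B : seq R) :
  \prod_(z <- A) \prod_(w <- B) (z - w) =
  (-1) ^+ (size A * size B) * \prod_(w <- B) \prod_(z <- A) (w - z).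
Proof.
rewrite exchange_big /=; transitivity (\prod_(w <- B) ((-1) ^+ size A * \prod_(z <- A) (w - z))).
  apply: eq_bigr => w _; elim: A => [|z A IH]; first by rewrite !big_nil mul1r.
  by rewrite !big_cons IH /= exprS; ring.
by rewrite big_split /= big_const_seq count_predT iter_mulr_1 exprM.
Qed.

Section LaguerreDiscriminant.
Variables (K : closedFieldType) (S : int).
Local Notation FK n := (map_poly (intmul 1 : int -> K) (laguerre S n)).

Lemma laguerreK_rec n : FK n.+2 =
  ('X + (S - (2 * n + 3)%:Z)%:~R%:P) * FK n.+1
  + (n.+1%:Z * (S - n.+1%:Z))%:~R *: FK n.
Proof.
by rewrite laguerre_rec rmorphD rmorphM rmorphD /= map_polyX map_polyC map_polyZ.
Qed.

Lemma laguerreK_deriv n : 'X * (FK n.+1)^`() =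
  n.+1%:Z%:~R *: FK n.+1 - (n.+1%:Z * (S - n.+1%:Z))%:~R *: FK n.
Proof.
rewrite deriv_map -(map_polyX (intmul 1 : {rmorphism int -> K})) -rmorphM /= laguerre_deriv.
by rewrite rmorphB /= !map_polyZ.
Qed.

Lemma size_laguerreK n : size (FK n) = n.+1.
Proof.
by rewrite size_map_poly_id0 ?size_laguerre // (monicP (laguerre_monic S n)) oner_neq0.
Qed.

Lemma roots_laguerreK n (A : seq K) : FK n = \prod_(z <- A) ('X - z%:P) -> size A = n.
Proof. by move=> e; have := size_laguerreK n; rewrite e size_prod_XsubC => -[]. Qed.

Lemma roots_laguerreK_exists n : exists A : seq K, FK n = \prod_(z <- A) ('X - z%:P).
Proof.
have [A AE] := closed_field_poly_normal (FK n); exists A.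
by rewrite AE (monicP (monic_map _ (laguerre_monic S n))) scale1r.
Qed.

(* Schur's computation: the recurrence turns the resultant of two consecutive
   polynomials into the previous one. *)
Lemma laguerreK_resultant n (A : seq K) : FK n.+1 = \prod_(z <- A) ('X - z%:P) ->
  \prod_(z <- A) (FK n).[z] = (\prod_(1 <= j < n.+1) (j%:Z * (S - j%:Z)) ^+ j)%:~R.
Proof.
elim: n A => [|n IH] A AE.
  rewrite big_geq // big1 // => z _.
  have -> : laguerre S 0 = 1.
    apply/polyP => i; rewrite coef_laguerre /laguerre_coef coef1 big_geq ?mulr1 //.
    by case: i.
  by rewrite rmorph1 hornerC.
have [B BE] := roots_laguerreK_exists n.+1.
have sA := roots_laguerreK AE; have sB := roots_laguerreK BE.
rewrite BE; under eq_bigr do rewrite horner_prod.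
under eq_bigr do under eq_bigr do rewrite hornerXsubC.
(* The degrees are consecutive, so their product is even and the exchange produces no sign. *)
rewrite prod_diff_swap sA sB -signr_odd oddM /= andNb expr0 mul1r.
have -> : \prod_(w <- B) \prod_(z <- A) (w - z) = \prod_(w <- B) (FK n.+2).[w].
  by apply: eq_bigr => w _; rewrite AE horner_prod; apply: eq_bigr => z _; rewrite hornerXsubC.
have -> : \prod_(w <- B) (FK n.+2).[w] =
   \prod_(w <- B) ((n.+1%:Z * (S - n.+1%:Z))%:~R * (FK n).[w]).
  rewrite !big_seq; apply: eq_bigr => w wB; rewrite laguerreK_rec hornerD hornerM hornerZ.
  have -> : (FK n.+1).[w] = 0 by apply/eqP; rewrite -[_ == _]/(root _ _) BE root_prod_XsubC.
  by rewrite mulr0 add0r.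
rewrite big_split /= big_const_seq count_predT iter_mulr_1 IH // sB.
by rewrite [in RHS]big_nat_recr //= [in RHS]rmorphM rmorphXn mulrC.
Qed.

(** At a root z, the differential relation makes -z F'(z) a constant multiple of the preceding
    polynomial, which reduces the product to the resultant. The factors -z multiply to the constant
    coefficient, kept on the left to avoid a division. *)
Lemma laguerreK_discriminant n (A : seq K) : FK n.+1 = \prod_(z <- A) ('X - z%:P) ->
  (\prod_(1 <= i < n.+2) (S - i%:Z))%:~R * \prod_(z <- A) (FK n.+1)^`().[z] =
  (\prod_(1 <= j < n.+2) (j%:Z * (S - j%:Z)) ^+ j)%:~R.
Proof.
move=> AE; have sA := roots_laguerreK AE.
have F0 : (\prod_(1 <= i < n.+2) (S - i%:Z))%:~R = \prod_(z <- A) (- z).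
  rewrite -laguerre_coef0 -coef_map /= AE -horner_coef0 horner_prod.
  by apply: eq_bigr => z _; rewrite hornerXsubC add0r.
rewrite F0 -big_split /=.
have -> : \prod_(z <- A) (- z * (FK n.+1)^`().[z]) =
   \prod_(z <- A) ((n.+1%:Z * (S - n.+1%:Z))%:~R * (FK n).[z]).
  rewrite !big_seq; apply: eq_bigr => z zA.
  have := congr1 (fun P : {poly K} => P.[z]) (laguerreK_deriv n).
  rewrite hornerM hornerX hornerD hornerN !hornerZ.
  have -> : (FK n.+1).[z] = 0 by apply/eqP; rewrite -[_ == _]/(root _ _) AE root_prod_XsubC.
  by rewrite mulr0 sub0r mulNr => ->; rewrite opprK.
rewrite big_split /= big_const_seq count_predT iter_mulr_1 laguerreK_resultant // sA.
by rewrite [in RHS]big_nat_recr //= [in RHS]rmorphM rmorphXn mulrC.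
Qed.

End LaguerreDiscriminant.

Section Vandermonde.
Variables (R : comNzRingType).

Lemma deriv_prod_XsubC n (a : 'I_n -> R) i :
  (\prod_j ('X - (a j)%:P))^`().[a i] = \prod_(j | j != i) (a i - a j).
Proof.
rewrite (bigD1 i) //= derivM derivXsubC mul1r hornerD hornerM hornerXsubC subrr mul0r addr0.
by rewrite horner_prod; apply: eq_bigr => j _; rewrite hornerXsubC.
Qed.

Definition delta n (a : 'I_n -> R) := \prod_(i < n) \prod_(j < n | (i < j)%N) (a j - a i).

Lemma delta_sqr n (a : 'I_n -> R) :
  delta a ^+ 2 = (-1) ^+ 'C(n, 2) * \prod_i (\prod_j ('X - (a j)%:P))^`().[a i].
Proof.
under [in RHS]eq_bigr do rewrite deriv_prod_XsubC.
have -> : \prod_(i < n) \prod_(j < n | j != i) (a i - a j) =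
  (\prod_(i < n) \prod_(j < n | (i < j)%N) (a i - a j)) * delta a.
  rewrite /delta [X in _ * X](exchange_big_dep predT) //= -big_split /=.
  apply: eq_bigr => i _; rewrite (bigID (fun j : 'I_n => (i < j)%N)) /=; congr (_ * _).
    by apply: eq_bigl => j; rewrite -val_eqE /=; case: ltngtP.
  by apply: eq_bigl => j; rewrite -val_eqE /=; case: ltngtP.
rewrite mulrA expr2; congr (_ * _).
have -> : \prod_(i < n) \prod_(j < n | (i < j)%N) (a i - a j) =
   \prod_(i < n) \prod_(j < n | (i < j)%N) (-1) * delta a.
  rewrite -big_split /=; apply: eq_bigr => i _; rewrite -big_split /=.
  by apply: eq_bigr => j _; ring.
have -> : \prod_(i < n) \prod_(j < n | (i < j)%N) (-1) = (-1) ^+ 'C(n, 2) :> R.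
  under eq_bigr do rewrite prodr_const.
  rewrite prodrXr; congr (_ ^+ _).
  rewrite -bin2_sum big_mkord.
  transitivity (\sum_(i < n) \sum_(j < n | (i < j)%N) 1)%N.
    by apply: eq_bigr => i _; rewrite sum1_card.
  rewrite (exchange_big_dep predT) //=; apply: eq_bigr => j _.
  by rewrite (big_ord_narrow (ltnW (ltn_ord j))) sum1_card card_ord.
by rewrite mulrA -exprD addnn -signr_odd odd_double expr0 mul1r.
Qed.

(** Permuting the arguments permutes the columns of a Vandermonde determinant. *)
Lemma delta_perm n (a : 'I_n -> R) (s : {perm 'I_n}) :
  delta (fun i => a (s i)) = (-1) ^+ s * delta a.
Proof.
pose V (b : 'I_n -> R) := Vandermonde n (\row_j b j).
have VE b : delta b = \det (V b).
  rewrite det_Vandermonde; apply: eq_bigr => i _; apply: eq_bigr => j _.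
  by rewrite !mxE.
rewrite !VE; have -> : V (fun i => a (s i)) = V a *m perm_mx s^-1%g.
  by rewrite -col_permE; apply/matrixP => i j; rewrite !mxE.
by rewrite det_mulmx det_perm odd_permV mulrC.
Qed.

End Vandermonde.

(** Schur's induction uses the roots of all lower Laguerre polynomials, which need not lie in [L],
    so [L] is embedded into an algebraically closed field. A primitive element goes to a complex
    root of its minimal polynomial; [wd] shows that the value does not depend on the polynomial
    representing an element. *)
Lemma fieldext_algC_morphism (L : splittingFieldType rat) :
  exists iota : L -> algC, zmod_morphism iota /\ monoid_morphism iota.
Proof.
have /and3P[_ sep _] := galois_rat L.
have [th thE] : exists th : L, <<1; th>>%VS = fullv.
  exists (separable_generator 1 {:L}); symmetry.
  by apply: eq_adjoin_separable_generator; rewrite ?sub1v.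
have [p pE] : exists p : {poly rat}, minPoly 1 th = map_poly (in_alg L) p.
  by have /polyOver1P[p ->] := minPolyOver 1 th; exists p.
pose C := map_poly (ratr : rat -> algC).
have [zt zt0] : exists z, root (C p) z.
  apply/closed_rootP; rewrite size_map_poly -(size_map_poly (in_alg L)) -pE size_minPoly.
  by [].
have wd (u v : {poly rat}) : (map_poly (in_alg L) u).[th] = (map_poly (in_alg L) v).[th] ->
    (C u).[zt] = (C v).[zt].
  move=> e; apply/eqP; rewrite -subr_eq0 -hornerN -hornerD -rmorphB.
  have : p %| u - v.
    rewrite -(dvdp_map (in_alg L)) -pE; apply: minPoly_dvdp.
      by apply/polyOver1P; exists (u - v).
    by rewrite /root rmorphB hornerD hornerN e subrr.
  case/dvdpP => w ->; rewrite rmorphM hornerM; move/eqP: zt0 => ->; by rewrite mulr0.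
have ex (x : L) : exists u : {poly rat}, (map_poly (in_alg L) u).[th] = x.
  have : x \in <<1; th>>%VS by rewrite thE memvf.
  by case/Fadjoin1_polyP => u ->; exists u.
have [Q QE] := boolp.choice ex.
exists (fun x => (C (Q x)).[zt]); split.
  move=> x y; rewrite -hornerN -hornerD -rmorphB; apply: wd.
  by rewrite QE rmorphB hornerD hornerN !QE.
split=> [|x y].
  rewrite (wd _ 1); first by rewrite /C rmorph1 hornerC.
  by rewrite QE rmorph1 hornerC.
rewrite -hornerM -rmorphM; apply: wd.
by rewrite QE rmorphM hornerM !QE.
Qed.

Lemma laguerre_delta_sqr (L : splittingFieldType rat) (S : int) n (a : 'I_n.+1 -> L) :
  map_poly (intmul 1 : int -> L) (laguerre S n.+1) = \prod_i ('X - (a i)%:P) ->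
  (\prod_(1 <= i < n.+2) (S - i%:Z))%:~R * delta a ^+ 2 =
  (-1) ^+ 'C(n.+1, 2) * (\prod_(1 <= j < n.+2) (j%:Z * (S - j%:Z)) ^+ j)%:~R.
Proof.
have [iota0 [iotaB iotaM]] := fieldext_algC_morphism L.
pose iota : {rmorphism L -> algC} :=
  HB.pack iota0 (GRing.isZmodMorphism.Build _ _ iota0 iotaB) (GRing.isMonoidMorphism.Build _ _ iota0 iotaM).
move=> aE; apply: (fmorph_inj iota); rewrite rmorphM [RHS]rmorphM !rmorph_int rmorphXn rmorph_sign.
have -> : iota (delta a) = delta (iota \o a).
  rewrite /delta rmorph_prod; apply: eq_bigr => i _; rewrite rmorph_prod.
  by apply: eq_bigr => j _; rewrite rmorphB.
have bE : map_poly (intmul 1 : int -> algC) (laguerre S n.+1) = \prod_i ('X - (iota (a i))%:P).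
  have := congr1 (map_poly iota) aE; rewrite -map_poly_comp rmorph_prod.
  rewrite (eq_map_poly (g := (intmul 1 : int -> algC))) => [->|i]; last exact: rmorph_int.
  by apply: eq_bigr => i _; apply: map_polyXsubC.
rewrite delta_sqr -bE mulrCA; congr (_ * _).
have bE' : map_poly (intmul 1 : int -> algC) (laguerre S n.+1) =
    \prod_(z <- [seq iota (a i) | i <- enum 'I_n.+1]) ('X - z%:P).
  by rewrite bE big_map big_enum.
by rewrite -(laguerreK_discriminant bE') big_map big_enum.
Qed.

(** * Parity of permutations of the roots and squareness of the discriminant *)

Section OrdPerm.
Variable T : finType.

Definition ord_perm_fun (s : {perm T}) (i : 'I_#|T|) : 'I_#|T| := enum_rank (s (enum_val i)).
Lemma ord_perm_inj s : injective (ord_perm_fun s).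
Proof. by move=> i j /enum_rank_inj/perm_inj/enum_val_inj. Qed.
Definition ord_perm s := perm (@ord_perm_inj s).

Lemma ord_permM : {in setT &, {morph ord_perm : s t / (s * t)%g}}.
Proof. by move=> s t _ _; apply/permP => i; rewrite permM !permE /ord_perm_fun enum_rankK permM. Qed.
Canonical ord_perm_morphism := Morphism ord_permM.

Lemma injm_ord_perm : ('injm ord_perm)%g.
Proof.
apply/subsetP => s /morphpreP[_ /set1gP s1]; apply/set1gP/permP => x.
have /permP/(_ (enum_rank x)) := s1.
by rewrite permE /ord_perm_fun enum_rankK !perm1 => /enum_rank_inj.
Qed.

Lemma odd_ord_perm s : odd_perm (ord_perm s) = odd_perm s.
Proof.
have opT x y : x != y -> odd_perm (ord_perm (tperm x y)) = true.
  move=> xy; suff -> : ord_perm (tperm x y) = tperm (enum_rank x) (enum_rank y).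
    by rewrite odd_tperm (inj_eq enum_rank_inj) xy.
  apply/permP => i; rewrite permE /ord_perm_fun -[in RHS](enum_valK i).
  case: (tpermP x y (enum_val i)) => [->|->|/eqP xi /eqP yi].
  - by rewrite tpermL.
  - by rewrite tpermR.
  by rewrite tpermD // (inj_eq enum_rank_inj) eq_sym.
have [ts -> dts] := prod_tpermP s; elim: ts dts => [|t ts IH] /=.
  rewrite big_nil odd_perm1; suff -> : ord_perm 1%g = 1%g by rewrite odd_perm1.
  by apply/permP => i; rewrite [LHS]permE /ord_perm_fun perm1 enum_valK perm1.
by move=> /andP[tt dts]; rewrite big_cons ord_permM ?inE // !odd_permM IH // opT // odd_tperm tt.
Qed.

Lemma Alt_isog_ord : ('Alt_T \isog 'Alt_('I_#|T|))%g.
Proof.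
suff <- : (ord_perm_morphism @* 'Alt_T)%g = ('Alt_('I_#|T|))%g by rewrite sub_isog ?subsetT ?injm_ord_perm.
apply/eqP; rewrite eqEcard; apply/andP; split.
  apply/subsetP => _ /morphimP[s _ sA ->]; move: sA; rewrite !Alt_even.
  by rewrite [X in _ -> ~~ odd_perm X]/= odd_ord_perm.
rewrite card_injm ?subsetT ?injm_ord_perm //.
have [T1|T1] := leqP #|T| 1; first by rewrite !trivial_Alt_2 ?cards1 ?card_ord // (leq_trans T1).
by rewrite -(leq_pmul2l (isT : 0 < 2)%N) !card_Alt ?card_ord.
Qed.

End OrdPerm.

Section Criterion.
Variables (L : splittingFieldType rat) (rs : seq L) (f : {poly int}).
Hypotheses (hf : map_poly (intmul 1 : int -> L) f = \prod_(z <- rs) ('X - z%:P)).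
Local Notation Gal := 'Gal({:L} / 1%AS)%g.
Local Notation T := (seq_sub rs).

Definition root_enum (i : 'I_#|{: T}|) : L := val (enum_val i).
Local Notation dl := (delta root_enum).

Lemma prod_root_enum (F : L -> {poly L}) : uniq rs ->
  \prod_(z <- rs) F z = \prod_i F (root_enum i).
Proof.
move=> u; rewrite -(big_enum_val (fun t : T => F (val t))) /=.
rewrite -big_enum -(big_map val predT F); apply: perm_big.
apply: uniq_perm => //; first by rewrite map_inj_uniq ?enum_uniq //; apply: val_inj.
move=> z; apply/idP/mapP => [zr|[t _ ->]]; last exact: ssvalP.
by exists (SeqSub zr); rewrite ?mem_enum.
Qed.

Lemma gal_delta (g : gal_of {:L}) : g dl = (-1) ^+ (root_perm hf g) * dl.
Proof.
rewrite -odd_ord_perm -delta_perm /delta rmorph_prod; apply: eq_bigr => i _.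
rewrite rmorph_prod; apply: eq_bigr => j _; rewrite rmorphB /root_enum.
by rewrite !permE /ord_perm_fun !enum_rankK !root_permE.
Qed.

(** An automorphism multiplies the product of root differences by the sign of its permutation. As
    this product is nonzero, all signs are trivial exactly when it is fixed, that is, rational. *)
Lemma galois_perm_Alt_sqr (D : rat) : dl ^+ 2 = D%:A -> D != 0 ->
  (galois_perm rs \subset 'Alt_T)%g <-> exists r, D = r ^+ 2.
Proof.
move=> dD D0; have d0 : dl != 0.
  by apply: contraNneq D0 => d0; rewrite -(fmorph_eq0 (in_alg L)) /= -dD d0 expr0n.
split=> [/subsetP sub|[r rD]].
  have /vlineP[r rE] : dl \in 1%VS.
    apply: gal_fixed_rat => g gG; rewrite gal_delta.
    have : root_perm hf g \in ('Alt_T)%g%g by apply: sub; rewrite (galois_permE hf) imset_f.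
    by rewrite Alt_even => /negbTE->; rewrite expr0 mul1r.
  exists r; apply: (fmorph_inj (in_alg L)); rewrite rmorphXn /= -dD rE //.
apply/subsetP => s; rewrite (galois_permE hf) => /imsetP[g gG ->]; rewrite Alt_even.
apply/negP => odd_g; have := gal_delta g; rewrite odd_g expr1 mulN1r.
have -> : g dl = dl.
  have : dl ^+ 2 = r%:A ^+ 2 by rewrite dD rD -[r%:A]/(in_alg L r) -rmorphXn.
  move/eqP; rewrite eqf_sqr => /orP[]/eqP->; rewrite ?rmorphN -[r%:A]/(in_alg L r) /=.
    by rewrite (fixed_gal _ gG) ?rpredZ ?rpred1 ?sub1v //; apply: rpredZ; apply: rpred1.
  by congr (- _); rewrite (fixed_gal _ gG) ?sub1v //; apply: rpredZ; apply: rpred1.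
move/eqP; rewrite -addr_eq0 -mulr2n -mulr_natl mulf_eq0 (negbTE d0) orbF.
by rewrite fieldext_nat_eq0.
Qed.

End Criterion.

(** * Newton polygons of the Pade coefficients *)

Section PadeCoefficients.
Local Open Scope nat_scope.

Definition pade_coef n r j := 'C(n, j) * \prod_(r.+1 <= t < (n + r - j).+1) t.

Lemma prod_range_gt0 a b : 0 < a -> 0 < \prod_(a <= t < b) t.
Proof.
move=> a0; rewrite big_seq; apply: prodn_cond_gt0 => t.
by rewrite mem_index_iota; case/andP => /(leq_trans a0).
Qed.

Lemma logn_prod_range p a b : 0 < a ->
  logn p (\prod_(a <= t < b) t) = \sum_(a <= t < b) logn p t.
Proof.
move=> a0; elim: b => [|b IH]; first by rewrite !big_geq // logn1.
have [ab|ba] := leqP a b; last by rewrite !big_geq // logn1.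
by rewrite !big_nat_recr //= lognM ?IH ?prod_range_gt0 // (leq_trans a0).
Qed.

Lemma sum_range_eq c a b : \sum_(a <= t < b) (t == c) = (a <= c < b).
Proof.
elim: b => [|b IH]; first by rewrite big_geq // ltn0 andbF.
have [ab|ba] := leqP a b; last by rewrite big_geq //; case: (leqP a c) => //=; lia.
by rewrite big_nat_recr //= IH; case: eqP; lia.
Qed.

Section Prime.
Variables (p n r : nat).
Hypotheses (p_pr : prime p) (p5 : 5 <= p) (np : n < 2 * p) (pn : p < n)
  (nr : r = n.+1 \/ n = r.+1).

(** The factors r+1, ..., n+r-j lie strictly between p and 4p. Their only possible multiples of [p]
    are 2p and 3p, and each contributes a single factor because [p >= 5]. *)
Lemma logn_pade_coef j : j <= n -> logn p (pade_coef n r j) =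
  logn p 'C(n, j) + (r < 2 * p <= n + r - j) + (r < 3 * p <= n + r - j).
Proof.
move=> jn; rewrite /pade_coef lognM ?bin_gt0 ?prod_range_gt0 //.
rewrite logn_prod_range // -addnA; congr (_ + _).
transitivity (\sum_(r.+1 <= t < (n + r - j).+1) ((t == 2 * p) + (t == 3 * p))).
  rewrite !big_nat; apply: eq_bigr => t /andP[rt tn].
  have t0 : 0 < t by apply: leq_ltn_trans rt.
  have t4 : t < 4 * p by clear -rt tn nr np jn; lia.
  have tp : p < t by clear -rt nr pn; lia.
  have : logn p t = (p %| t).
    case: (boolP (p %| t)) => [pt|/negbTE pt]; last by rewrite lognE pt !andbF.
    apply/eqP; rewrite eqn_leq -ltnS; apply/andP; split; last by rewrite logn_gt0 mem_primes p_pr t0.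
    rewrite ltnNge -(pfactor_dvdn 2 p_pr t0); apply/negP => /(dvdn_leq t0).
    by rewrite -mulnn; clear -t4 p5; nia.
  move=> ->; case: (boolP (p %| t)) => [/dvdnP[d dE]|pt].
    have d2 : d = 2 \/ d = 3 by clear -dE tp t4 p5; nia.
    by case: d2 dE => -> ->; rewrite eqxx; case: eqP => //; clear -p5; lia.
  case: eqP => [e|_]; first by rewrite e dvdn_mull in pt.
  by case: eqP => // e; rewrite e dvdn_mull in pt.
by rewrite big_split /= !sum_range_eq !ltnS.
Qed.

Lemma logn_bin_pos j : n - p < j -> j < p -> 0 < logn p 'C(n, j).
Proof.
move=> h1 h2; rewrite logn_gt0 mem_primes p_pr bin_gt0 prime_dvd_bin //.
- by rewrite andbT /=; clear -h2 pn; lia.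
- by clear -h1 h2 pn; lia.
- exact: ltnW.
Qed.

Lemma logn_bin_eq0 j : j <= n -> (j <= n - p) || (p <= j) -> logn p 'C(n, j) = 0.
Proof.
move=> jn h; apply/eqP; rewrite -leqn0 leqNgt; apply/negP => C1.
have Lf N : N < 2 * p -> logn p N`! = (p <= N).
  move=> N2; rewrite logn_fact //.
  transitivity (\sum_(1 <= k < N.+1) (k == 1) * (p <= N)).
    rewrite !big_nat; apply: eq_bigr => -[//|[|k]] /andP[_ kN]; rewrite ?expn1.
      rewrite mul1n; case: leqP => [pN|Np]; last by rewrite divn_small.
      have p0 := prime_gt0 p_pr; have : N %/ p < 2 by rewrite ltn_divLR.
      have : 0 < N %/ p by rewrite divn_gt0.
      by case: (N %/ p) => [|[]].
    rewrite mul0n divn_small // (leq_trans N2) // (@leq_trans (p ^ 2)) //.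
      by rewrite -mulnn leq_mul2r (leq_trans _ p5) // orbT.
    exact: leq_pexp2l (prime_gt0 p_pr) _.
  by rewrite -big_distrl /= sum_range_eq; case: (leqP p N) => pN /=; move: (prime_gt0 p_pr); lia.
have := congr1 (logn p) (bin_fact jn).
rewrite !lognM ?muln_gt0 ?fact_gt0 ?bin_gt0 // !Lf //; [|clear -np; lia|clear -jn np; lia].
by clear -C1 h pn jn; lia.
Qed.

Lemma dvd_pade e j : j <= n -> (p ^ e %| pade_coef n r j) = (e <= logn p (pade_coef n r j)).
Proof.
by move=> jn; rewrite pfactor_dvdn // muln_gt0 bin_gt0 jn prod_range_gt0.
Qed.

(* The Newton polygon of the coefficients at [p] has a side of horizontal
   length [p] and height 1. *)
Lemma pade_newton :
  (exists2 e, e = p & [/\ forall j, j < e -> p %| pade_coef n r j,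
    ~~ (p %| pade_coef n r e) & ~~ (p ^ 2 %| pade_coef n r 0)]) \/
  (exists2 k, 0 < k < p &
   [/\ forall j, j < k -> p ^ 2 %| pade_coef n r j,
       forall j, j < k + p -> p %| pade_coef n r j &
       [/\ ~~ (p ^ 3 %| pade_coef n r 0), ~~ (p ^ 2 %| pade_coef n r k),
           ~~ (p %| pade_coef n r (k + p)) & k + p <= n]]).
Proof.
have n0 : 0 < n by apply: leq_ltn_trans pn.
have dvd1 j : j <= n -> (p %| pade_coef n r j) = (0 < logn p (pade_coef n r j)).
  by move=> jn; rewrite -(dvd_pade 1 jn) expn1.
have v j (jn : j <= n) := logn_pade_coef jn.
have b1 := logn_bin_pos; have b0 := logn_bin_eq0.
have [p3|p3] := leqP (3 * p) (n + r); last first.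
  left; exists p => //; split=> [j jp||].
  - have jn : j <= n by apply: ltnW (ltn_trans jp pn).
    rewrite dvd1 // v //; have := b1 j; clear b1 b0 v dvd1.
    by case: (ltnP (n - p) j) => h; [move=> /(_ isT jp); lia|move=> _; lia].
  - rewrite dvd1 ?(ltnW pn) // v ?(ltnW pn) // b0 ?(ltnW pn) ?leqnn ?orbT //.
    by clear b1 b0 v dvd1; lia.
  - rewrite dvd_pade // v // b0 //; by clear b1 b0 v dvd1; lia.
(* Together with 3p <= n + r this forces r = 2p and n = 2p - 1, so 3p is the only multiple of [p] in
   the range. *)
have [p2|p2] := leqP (2 * p) r.
  left; exists p => //; split=> [j jp||].
  - have jn : j <= n by apply: ltnW (ltn_trans jp pn).
    by rewrite dvd1 // v //; clear b1 b0 v dvd1; lia.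
  - rewrite dvd1 ?(ltnW pn) // v ?(ltnW pn) // b0 ?(ltnW pn) ?leqnn ?orbT //.
    by clear b1 b0 v dvd1; lia.
  - rewrite dvd_pade // v // b0 //; by clear b1 b0 v dvd1; lia.
(* Now 2p and 3p both occur for j = 0. The factor 3p leaves the range at j = k and the factor 2p at
   j = k + p, which are the two lower vertices of the polygon. *)
right; pose k := n + r + 1 - 3 * p; have kE : k + 3 * p = n + r + 1 by rewrite /k; clear -p3; lia.
clearbody k; have kn : k <= n - p by clear -kE p2 pn; lia.
have kpn : k + p <= n by clear -kn pn; lia.
exists k; first by clear -kE p3 np p2 nr; lia.
split=> [j jk|j jkp|].
- have jn : j <= n by clear -jk kn; lia.
  by rewrite dvd_pade // v //; clear b1 b0 v dvd1; lia.
- have jn : j <= n by clear -jkp kpn; lia.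
  by rewrite dvd1 // v //; clear b1 b0 v dvd1; lia.
split=> //.
- rewrite dvd_pade // v // b0 //; by clear b1 b0 v dvd1; lia.
- have k_n : k <= n by clear -kn; lia.
  rewrite dvd_pade // v // b0 ?kn //; by clear b1 b0 v dvd1; lia.
- rewrite dvd1 // v // b0 ?leq_addl ?orbT //; by clear b1 b0 v dvd1; lia.
Qed.

End Prime.
End PadeCoefficients.

(** * Pade polynomials *)

Section PadeGalois.
Variables (n r : nat) (f : {poly int}) (L : splittingFieldType rat) (rs : seq L).
Hypotheses (n0 : (0 < n)%N) (nr : (r = n.+1 \/ n = r.+1)%N).
Hypotheses (mf : f \is monic) (sf : size f = n.+1)
  (fE : forall j, (j <= n)%N -> absz f`_j = pade_coef n r j).
Hypothesis irr : irreducible_poly (map_poly (intmul 1 : int -> rat) f).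
Hypothesis hf : map_poly (intmul 1 : int -> L) f = \prod_(z <- rs) ('X - z%:P).
Hypothesis gen : <<1 & rs>>%VS = fullv.
Local Notation Gal := 'Gal({:L} / 1%AS)%g.
Local Notation T := (seq_sub rs).
Local Notation G := (galois_perm_group rs).

Lemma size_roots : size rs = n.
Proof.
have := size_map_poly_id0 (f := (intmul 1 : int -> L)) (p := f).
by rewrite hf size_prod_XsubC sf (monicP mf) oner_neq0 => /(_ isT) [].
Qed.

Lemma roots_uniq : uniq rs.
Proof.
have [z0 z0r] : exists z, z \in rs.
  by have := size_roots; case: rs => [|z l] sz; [move: n0; rewrite -sz | exists z; rewrite mem_head].
rewrite -separable_prod_XsubC -hf -(eqp_separable (minPoly_eqp hf irr z0r)).
have /and3P[_ /separableP sep _] := galois_rat L.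
exact: sep (memvf z0).
Qed.

Lemma card_roots : #|{: T}| = n.
Proof. by rewrite card_seq_sub ?roots_uniq // size_roots. Qed.

Lemma galois_perm_trans : [transitive G, on setT | 'P].
Proof. by apply: galois_perm_transitive hf irr _; rewrite size_roots. Qed.

Lemma pade_prime_dvd p : prime p -> (5 <= p)%N -> (n < 2 * p)%N -> (p < n)%N ->
  (p %| #|G|)%N.
Proof.
move=> p_pr p5 np pn; rewrite (card_galois_perm hf gen).
have [k [phi [sur pk]]] := residue_exists L p_pr.
have [rsO rsOE] := roots_algint mf hf.
have le j : (j <= p)%N -> (j <= n)%N by move/leq_trans; apply; apply: ltnW.
case: (pade_newton p_pr p5 np pn nr) => [[e eE [h1 h2 h3]]|[k1 k1p [h1 h2 [h3 h4 h5 kn]]]].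
  rewrite -eE; rewrite eE in h1 h2; apply: (newton_single hf rsOE sur pk); rewrite ?eE ?fE ?prime_gt0 ?le //.
  by move=> j jp; rewrite fE ?le ?(ltnW jp) //; apply: h1.
have k1n : (k1 <= n)%N by apply: leq_trans (leq_addr _ _) kn.
apply: (newton_double mf hf rsOE sur pk k1p); rewrite ?fE //.
  by move=> j jp; rewrite fE ?h1 // (leq_trans (ltnW jp)).
by move=> j jp; rewrite fE ?h2 // (leq_trans (ltnW jp)).
Qed.

Lemma pade_Alt_large : (8 <= n)%N -> ('Alt_T \subset G)%g.
Proof.
move=> n8; have h4 : (4 <= n./2)%N by clear -n8; lia.
have [p p_pr /andP[hp ph]] := bertrand h4.
have p5 : (5 <= p)%N by clear -h4 hp; lia.
have np : (n < 2 * p)%N by clear -hp; lia.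
have pn : (p + 3 <= n)%N by clear -ph; lia.
apply: (jordan_prime_cycle galois_perm_trans p_pr); rewrite ?card_roots //.
  by clear -p5; lia.
by apply: pade_prime_dvd => //; clear -pn; lia.
Qed.

Lemma pade_Alt_small : (n <= 2)%N -> ('Alt_T \subset G)%g.
Proof. by move=> n2; rewrite trivial_Alt_2 ?sub1G // card_roots. Qed.

(** Up to degree 5, three points are more than half of the roots. In degrees 6 and 7 the Newton
    polygon at 5 provides a 5-cycle, which makes the group 2-transitive, and this lets the 3-cycle
    spread. *)
Lemma pade_Alt_of_3cycle (s : {perm T}) : s \in galois_perm rs -> #[s]%g = 3%N ->
  #|support_perm s| = 3%N -> (n <= 7)%N -> ('Alt_T \subset G)%g.
Proof.
move=> sG os ss n7.
have [n5|n6] := leqP n 5.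
  apply: (Alt_sub_of_3cycle sG os ss) => E sE EnT.
  apply: move_of_card => //; first exact: galois_perm_trans.
  have : (3 <= #|E|)%N by rewrite -ss subset_leq_card.
  by rewrite card_roots; clear -n5; lia.
have p5 : (5 %| #|G|)%N by apply: pade_prime_dvd => //; clear -n7 n6; lia.
have [c cG oc] := Cauchy (isT : prime 5) p5.
have n10 : (#|{: T}| < 2 * 5)%N by rewrite card_roots; clear -n7; lia.
have sc := card_support_of_prime_order (isT : prime 5) oc n10.
have tr2 : [transitive^2 G, on setT | 'P].
  apply: (@ntransitive_weak _ _ _ _ _ _ (1 + (#|{: T}| - 5))%N).
    by rewrite card_roots; clear -n6; lia.
  apply: (@prime_cycle_ntransitive _ c 5 isT oc sc G cG) => E sE EnT.
  apply: move_of_card => //; first exact: galois_perm_trans.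
  have : (5 <= #|E|)%N by rewrite -[X in (X <= _)%N]sc subset_leq_card.
  by rewrite card_roots; clear -n7; lia.
apply: (Alt_sub_of_3cycle sG os ss) => E sE EnT; apply: move_of_2transitive => //.
by apply: leq_trans (subset_leq_card sE); rewrite ss.
Qed.

Lemma pade_Alt_3 : n = 3%N -> ('Alt_T \subset G)%g.
Proof.
move=> n3; have p3 : (3 %| #|G|)%N.
  by have := atrans_dvd galois_perm_trans; rewrite cardsT card_roots n3.
have [c cG oc] := Cauchy (isT : prime 3) p3.
have n6 : (#|{: T}| < 2 * 3)%N by rewrite card_roots n3.
have sc := card_support_of_prime_order (isT : prime 3) oc n6.
by apply: (pade_Alt_of_3cycle cG oc sc); rewrite n3.
Qed.

End PadeGalois.

(* Polynomials modulo [q] as lists of natural numbers, lowest degree first. *)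
Section ListPolynomials.
Local Open Scope nat_scope.

Fixpoint ladd (s t : seq nat) : seq nat :=
  match s, t with
  | a :: s', b :: t' => (a + b) :: ladd s' t'
  | [::], _ => t
  | _, [::] => s
  end.
Definition lmul (s t : seq nat) : seq nat :=
  foldr (fun a acc => ladd (map (muln a) t) (0 :: acc)) [::] s.
Definition lprod (ss : seq (seq nat)) : seq nat := foldr lmul [:: 1] ss.
Definition lhorner_mod q (s : seq nat) j : nat := foldr (fun a acc => (a + j * acc) %% q) 0 s.
Definition lprod_mod q (s : seq nat) : nat := foldr (fun t acc => (t * acc) %% q) 1 s.

Definition pade_residue q (e : bool) n r j : nat :=
  let c := ('C(n, j) * lprod_mod q (index_iota r.+1 (n + r - j).+1)) %% q in
  if e && odd (n + j) then q - c else c.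

(* [c] and [ds] list the non-leading coefficients of the monic factors modulo
   [q]: a cubic without roots and factors of degree at most 2. The square of a
   Frobenius element is then a 3-cycle on the roots. *)
Definition frobenius_certificate q e n r (c : seq nat) (ds : seq (seq nat)) : bool :=
  [&& prime q, n + r < q, size c == 3, all (fun d => size d <= 2) ds,
      n == 3 + sumn (map size ds),
      map (modn^~ q) (lprod (rcons c 1 :: [seq rcons d 1 | d <- ds])) ==
        map (modn^~ q) [seq pade_residue q e n r j | j <- iota 0 n.+1]
    & all (fun j => lhorner_mod q (rcons c 1) j != 0) (iota 0 q)].

Lemma lprod_modE q s : lprod_mod q s = \prod_(t <- s) t %[mod q].
Proof.
elim: s => [|t s IH]; first by rewrite big_nil.
by rewrite big_cons /= modn_mod -modnMmr IH modnMmr.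
Qed.

Lemma lhorner_modE q (s : seq nat) j :
  (lhorner_mod q s j == 0) = (q %| `|(Poly (map Posz s)).[j%:Z]%R|).
Proof.
suff [h hq] : exists2 h : nat, (Poly (map Posz s)).[j%:Z]%R = h & lhorner_mod q s j = h %% q.
  by move=> ->; rewrite hq.
elim: s => [|a s [h IH IHq]] /=; first by exists 0; rewrite ?horner0 ?mod0n.
exists (a + j * h); last by rewrite IHq -modnDmr modnMmr modnDmr.
by rewrite cons_poly_def hornerD hornerM hornerX hornerC IH; lia.
Qed.

End ListPolynomials.

Section ListPolynomialsField.
Variables (k : fieldType) (q : nat).
Hypothesis qk : q \in [pchar k].
Definition lpoly (s : seq nat) : {poly k} := Poly [seq a%:R | a <- s].

Lemma natr_mod (a : nat) : (a %% q)%:R = a%:R :> k.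
Proof. by rewrite [in RHS](divn_eq a q) natrD natrM (pcharf0 qk) mulr0 add0r. Qed.

Lemma lpoly_mod s : lpoly (map (modn^~ q) s) = lpoly s.
Proof. by congr Poly; rewrite -map_comp; apply: eq_map => a /=; rewrite natr_mod. Qed.

Lemma lpoly_add s t : lpoly (ladd s t) = lpoly s + lpoly t.
Proof.
elim: s t => [|a s IH] [|b t]; rewrite /lpoly /= ?add0r ?addr0 //.
by rewrite !cons_poly_def -/(lpoly _) IH /lpoly natrD polyCD mulrDl addrACA.
Qed.

Lemma lpoly_mul s t : lpoly (lmul s t) = lpoly s * lpoly t.
Proof.
elim: s => [|a s IH]; first by rewrite /lpoly /= mul0r.
rewrite /= lpoly_add {2}/lpoly /= cons_poly_def -/(lpoly _) IH /= polyC0 addr0.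
rewrite {4}/lpoly /= cons_poly_def -/(lpoly s) mulrDl addrC; congr (_ + _); first by ring.
rewrite /lpoly -map_comp; apply/polyP => i; rewrite coefCM !coef_Poly.
have [it|ti] := ltnP i (size t); last by rewrite !nth_default ?size_map // mulr0.
by rewrite !(nth_map 0%N) //= natrM.
Qed.

Lemma lpoly_prod ss : lpoly (lprod ss) = \prod_(s <- ss) lpoly s.
Proof.
elim: ss => [|s ss IH]; first by rewrite big_nil /lpoly /= cons_poly_def mul0r add0r.
by rewrite big_cons -IH -lpoly_mul.
Qed.

Lemma lpoly_int s : lpoly s = map_poly (intmul 1) (Poly (map Posz s)).
Proof.
apply/polyP => i; rewrite coef_map_id0 // !coef_Poly.
have [it|ti] := ltnP i (size s); last by rewrite !nth_default ?size_map.
by rewrite !(nth_map 0%N).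
Qed.

End ListPolynomialsField.

Lemma Poly_rcons1 s : (Poly (map Posz (rcons s 1%N)) \is monic) *
  (size (Poly (map Posz (rcons s 1%N))) = (size s).+1).
Proof.
have E : Poly (map Posz (rcons s 1%N)) = map Posz (rcons s 1%N) :> seq int.
  by apply: (PolyK (c := 0)); rewrite map_rcons last_rcons.
split; last by rewrite E size_map size_rcons.
by rewrite monicE lead_coefE E size_map size_rcons /= map_rcons nth_rcons size_map ltnn eqxx.
Qed.

Section SmallDegrees.
Variables (n r : nat) (e : bool) (f : {poly int}) (L : splittingFieldType rat) (rs : seq L).
Hypotheses (n0 : (0 < n)%N) (nr : (r = n.+1 \/ n = r.+1)%N).
Hypotheses (mf : f \is monic) (sf : size f = n.+1)
  (fS : forall j, (j <= n)%N -> f`_j = (-1) ^+ (e && odd (n + j)) * (pade_coef n r j)%:Z).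
Hypothesis irr : irreducible_poly (map_poly (intmul 1 : int -> rat) f).
Hypothesis hf : map_poly (intmul 1 : int -> L) f = \prod_(z <- rs) ('X - z%:P).
Hypothesis gen : <<1 & rs>>%VS = fullv.
Local Notation T := (seq_sub rs).
Local Notation G := (galois_perm_group rs).
Local Notation S := (n + r).+1.
Hypothesis hdel : (\prod_(1 <= i < n.+1) (S%:Z - i%:Z))%:~R * delta (@root_enum L rs) ^+ 2 =
  (-1) ^+ 'C(n, 2) * (\prod_(1 <= j < n.+1) (j%:Z * (S%:Z - j%:Z)) ^+ j)%:~R.

Let fE j : (j <= n)%N -> absz f`_j = pade_coef n r j.
Proof. by move=> /fS ->; rewrite abszM absz_sign mul1n. Qed.

Let rs_uniq : uniq rs := roots_uniq n0 mf sf irr hf.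

(** A prime dividing Schur's product divides some [j] or [S - j], and these are positive and at most
    n + r < q. So the product of root differences survives under [phi], and so does each
    difference. *)
Lemma residue_distinct q (k : fieldType) (phi : {rmorphism algint L -> k}) (rsO : seq (algint L)) :
  q \in [pchar k] -> (n + r < q)%N -> map val rsO = rs -> {in rsO &, injective phi}.
Proof.
move=> qk rq rsOE; have q_pr := pcharf_prime qk.
have ex (i : 'I_#|{: T}|) : exists a : algint L, a \in rsO /\ val a = root_enum i.
  have /mapP[a ar aE] : root_enum i \in map val rsO by rewrite rsOE; apply: ssvalP.
  by exists a; rewrite aE.
have [b bP] := boolp.choice ex.
have valb i : val (b i) = root_enum i by case: (bP i).
have dval : val (delta b) = delta (@root_enum L rs).
  rewrite /delta rmorph_prod; apply: eq_bigr => i _; rewrite rmorph_prod.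
  by apply: eq_bigr => j _; rewrite rmorphB -!valb.
have db : (\prod_(1 <= i < n.+1) (S%:Z - i%:Z))%:~R * delta b ^+ 2 =
  (-1) ^+ 'C(n, 2) * (\prod_(1 <= j < n.+1) (j%:Z * (S%:Z - j%:Z)) ^+ j)%:~R.
  apply: val_inj; rewrite rmorphM [RHS]rmorphM rmorphXn rmorph_sign.
  move: hdel; rewrite -dval -!algint_val_intr; exact.
have d0 : phi (delta b) != 0.
  have : phi ((-1) ^+ 'C(n, 2) * (\prod_(1 <= j < n.+1) (j%:Z * (S%:Z - j%:Z)) ^+ j)%:~R) != 0.
    rewrite rmorphM rmorph_sign mulf_neq0 ?signr_eq0 //.
    have a1 : absz 1 = 1%N by [].
    rewrite (residue_int phi qk) (big_morph absz abszM a1) Euclid_dvd_prod //.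
    rewrite big_has; apply/hasPn => j; rewrite mem_index_iota => /andP[j1 jn].
    rewrite abszX abszM Euclid_dvdX // Euclid_dvdM // negb_and; apply/orP; left.
    rewrite negb_or; apply/andP; split; apply/negP => /dvdn_leq; first by clear -j1 jn rq; lia.
    by clear -j1 jn rq; lia.
  by rewrite -db; apply: contraNneq => d0; rewrite rmorphM rmorphXn d0 expr0n mulr0.
have binj i j : phi (b i) = phi (b j) -> i = j.
  move=> bij; apply/eqP; apply: contraNT d0; rewrite rmorph_prod => ij.
  have [i' [j' [lt b0]]] : exists i' j' : 'I_#|{: T}|, (i' < j')%N /\ phi (b j') - phi (b i') = 0.
    by case: (ltngtP i j) => [lt|lt|/val_inj e']; [exists i, j | exists j, i |]; rewrite ?bij ?subrr //;
      rewrite e' eqxx in ij.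
  by rewrite (bigD1 i') //= rmorph_prod (bigD1 j') //= rmorphB b0 !mul0r.
have bsurj a : a \in rsO -> exists i, a = b i.
  move=> ar; have ar' : val a \in rs by rewrite -rsOE map_f.
  exists (enum_rank (SeqSub ar' : T)); apply: val_inj.
  by rewrite valb /root_enum enum_rankK.
by move=> x y /bsurj[i ->] /bsurj[j ->] /binj ->.
Qed.

Lemma pade_Alt_certificate q c ds : (n <= 7)%N -> frobenius_certificate q e n r c ds ->
  ('Alt_T \subset G)%g.
Proof.
move=> n7 /and5P[q_pr nrq /eqP c3 dsz /and3P[/eqP nds /eqP prodE noroot]].
have [k [phi [sur pk]]] := residue_exists L q_pr.
have [rsO rsOE] := roots_algint mf hf.
have inj : {in rsO &, injective phi} := residue_distinct pk nrq rsOE.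
pose P s : {poly int} := Poly (map Posz (rcons s 1%N)).
have fk : map_poly (intmul 1 : int -> k) f = lpoly k (lprod (rcons c 1%N :: [seq rcons d 1%N | d <- ds])).
  rewrite -(lpoly_mod pk) prodE (lpoly_mod pk); apply/polyP => j.
  rewrite coef_map_id0 // coef_Poly.
  have [jn|nj] := ltnP j n.+1; last first.
    by rewrite !nth_default ?sf // !size_map size_iota.
  rewrite (nth_map 0%N) ?size_map ?size_iota // (nth_map 0%N) ?size_iota // nth_iota // add0n.
  rewrite fS // /pade_residue.
  have cE : (('C(n, j) * lprod_mod q (index_iota r.+1 (n + r - j).+1)) %% q)%N%:R = (pade_coef n r j)%:R :> k.
    by rewrite -(natr_mod pk (pade_coef n r j)) -modnMmr lprod_modE modnMmr.
  case: ifP => _; last by rewrite expr0 mul1r -pmulrn -cE.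
  rewrite expr1 mulN1r rmorphN /= -pmulrn natrB ?(pcharf0 pk) ?cE ?sub0r //.
  by apply: ltnW; rewrite ltn_mod prime_gt0.
have [s [sG os ss]] : exists s, [/\ s \in galois_perm rs, #[s]%g = 3%N & #|support_perm s| = 3%N].
  refine (galois_3cycle (c := P c) (ds := map P ds) hf pk rs_uniq rsOE inj _ _ _ _ _ _).
  - move=> y; rewrite fk lpoly_prod big_cons big_map hornerM => /eqP.
    rewrite mulf_eq0 horner_prod prodf_seq_eq0 => /orP[/eqP y0|/hasP[d dd /= /eqP y0]].
      by left; rewrite -y0 lpoly_int.
    by right; exists (P d); rewrite ?map_f // -y0 lpoly_int.
  - by rewrite Poly_rcons1.
  - by rewrite Poly_rcons1 c3.
  - move=> j jq; rewrite -lhorner_modE; apply: (allP noroot); rewrite mem_iota //.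
  - by apply/allP => _ /mapP[d dd ->]; rewrite !Poly_rcons1 ltnS (allP dsz).
  rewrite (size_roots mf sf hf) nds sumnE !big_map; congr (_ + _)%N.
  by apply: eq_bigr => d _; rewrite Poly_rcons1.
exact: (pade_Alt_of_3cycle n0 nr mf sf fE irr hf gen sG os ss n7).
Qed.

End SmallDegrees.

(** * The square class of the discriminant *)

Section SquareClasses.
Local Open Scope nat_scope.

(** The absolute value of the discriminant: Schur's product divided by the constant coefficient,
    which lowers the exponent of each S - j by one. *)
Definition disc_nat S n := \prod_(1 <= j < n.+1) (j ^ j * (S - j) ^ j.-1).
Definition odd_prod h := \prod_(0 <= i < h) i.*2.+1.

Lemma odd_prod_gt0 h : 0 < odd_prod h.
Proof. by rewrite /odd_prod; apply: prodn_gt0. Qed.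

(** Up to squares only odd exponents count: j^j leaves the odd [j], and (S - j)^(j-1) leaves S - j
    for even [j]. *)
Lemma disc_nat_class S n : n < S -> exists2 c, 0 < c &
  disc_nat S n = odd_prod (uphalf n) * \prod_(1 <= i < n./2.+1) (S - i.*2) * c ^ 2.
Proof.
elim: n => [|n IH] nS; first by exists 1; rewrite // /disc_nat /odd_prod !big_geq.
have [c c0 cE] := IH (ltnW nS); have S0 : 0 < S - n.+1 by rewrite subn_gt0.
rewrite /disc_nat big_nat_recr // -/(disc_nat S n) cE.
have [h [nh|nh]] : exists h, n = h.*2 \/ n = h.*2.+1.
  by exists n./2; case: (boolP (odd n)) => on; [right|left]; lia.
  exists (c * (n.+1 ^ h * (S - n.+1) ^ h)).
    by rewrite !muln_gt0 c0 !expn_gt0 S0.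
  have -> : uphalf n.+1 = h.+1 by lia.
  have -> : uphalf n = h by lia.
  have -> : n.+1./2 = h by lia.
  have -> : n./2 = h by lia.
  rewrite /odd_prod [in RHS]big_nat_recr //= -/(odd_prod h) !expnMn -!expnM.
  rewrite !muln2 -nh [n.+1 ^ n.+1]expnS.
  ring.
exists (c * (n.+1 ^ h.+1 * (S - n.+1) ^ h)).
  by rewrite !muln_gt0 c0 !expn_gt0 S0.
have -> : uphalf n.+1 = h.+1 by lia.
have -> : uphalf n = h.+1 by lia.
have -> : n.+1./2 = h.+1 by lia.
have -> : n./2 = h by lia.
rewrite [LHS]/= [in RHS]big_nat_recr //= !expnMn -!expnM !muln2.
have -> : h.+1.*2 = n.+1 by lia.
have -> : (S - n.+1) ^ n = (S - n.+1) * (S - n.+1) ^ h.*2 by rewrite nh expnS.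
ring.
Qed.

Lemma prod_ffact a h : \prod_(1 <= i < h.+1) (a.+1 - i) = a ^_ h.
Proof. by rewrite ffact_prod big_add1 /= big_mkord; apply: eq_bigr => i _; rewrite subSS. Qed.

Lemma fact_double h : (h.*2)`! = 2 ^ h * odd_prod h * h`!.
Proof.
elim: h => [|h IH]; first by rewrite /odd_prod big_geq.
rewrite doubleS !factS IH /odd_prod big_nat_recr //= -/(odd_prod h) expnS.
have -> : h.*2.+2 = 2 * h.+1 by lia.
ring.
Qed.

Lemma prod_upper_half h : \prod_(1 <= i < h.+1) (h.*2.+1 - i) = 2 ^ h * odd_prod h.
Proof.
rewrite prod_ffact; apply/eqP; rewrite -(eqn_pmul2r (fact_gt0 h)) -fact_double.
by rewrite -(@ffact_fact h.*2 h) -?addnn ?leq_addr // addnK.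
Qed.

Lemma prod_upper_half_pred k :
  2 * \prod_(1 <= i < k.+2) (k.+1.*2 - i) = 2 ^ k.+1 * odd_prod k.+1.
Proof.
rewrite doubleS prod_ffact; apply/eqP; rewrite -(eqn_pmul2r (fact_gt0 k.+1)) -fact_double.
rewrite doubleS [in X in _ == X]factS -(@ffact_fact k.*2.+1 k.+1); last by lia.
have -> : k.*2.+1 - k.+1 = k by lia.
have -> : k.*2.+2 = 2 * k.+1 by lia.
by apply/eqP; rewrite factS; ring.
Qed.

Lemma prod_upper_half_succ h :
  h.+1 * \prod_(1 <= i < h.+1) (h.*2.+2 - i) = 2 ^ h * odd_prod h.+1.
Proof.
rewrite prod_ffact; apply/eqP.
rewrite -(eqn_pmul2r (fact_gt0 h.+1)) -(@eqn_pmul2l 2) // [in X in _ == X]mulnA [in X in _ == X]mulnA -expnS.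
rewrite -fact_double doubleS [in X in _ == X]factS -(@ffact_fact h.*2.+1 h); last by lia.
have -> : h.*2.+1 - h = h.+1 by lia.
have -> : h.*2.+2 = 2 * h.+1 by lia.
by apply/eqP; ring.
Qed.

Lemma prod_double (a h : nat) : h < a ->
  \prod_(1 <= i < h.+1) (a.*2 - i.*2) = 2 ^ h * \prod_(1 <= i < h.+1) (a - i).
Proof.
move=> ha; transitivity (\prod_(1 <= i < h.+1) (2 * (a - i))).
  by apply: eq_bigr => i _; rewrite -doubleB mul2n.
rewrite big_split /=; congr (_ * _).
by rewrite prod_nat_const_nat subn1.
Qed.

(** A representative of the square class of the discriminant up to sign. Here S is 2n + 2 or 2n;
    halving the even numbers S - 2i leaves the upper part of a factorial, which again is a power of
    2 times a product of odd numbers. The odd numbers pair up into squares except for the boundary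
    factor given here. *)
Definition disc_weight n r :=
  if r == n.+1 then (if odd n then n.+1./2 else 1) else (if odd n then n else 2).

Lemma disc_weight_square n r : 0 < n -> (r = n.+1 \/ n = r.+1) ->
  exists2 c, 0 < c & disc_weight n r * disc_nat (n + r).+1 n = c ^ 2.
Proof.
move=> n0 nr; have nS : n < (n + r).+1 by rewrite ltnS leq_addr.
have [c c0 ->] := disc_nat_class nS; rewrite /disc_weight.
have [h [nh|nh]] : exists h, n = h.*2 \/ n = h.*2.+1.
  by exists n./2; case: (boolP (odd n)) => on; [right|left]; lia.
  have on : odd n = false by rewrite nh odd_double.
  have -> : uphalf n = h by lia.
  have -> : n./2 = h by lia.
  rewrite on; case: nr => [->|nr].
    have -> : (n + n.+1).+1 = (h.*2.+1).*2 by lia.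
    rewrite eqxx mul1n prod_double ?ltnS -?addnn ?leq_addr // addnn prod_upper_half.
    exists (odd_prod h * 2 ^ h * c); first by rewrite !muln_gt0 odd_prod_gt0 expn_gt0 c0.
    by rewrite !expnMn; ring.
  have -> : (r == n.+1) = false by apply/eqP; lia.
  have -> : (n + r).+1 = (h.*2).*2 by lia.
  rewrite prod_double; last by lia.
  have X : 2 * \prod_(1 <= i < h.+1) (h.*2 - i) = 2 ^ h * odd_prod h.
    by case: h nh => [nh|k _]; [rewrite nh in n0 | apply: prod_upper_half_pred].
  exists (odd_prod h * 2 ^ h * c); first by rewrite !muln_gt0 odd_prod_gt0 expn_gt0 c0.
  transitivity (odd_prod h * (2 ^ h * (2 * \prod_(1 <= i < h.+1) (h.*2 - i))) * c ^ 2); first by ring.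
  by rewrite X !expnMn; ring.
have on : odd n by rewrite nh /= odd_double.
have -> : uphalf n = h.+1 by lia.
have -> : n./2 = h by lia.
rewrite on; case: nr => [->|nr].
  have -> : (n + n.+1).+1 = (h.*2.+2).*2 by lia.
  have -> : n.+1./2 = h.+1 by lia.
  rewrite eqxx prod_double; last by lia.
  have X := prod_upper_half_succ h.
  exists (odd_prod h.+1 * 2 ^ h * c); first by rewrite !muln_gt0 odd_prod_gt0 expn_gt0 c0.
  transitivity (odd_prod h.+1 * (2 ^ h * (h.+1 * \prod_(1 <= i < h.+1) (h.*2.+2 - i))) * c ^ 2); first by ring.
  by rewrite X !expnMn; ring.
have -> : (r == n.+1) = false by apply/eqP; lia.
have -> : (n + r).+1 = (h.*2.+1).*2 by lia.
rewrite prod_double; last by lia.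
rewrite prod_upper_half; exists (odd_prod h.+1 * 2 ^ h * c).
  by rewrite !muln_gt0 odd_prod_gt0 expn_gt0 c0.
have E : odd_prod h.+1 = odd_prod h * n by rewrite /odd_prod big_nat_recr //= nh.
by rewrite E; ring.
Qed.

Lemma square_cofactor w E c : 0 < c -> w * E = c ^ 2 -> (exists t, E = t ^ 2) -> exists t, w = t ^ 2.
Proof.
move=> c0 wE [t Et]; have t0 : 0 < t.
  by rewrite lt0n; apply/eqP => t0; move: wE; rewrite Et t0 muln0 => /esym/eqP; rewrite expn_eq0 eqn0Ngt c0.
have /dvdnP[u cu] : t %| c by rewrite -(@dvdn_pexp2r t c 2) // -wE Et dvdn_mull.
exists u; apply/eqP; rewrite -(@eqn_pmul2r (t ^ 2)) ?expn_gt0 ?t0 //.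
by rewrite -{1}Et wE cu expnMn.
Qed.

Lemma rat_square_nat (E : nat) : (exists r : rat, E%:R = r ^+ 2)%R -> exists t, E = t ^ 2.
Proof.
move=> [r rE]; exists `|numq r|.
have : (E%:Z * denq r ^+ 2 = numq r ^+ 2)%R.
  have rd : (r * (denq r)%:~R = (numq r)%:~R)%R.
    by rewrite -{1}[r]divq_num_den divfK // intr_eq0 denq_neq0.
  by apply: (@intr_inj rat); rewrite rmorphM !rmorphXn /= -rd exprMn -rE.
move/(congr1 absz); rewrite abszM !abszX /= => NE.
have : `|denq r| %| `|numq r| by rewrite -(@dvdn_pexp2r _ _ 2) // -NE dvdn_mull.
have := coprime_num_den r; rewrite coprime_sym /coprime => /eqP cp /gcdn_idPl.
by rewrite cp => d1; rewrite -NE -d1 exp1n muln1.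
Qed.

Lemma signed_square (w E c : nat) (b : bool) : 0 < c -> w * E = c ^ 2 ->
  (exists r : rat, ((-1) ^+ b * E%:R = r ^+ 2)%R) <-> ~~ b /\ exists t, w = t ^ 2.
Proof.
move=> c0 wE; have E0 : 0 < E by case: E wE => // /esym/eqP; rewrite muln0 expn_eq0 eqn0Ngt c0.
split=> [[r rE]|[/negbTE-> sq]].
  case: b rE => rE; last by split=> //; apply: (square_cofactor c0 wE); apply: rat_square_nat; exists r; rewrite -rE mul1r.
  have := sqr_ge0 r; rewrite -rE expr1 mulN1r oppr_ge0 => /(lt_le_trans _).
  by move=> /(_ 0%R); rewrite ltr0n ltxx E0 => /(_ isT).
have [t ->] := square_cofactor c0 (etrans (mulnC _ _) wE) sq.
by exists (t%:R)%R; rewrite mul1r natrX.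
Qed.

Lemma odd_bin2 n : odd 'C(n, 2) = odd n./2.
Proof.
suff [] : odd 'C(n, 2) = odd n./2 /\ odd 'C(n.+1, 2) = odd n.+1./2 by [].
elim: n => [|n [IH1 IH2]]; first by [].
by split=> //; rewrite binS bin1 binS bin1 !oddD IH1 /=; case: (odd n); case: (odd _).
Qed.

End SquareClasses.

(** * The two families *)

Lemma irreducible_poly_eqp (F : fieldType) (p q : {poly F}) :
  p %= q -> irreducible_poly p -> irreducible_poly q.
Proof.
move=> pq [sp irr]; split=> [|d sd dq]; first by rewrite -(eqp_size pq).
by apply: eqp_trans (pq); apply: irr; rewrite // (eqp_dvdr _ pq).
Qed.

Lemma coef_comp_scaleX (R : comNzRingType) (p : {poly R}) (c : R) j :
  (p \Po (c *: 'X))`_j = c ^+ j * p`_j.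
Proof.
have -> : p \Po (c *: 'X) = \poly_(i < size p) (c ^+ i * p`_i).
  by rewrite comp_polyE poly_def; apply: eq_bigr => i _; rewrite exprZn scalerA mulrC.
by rewrite coef_poly; case: ltnP => // jp; rewrite nth_default // mulr0.
Qed.

Section PadePoly.
Variables (e : bool) (n r : nat).

Definition pade_poly : {poly int} :=
  \poly_(j < n.+1) ((-1) ^+ (e && odd (n + j)) * (pade_coef n r j)%:Z).

Lemma coef_pade_poly j : (j <= n)%N ->
  pade_poly`_j = (-1) ^+ (e && odd (n + j)) * (pade_coef n r j)%:Z.
Proof. by move=> jn; rewrite coef_poly ltnS jn. Qed.

Lemma pade_coef_lead : pade_coef n r n = 1%N.
Proof. by rewrite /pade_coef binn addKn big_geq. Qed.

Lemma size_pade_poly : size pade_poly = n.+1.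
Proof. by rewrite size_poly_eq // pade_coef_lead mulr1 signr_eq0. Qed.

Lemma pade_poly_monic : pade_poly \is monic.
Proof.
rewrite monicE lead_coefE size_pade_poly coef_pade_poly // pade_coef_lead.
by rewrite addnn odd_double andbF.
Qed.

Lemma laguerre_coef_pade j : (j <= n)%N ->
  laguerre_coef (n + r).+1%:Z n j = (pade_coef n r j)%:Z.
Proof.
move=> jn; rewrite /laguerre_coef /pade_coef PoszM; congr (_ * _).
have [d nd] : exists d, n = (d + j)%N by exists (n - j)%N; rewrite subnK.
have -> : (\prod_(j.+1 <= i < n.+1) ((n + r).+1%:Z - i%:Z)) =
    (\prod_(j.+1 <= i < n.+1) ((n + r).+1 - i))%N%:Z.
  rewrite (big_morph _ PoszM (erefl (Posz 1))) !big_nat; apply: eq_bigr => i /andP[_ hi].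
  by rewrite subzn // ltnW // ltnS (leq_trans _ (leq_addr _ _)).
congr Posz; clear -nd; move: j nd; elim: d => [|d IH] j nd.
  by rewrite nd add0n addKn !big_geq.
rewrite big_ltn; last by rewrite nd; lia.
rewrite (IH j.+1) ?nd; last by lia.
have -> : ((d.+1 + j + r - j).+1 = (d.+1 + j + r - j.+1).+2)%N by lia.
rewrite [RHS]big_nat_recr /=; last by lia.
by rewrite mulnC; congr (_ * _)%N; lia.
Qed.

(** The second family is a Laguerre polynomial only after x is replaced by -x, so its roots change
    sign; the squared product of their differences does not. *)
Lemma laguerre_pade_roots (L : splittingFieldType rat) (rs : seq L) :
  map_poly (intmul 1 : int -> L) pade_poly = \prod_(z <- rs) ('X - z%:P) ->
  map_poly (intmul 1 : int -> L) (laguerre (n + r).+1%:Z n) =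
    \prod_(z <- rs) ('X - ((-1) ^+ e * z)%:P).
Proof.
move=> hf; set s : L := (-1) ^+ e; have ss : s * s = 1 by rewrite -expr2 sqrr_sign.
have szr : size rs = n.
  have := size_map_poly_id0 (f := (intmul 1 : int -> L)) (p := pade_poly).
  by rewrite hf size_prod_XsubC size_pade_poly (monicP pade_poly_monic) oner_neq0 => /(_ isT) [].
have prodE : \prod_(z <- rs) ('X - (s * z)%:P) =
    s ^+ n *: (\prod_(z <- rs) ('X - z%:P) \Po (s *: 'X)).
  rewrite -szr; elim: (rs) => [|z l IH]; first by rewrite !big_nil comp_polyC scale1r.
  rewrite !big_cons IH comp_polyM comp_polyB comp_polyX comp_polyC [size (z :: l)]/=.
  rewrite exprSr -[RHS]scalerA -[LHS]scalerAr; congr (_ *: _).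
  by rewrite scalerAl scalerBr scalerA ss scale1r -!mul_polyC polyCM.
rewrite prodE -hf; apply/polyP => j; rewrite coefZ coef_comp_scaleX !coef_map coef_laguerre mulrA -exprD.
have [jn|nj] := leqP j n; last first.
  rewrite /laguerre_coef bin_small // mul0r [pade_poly`_j]nth_default ?size_pade_poly //=.
  by rewrite mulr0.
rewrite laguerre_coef_pade // coef_pade_poly //= intrM intr_sign mulrA /s.
case: e => /=; last by rewrite expr1n !mul1r.
by rewrite expr1 signr_odd -expr2 sqrr_sign mul1r.
Qed.
End PadePoly.

Lemma delta_sqr_sign (R : comNzRingType) (e : bool) n (a : 'I_n -> R) :
  delta (fun i => (-1) ^+ e * a i) ^+ 2 = delta a ^+ 2.
Proof.
rewrite /delta -!prodrXl; apply: eq_bigr => i _; rewrite -!prodrXl; apply: eq_bigr => j _.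
by rewrite -mulrBr exprMn sqrr_sign mul1r.
Qed.

Lemma laguerre_delta_sqr_gt0 (L : splittingFieldType rat) (S : int) n (a : 'I_n -> L) : (0 < n)%N ->
  map_poly (intmul 1 : int -> L) (laguerre S n) = \prod_i ('X - (a i)%:P) ->
  (\prod_(1 <= i < n.+1) (S - i%:Z))%:~R * delta a ^+ 2 =
    (-1) ^+ 'C(n, 2) * (\prod_(1 <= j < n.+1) (j%:Z * (S - j%:Z)) ^+ j)%:~R.
Proof. by case: n a => // n a _; apply: laguerre_delta_sqr. Qed.

Section PadeGroup.
Variables (e : bool) (n r : nat) (L : splittingFieldType rat) (rs : seq L).
Hypotheses (n0 : (0 < n)%N) (nr : (r = n.+1 \/ n = r.+1)%N) (er : e = (r < n)%N).
Local Notation f := (pade_poly e n r).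
Hypothesis irr : irreducible_poly (map_poly (intmul 1 : int -> rat) f).
Hypothesis hf : map_poly (intmul 1 : int -> L) f = \prod_(z <- rs) ('X - z%:P).
Hypothesis gen : <<1 & rs>>%VS = fullv.
Local Notation T := (seq_sub rs).
Let mf := pade_poly_monic e n r.
Let sf := size_pade_poly e n r.
Let fS := @coef_pade_poly e n r.
Let cardT : #|{: T}| = n := card_roots n0 mf sf irr hf.

Lemma pade_delta_sqr :
  (\prod_(1 <= i < n.+1) ((n + r).+1%:Z - i%:Z))%:~R * delta (@root_enum L rs) ^+ 2 =
    (-1) ^+ 'C(n, 2) * (\prod_(1 <= j < n.+1) (j%:Z * ((n + r).+1%:Z - j%:Z)) ^+ j)%:~R.
Proof.
have u : uniq rs := roots_uniq n0 mf sf irr hf.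
have := laguerre_pade_roots hf; rewrite (prod_root_enum (fun z => 'X - ((-1) ^+ e * z)%:P) u) => lE.
rewrite -(delta_sqr_sign e); move: (@root_enum L rs) lE; rewrite cardT => a lE.
exact: laguerre_delta_sqr_gt0.
Qed.

Lemma pade_Alt_sub : ('Alt_T \subset galois_perm_group rs)%g.
Proof.
have fE j : (j <= n)%N -> absz f`_j = pade_coef n r j.
  by move=> jn; rewrite fS // abszM abszX exp1n mul1n.
have cert := pade_Alt_certificate n0 nr mf sf fS irr hf gen pade_delta_sqr.
have [n8|n7] := leqP 8 n; first exact: pade_Alt_large n0 nr mf sf fE irr hf gen n8.
have [n2|n3] := leqP n 2; first exact: pade_Alt_small n0 mf sf irr hf n2.
have [n4|n4] := eqVneq n 3%N; first exact: pade_Alt_3 n0 nr mf sf fE irr hf gen n4.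
have : [|| n == 4, n == 5, n == 6 | n == 7]%N by clear -n7 n3 n4; lia.
have [nr'|nr'] := nr.
  have e0 : e = false by rewrite er nr'; clear; lia.
  (* Each certificate is a factorisation modulo a prime exceeding n + r: a cubic without zeros times
     factors of degree 1 and 2, in degrees 4 to 7. The Boolean check is done by computation. *)
  case/or4P=> /eqP nE;
    [ apply: (cert 11%N [:: 7; 2; 10]%N [:: [:: 3]]%N)
    | apply: (cert 29%N [:: 15; 3; 28]%N [:: [:: 13; 7]]%N)
    | apply: (cert 19%N [:: 18; 0; 9]%N [:: [:: 17]; [:: 13; 3]]%N)
    | apply: (cert 67%N [:: 21; 18; 31]%N [:: [:: 25]; [:: 3]; [:: 23; 4]]%N) ];
    rewrite // e0 nr' nE; vm_cast_no_check (erefl true).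
have e1 : e = true by rewrite er nr'; clear; lia.
have rE : r = n.-1 by rewrite nr'.
case/or4P=> /eqP nE;
  [ apply: (cert 17%N [:: 1; 9; 11]%N [:: [:: 7]]%N)
  | apply: (cert 13%N [:: 12; 12; 4]%N [:: [:: 1; 10]]%N)
  | apply: (cert 13%N [:: 8; 9; 1]%N [:: [:: 8]; [:: 4; 7]]%N)
  | apply: (cert 19%N [:: 8; 10; 11]%N [:: [:: 10]; [:: 4]; [:: 10; 2]]%N) ];
  rewrite // e1 rE nE; vm_cast_no_check (erefl true).
Qed.

Lemma prod_disc_nat S : (n < S)%N ->
  (\prod_(1 <= j < n.+1) (j%:Z * (S%:Z - j%:Z)) ^+ j) =
    (\prod_(1 <= j < n.+1) (S%:Z - j%:Z)) * (disc_nat S n)%:Z.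
Proof.
move=> nS; rewrite /disc_nat (big_morph _ PoszM (erefl (Posz 1))) -big_split /= !big_nat.
apply: eq_bigr => -[//|j] /andP[_ jn].
have jS : (j.+1 <= S)%N by rewrite (leq_trans _ (ltnW nS)).
by rewrite PoszM -!natz !natrX !natz -subzn // exprMn [X in _ * X = _]exprS; ring.
Qed.

Lemma pade_delta_sqr_rat : delta (@root_enum L rs) ^+ 2 =
  ((-1) ^+ odd n./2 * (disc_nat (n + r).+1 n)%:R : rat)%:A.
Proof.
have := pade_delta_sqr; rewrite prod_disc_nat ?ltnS ?leq_addr // intrM [X in _ = X -> _]mulrCA.
set P := (X in X%:~R) => E; have P0 : P%:~R != 0 :> L.
  rewrite -(rmorph_int (in_alg L)) fmorph_eq0 intr_eq0 /P prodf_seq_neq0; apply/allP => j.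
  by rewrite mem_index_iota => /andP[j1 jn]; rewrite subr_eq0; apply/eqP => -[]; clear -jn; lia.
apply: (mulfI P0); rewrite E -signr_odd odd_bin2; congr (_ * _).
by rewrite -[RHS]/(in_alg L _) rmorphM rmorph_sign rmorph_nat.
Qed.

Lemma pade_Alt_iff : (galois_perm rs \subset 'Alt_T)%g <->
  ~~ odd n./2 /\ exists t, disc_weight n r = (t ^ 2)%N.
Proof.
have [c c0 wE] := disc_weight_square n0 nr.
rewrite -(signed_square _ c0 wE); apply: (galois_perm_Alt_sqr hf pade_delta_sqr_rat).
rewrite mulf_neq0 ?signr_eq0 // pnatr_eq0.
apply: contraTneq c0 => E0; move: wE.
by rewrite E0 muln0 => /esym/eqP; rewrite expn_eq0 andbT => /eqP ->.
Qed.

(** Since the group contains the alternating group, an abstract isomorphism forces equality by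
    counting, so it can be tested by the inclusion. *)
Lemma pade_isog_Alt : (galois_perm rs \isog 'Alt_('I_n))%g <->
  ~~ odd n./2 /\ exists t, disc_weight n r = (t ^ 2)%N.
Proof.
have iso : ('Alt_T \isog 'Alt_('I_n))%g by have := Alt_isog_ord T; rewrite cardT.
rewrite -pade_Alt_iff; split=> [/card_isog cG|sub].
  have /eqP -> // : (galois_perm rs == 'Alt_T)%g.
  by rewrite eq_sym eqEcard pade_Alt_sub cG -(card_isog iso) leqnn.
by have -> // : galois_perm rs = ('Alt_T)%g; apply/eqP; rewrite eqEsubset sub pade_Alt_sub.
Qed.

End PadeGroup.

Lemma fact_div_prod u v j : (v <= u + v - j)%N ->
  (u + v - j)`!%:R / v`!%:R = (\prod_(v.+1 <= t < (u + v - j).+1) t)%N%:R :> rat.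
Proof. by move=> h; rewrite (fact_split h) natrM mulrAC divff ?mul1r // pnatr_eq0 -lt0n fact_gt0. Qed.

Lemma padeP_pade_poly u v : padeP u v = map_poly (intmul 1 : int -> rat) (pade_poly false u v).
Proof.
apply/polyP => j; rewrite coef_map /= /padeP -(poly_def u.+1 (fun j => (u + v - j)`!%:R / v`!%:R * 'C(u, j)%:R)).
rewrite !coef_poly ltnS; case: ifP => // ju.
by rewrite fact_div_prod ?mul1r; [rewrite /pade_coef PoszM intrM mulrC | lia].
Qed.

Lemma padeQ_pade_poly u v :
  padeQ u v = (-1) ^+ v *: map_poly (intmul 1 : int -> rat) (pade_poly true v u).
Proof.
apply/polyP => j; rewrite coefZ coef_map /= /padeQ.
rewrite (eq_bigr (fun j : 'I_v.+1 => ((-1) ^+ j * ((u + v - j)`!%:R / u`!%:R * 'C(v, j)%:R)) *: 'X^j)).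
  rewrite -(poly_def v.+1 (fun j => (-1) ^+ j * ((u + v - j)`!%:R / u`!%:R * 'C(v, j)%:R))).
  rewrite !coef_poly ltnS; case: ifP => [jv|_]; last by rewrite mulr0.
  rewrite addnC fact_div_prod; last by lia.
  rewrite [in RHS]intrM /= intr_sign signr_odd [RHS]mulrA -exprD addnA addnn exprD.
  by rewrite -[(-1) ^+ v.*2]signr_odd odd_double mul1r -natrM mulnC.
by move=> i _; rewrite -[- 'X]scaleN1r exprZn scalerA mulrC.
Qed.

Lemma splitting_field_monic (f : {poly int}) (c : rat) (L : splittingFieldType rat) (rs : seq L) :
  f \is monic -> c != 0 -> is_splitting_field (c *: map_poly (intmul 1 : int -> rat) f) rs ->
  map_poly (intmul 1 : int -> L) f = \prod_(z <- rs) ('X - z%:P).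
Proof.
move=> mf c0 [Ep _]; apply/eqP; rewrite -eqp_monic ?monic_map ?monic_prod_XsubC //.
apply: eqp_trans Ep; rewrite map_polyZ eqp_sym.
apply: eqp_trans (eqp_scale _ _) _; first by rewrite fmorph_eq0.
rewrite -map_poly_comp; apply/eqpP; exists (1, 1); rewrite ?oner_neq0 //= !scale1r.
by apply: eq_map_poly => i; rewrite /= -[RHS](rmorph_int (in_alg L)).
Qed.

(** For even [m] the weight is 1 and only the sign matters, giving m = 0 mod 4. For odd [m] the sign
    means m = 1 mod 4, so (m + 1)/2 is odd and must be the square of an odd number. *)
Lemma disc_weightP_square m : (0 < m)%N ->
  (~~ odd m./2 /\ exists t, disc_weight m m.+1 = (t ^ 2)%N) <->
  (m = 0 %[mod 4] \/ exists k : nat, m = 2 * (2 * k + 1) ^ 2 - 1)%N.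
Proof.
move=> m0; rewrite /disc_weight eqxx.
have [odm|evm] := boolP (odd m); last first.
  split=> [[om _]|[m4|[k mE]]].
  - by left; clear -om evm; lia.
  - by split; [clear -m4; lia | exists 1%N].
  - have : (0 < (2 * k + 1) ^ 2)%N by rewrite expn_gt0 addn1.
    by move: evm mE; set s := ((_ + _) ^ 2)%N; clear; lia.
split=> [[om [t tE]]|[m4|[k mE]]]; last 2 first.
- by move: odm m4; clear; lia.
- have m2 : (m.+1 = ((2 * k + 1) ^ 2).*2)%N.
    by rewrite mE mul2n subn1 prednK // double_gt0 expn_gt0 addn1.
  have sE : ((2 * k + 1) ^ 2 = (2 * (k * k + k)).*2 + 1)%N by rewrite -!mul2n; ring.
  split; last by exists (2 * k + 1)%N; rewrite m2 doubleK.
  by move: m2 sE; set s := ((_ + _) ^ 2)%N; set y := (_ * _ + _)%N; clear; lia.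
have m2 : (m.+1 = (t ^ 2).*2)%N by rewrite -tE; clear -odm; lia.
have ot : odd (t ^ 2) by clear -m2 om; lia.
rewrite oddX /= in ot; right; exists t./2.
have -> : (2 * t./2 + 1 = t)%N by clear -ot; lia.
by clear -m2; lia.
Qed.

(** In even degree m + 1 the weight is 2, never a square. In odd degree m + 1 is itself an odd
    square, hence 1 mod 8, and the sign condition holds by itself; [m >= 1] excludes k = 0. *)
Lemma disc_weightQ_square m : (0 < m)%N ->
  (~~ odd m.+1./2 /\ exists t, disc_weight m.+1 m = (t ^ 2)%N) <->
  (exists k : nat, 1 <= k /\ m = (2 * k + 1) ^ 2 - 1)%N.
Proof.
move=> m0; rewrite /disc_weight ltn_eqF //; split.
  case=> [_ [t]]; case: ifP => odm tE; last first.
    by case: t tE => [|[|t]] //; clear; nia.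
  have ot : odd t by move: odm; rewrite tE oddX.
  have t2 : (2 * t./2 + 1 = t)%N by clear -ot; lia.
  exists t./2; rewrite t2 -tE; split; last by clear; lia.
  by case: t tE ot {t2} => [|[|[|t]]] //; clear -m0; lia.
case=> k [k1 mE]; have mE' : (m.+1 = (2 * k + 1) ^ 2)%N.
  by rewrite mE subn1 prednK // expn_gt0 addn1.
have sE : ((2 * k + 1) ^ 2 = (2 * (k * k + k)).*2 + 1)%N by rewrite -!mul2n; ring.
have om : odd m.+1 by rewrite mE' oddX addn1 mul2n /= odd_double.
split; last by exists (2 * k + 1)%N; rewrite om mE'.
by rewrite mE' sE; clear; lia.
Qed.

Theorem theorem1p2 (m : nat) (m_ge1 : (1 <= m)%N)
    (irrP : irreducible_poly (padeP m m.+1))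
    (irrQ : irreducible_poly (padeQ m m.+1))
    (LP : splittingFieldType rat) (rootsP : seq LP)
    (splitsP : is_splitting_field (padeP m m.+1) rootsP)
    (LQ : splittingFieldType rat) (rootsQ : seq LQ)
    (splitsQ : is_splitting_field (padeQ m m.+1) rootsQ) :
  [/\ ('Alt_(seq_sub rootsP) \subset galois_perm rootsP)%g,
      ('Alt_(seq_sub rootsQ) \subset galois_perm rootsQ)%g,
      (galois_perm rootsP \isog 'Alt_('I_m))%g <->
        (m = 0 %[mod 4] \/ exists k : nat, m = 2 * (2 * k + 1) ^ 2 - 1)%N
    & (galois_perm rootsQ \isog 'Alt_('I_m.+1))%g <->
        (exists k : nat, 1 <= k /\ m = (2 * k + 1) ^ 2 - 1)%N].
Proof.
have sgn0 : (-1) ^+ m.+1 != 0 :> rat by rewrite signr_eq0.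
have [_ genP] := splitsP; have [_ genQ] := splitsQ.
move: irrP irrQ splitsP splitsQ; rewrite padeP_pade_poly padeQ_pade_poly => irP irQ spP spQ.
have hP := splitting_field_monic (pade_poly_monic false m m.+1) (oner_neq0 _).
rewrite scale1r in hP; have {}hP := hP _ _ spP.
have hQ := splitting_field_monic (pade_poly_monic true m.+1 m) sgn0 spQ.
have {}irQ := irreducible_poly_eqp (eqp_scale _ sgn0) irQ.
have eP : false = (m.+1 < m)%N by rewrite ltnNge leqnSn.
have eQ : true = (m < m.+1)%N by rewrite ltnSn.
have nrP : (m.+1 = m.+1 \/ m = m.+2)%N by left.
have nrQ : (m = m.+2 \/ m.+1 = m.+1)%N by right.
split.
- exact: pade_Alt_sub m_ge1 nrP eP irP hP genP.
- exact: pade_Alt_sub (ltn0Sn m) nrQ eQ irQ hQ genQ.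
- by rewrite (pade_isog_Alt m_ge1 nrP eP irP hP genP); apply: disc_weightP_square m_ge1.
- by rewrite (pade_isog_Alt (ltn0Sn m) nrQ eQ irQ hQ genQ); apply: disc_weightQ_square m_ge1.
Qed.
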